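(* Let $d\ge1$. There are positive constants $\tilde c(d)$ and $C(d)$, depending only on $d$, such that the following holds. Let $0\leq\eta\leq\tilde c(d)$ and let $\{f^{(Q)}\}_{Q\in\mathcal{D}_d}$ be any $SNBV_0$ family (that is, $f^{(Q)}\in SNBV_0(Q)$ for every $Q\in\mathcal{D}_d$). Suppose that, for every $Q\in\mathcal{D}_d$, there is a real $d\times d$ matrix $A^{(Q)}$ and a vector $y^{(Q)}\in\mathbf{R}^d$ such that $$\Vert A^{(Q)}-I_d\Vert_\infty+\Vert y^{(Q)}\Vert_\infty\leq\eta.$$ For every $Q\in\mathcal{D}_d$ define $$\widetilde{f^{(Q)}}(x):=f^{(Q)}\bigl(x_Q+A^{(Q)}(\ell(Q)y^{(Q)}+x-x_Q)\bigr).$$ Then $$\left\Vert\left\{\frac{f^{(Q)}-\widetilde{f^{(Q)}}}{|Q|^{1/2}}\right\}_{Q\in\mathcal{D}_d}\right\Vert_{AO(\mathcal{D}_d)}\leq C(d)\,\eta^{1/2}.$$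
   Context: Bessel families: a family $\{\psi_\gamma\}_{\gamma\in\Gamma}\subset L^2(\mathbf{R}^d)$ is a Bessel family if there is $0\le B<\infty$ with $\sum_{\gamma\in\Gamma}|\langle f,\psi_\gamma\rangle|^2\leq B\Vert f\Vert_2^2$ for all $f\in L^2(\mathbf{R}^d)$, where $\langle f,g\rangle=\int f\overline{g}\,dx$; the minimal such $B$ is the optimal bound. $AO(\Gamma)$ is the vector space of Bessel families indexed by $\Gamma$, and $\Vert\{\psi_\gamma\}_{\gamma\in\Gamma}\Vert_{AO(\Gamma)}$ is the square root of the optimal bound. A bound on the $AO(\Gamma)$ norm includes the assertion that the family is Bessel. Dyadic cubes: a dyadic interval is an interval $[j2^n,(j+1)2^n)$ with $j,n$ integers. A cube $Q\subset\mathbf{R}^d$ is a product of $d$ half-open intervals $[a,b)$ of the same length $\ell(Q)$; $x_Q$ is its center and $|Q|$ its Lebesgue measure. $Q$ is dyadic if all its factors are dyadic; $\mathcal{D}_d$ is the set of dyadic cubes in $\mathbf{R}^d$. $SNBV_0$: a measurable $f:\mathbf{R}^d\to\mathbf{C}$ belongs to $SNBV(\mathbf{R}^d)$ if, for every pair $(v,y)\in\mathbf{R}^d\times\mathbf{R}^d$, the function $t\mapsto f(y+tv)$ on $\mathbf{R}$ is of bounded variation with total variation $\leq1$. For a cube $Q$, $f\in SNBV(Q)$ if $f\in SNBV(\mathbf{R}^d)$ and $\{x:f(x)\neq0\}\subset Q$; $f\in SNBV_0(Q)$ if in addition $\int f\,dx=0$. Norms: for a real $d\times l$ matrix $B=[b_{ij}]$,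 $\Vert B\Vert_\infty:=\max_{1\le i\le d}\sum_{j=1}^l|b_{ij}|$; for a (column) vector, $\Vert x\Vert_\infty=\max_i|x_i|$. $I_d$ is the $d\times d$ identity. *)

(* Defs.v *)
(* MathComp-Analysis *)
From HB Require Import structures.
From mathcomp Require Import all_boot all_order all_algebra.
From mathcomp Require Import all_classical all_reals all_analysis.
From mathcomp Require Import complex.

Set Implicit Arguments.
Unset Strict Implicit.
Unset Printing Implicit Defensive.
Import Order.TTheory GRing.Theory Num.Theory.
Import numFieldNormedType.Exports.
Local Open Scope classical_set_scope.
Local Open Scope ring_scope.

Section borel_cV.
Context {R : realType} (n : nat).

Let coord (i : 'I_n) (x : 'cV[R]_n) : measurableTypeR R := x i 0.

Let borel_cV0 : g_sigma_preimage coord set0.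
Proof. exact: sigma_algebra0. Qed.

Let borel_cVC A : g_sigma_preimage coord A -> g_sigma_preimage coord (~` A).
Proof. exact: sigma_algebraC. Qed.

Let borel_cV_bigcup (F : (set 'cV[R]_n)^nat) :
  (forall i, g_sigma_preimage coord (F i)) ->
  g_sigma_preimage coord (\bigcup_i (F i)).
Proof. exact: sigma_algebra_bigcup. Qed.

HB.instance Definition _ := @isMeasurable.Build default_measure_display
  'cV[R]_n (g_sigma_preimage coord) borel_cV0 borel_cVC borel_cV_bigcup.

Lemma measurable_coord (i : 'I_n) :
  measurable_fun [set: 'cV[R]_n] (fun x => x i 0 : measurableTypeR R).
Proof.
move=> _ Y mY; rewrite setTI; apply: sub_sigma_algebra => /=.
rewrite -bigcup_seq/=; exists i => /=; first by rewrite mem_index_enum.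
by exists Y => //; rewrite setTI.
Qed.

Lemma measurable_fun_cV d (T : measurableType d) (f : T -> 'cV[R]_n) :
  (forall i, measurable_fun [set: T] (fun x => f x i 0 : measurableTypeR R)) ->
  measurable_fun [set: T] f.
Proof.
move=> mf _ Y mY.
have : g_sigma_preimage coord `<=` image_set_system [set: T] f measurable.
  apply: smallest_sub.
    exact/sigma_algebra_image/sigma_algebra_measurable.
  rewrite -bigcup_seq/=; apply: bigcup_sub => i _ _ [B mB <-].
  rewrite /image_set_system/= setTI -comp_preimage; exact: mf.
exact.
Qed.

End borel_cV.

Section product_lebesgue.
Context {R : realType}.
Local Notation mR := (measurableTypeR R).

Definition vcons n (p : mR * 'cV[R]_n) : 'cV[R]_n.+1 :=
  \col_i oapp (fun j => p.2 j 0) p.1 (unlift ord0 i).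

Definition vuncons n (x : 'cV[R]_n.+1) : mR * 'cV[R]_n :=
  (x ord0 0, \col_i x (lift ord0 i) 0).

Lemma vunconsK n : cancel (@vuncons n) (@vcons n).
Proof.
move=> x; apply/colP => i; rewrite mxE.
by case: unliftP => [j|] ->//=; rewrite mxE.
Qed.

Lemma vconsK n : cancel (@vcons n) (@vuncons n).
Proof.
move=> [a v]; rewrite /vuncons mxE unlift_none; congr pair.
by apply/colP => i; rewrite !mxE liftK.
Qed.

Lemma measurable_vcons n : measurable_fun [set: mR * 'cV[R]_n] (@vcons n).
Proof.
apply: measurable_fun_cV => i.
case: (unliftP ord0 i) => [j|] ->.
  rewrite (_ : (fun _ => _) = (fun v : 'cV[R]_n => v j 0 : mR) \o snd).
    exact: measurableT_comp (measurable_coord j) measurable_snd.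
  by apply/funext => p /=; rewrite mxE liftK.
rewrite (_ : (fun _ => _) = fst) ?measurable_fst//.
by apply/funext => p /=; rewrite mxE unlift_none.
Qed.

Lemma measurable_vuncons n : measurable_fun [set: 'cV[R]_n.+1] (@vuncons n).
Proof.
apply/measurable_fun_pairP; split; first exact: measurable_coord.
apply: measurable_fun_cV => i /=.
rewrite (_ : (fun _ => _) = (fun x : 'cV[R]_n.+1 => x (lift ord0 i) 0 : mR)).
  exact: measurable_coord.
by apply/funext => x; rewrite mxE.
Qed.

Section step.
Context n (mu : {sigma_finite_measure set 'cV[R]_n -> \bar R}).

Definition prod_step : set 'cV[R]_n.+1 -> \bar R :=
  pushforward (@lebesgue_measure R \x mu)%E (@vcons n).

Let prod_step0 : prod_step set0 = 0%E.
Proof. by rewrite /prod_step /pushforward preimage_set0 measure0. Qed.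

Let prod_step_ge0 A : (0 <= prod_step A)%E.
Proof. by rewrite /prod_step /pushforward; exact: measure_ge0. Qed.

Let prod_step_sigma_additive : semi_sigma_additive prod_step.
Proof.
move=> F mF tF mUF; rewrite /prod_step /pushforward preimage_bigcup.
apply: measure_semi_sigma_additive.
- by move=> k; rewrite -[X in measurable X]setTI; exact: measurable_vcons.
- apply/trivIsetP => /= i j _ _ ij; rewrite -preimage_setI.
  by move/trivIsetP : tF => /(_ _ _ _ _ ij) ->//; rewrite preimage_set0.
- by rewrite -preimage_bigcup -[X in measurable X]setTI; exact: measurable_vcons.
Qed.

HB.instance Definition _ := isMeasure.Build _ _ _ prod_step
  prod_step0 prod_step_ge0 prod_step_sigma_additive.

Let prod_step_sigma_finite : sigma_finite [set: 'cV[R]_n.+1] prod_step.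
Proof.
have /sigma_finiteP[F [FT ndF Foo]] := sigma_finiteT (@lebesgue_measure R).
have /sigma_finiteP[G [GT ndG Goo]] := sigma_finiteT mu.
exists (fun k => @vuncons n @^-1` (F k `*` G k)).
  rewrite -preimage_bigcup -(@preimage_setT _ _ (@vuncons n)); congr (_ @^-1` _).
  rewrite -setXTT FT GT predeqE => -[x y]; split.
    move=> [/= [i _ Fix] [j _ Gjy]]; exists (maxn i j) => //; split.
    - by move: x Fix; exact/subsetPset/ndF/leq_maxl.
    - by move: y Gjy; exact/subsetPset/ndG/leq_maxr.
  by move=> [i _ []/= ? ?]; split; exists i.
move=> k; have [mF Fk] := Foo k; have [mG Gk] := Goo k; split.
  rewrite -[X in measurable X]setTI; apply: measurable_vuncons => //.
  exact: measurableX.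
rewrite /prod_step /pushforward -comp_preimage.
rewrite (_ : @vuncons n \o @vcons n = id); last exact/funext/vconsK.
by rewrite preimage_id product_measure1E// lte_mul_pinfty// ge0_fin_numE.
Qed.

HB.instance Definition _ :=
  @Measure_isSigmaFinite.Build _ _ _ prod_step prod_step_sigma_finite.

End step.

(* The n-fold product of the Lebesgue measure on the Borel sets of R^n. *)
Fixpoint borel_lebesgue n : {sigma_finite_measure set 'cV[R]_n -> \bar R} :=
  if n is m.+1 then prod_step (borel_lebesgue m) else \d_(0 : 'cV[R]_0).

Lemma measurable_box n (A : 'I_n -> set mR) : (forall i, measurable (A i)) ->
  measurable [set x : 'cV[R]_n | forall i, A i (x i 0)].
Proof.
move=> mA; rewrite (_ : mkset _ =
    \bigcap_(i in [set: 'I_n]) ((fun x : 'cV[R]_n => x i 0) @^-1` A i)).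
  apply: fin_bigcap_measurable => // i _.
  by rewrite -[X in measurable X]setTI; exact: measurable_coord.
by apply/seteqP; split => x /= h i; [move=> _|]; exact: h.
Qed.

Lemma borel_lebesgue_box n (A : 'I_n -> set mR) :
  (forall i, measurable (A i)) ->
  borel_lebesgue n [set x : 'cV[R]_n | forall i, A i (x i 0)] =
    (\prod_(i < n) lebesgue_measure (A i))%E.
Proof.
elim: n A => [|n IH] A mA.
  by rewrite /= big_ord0 diracE mem_set//= => -[].
rewrite big_ord_recl/= /prod_step /pushforward.
rewrite (_ : _ @^-1` _ =
    A ord0 `*` [set x : 'cV[R]_n | forall i, A (lift ord0 i) (x i 0)]).
  rewrite product_measure1E//; last first.
    exact: (@measurable_box _ (fun i => A (lift ord0 i))).
  by congr (_ * _)%E; exact: (IH (fun i => A (lift ord0 i))).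
apply/seteqP; split => -[a v] /= h.
  split; first by have := h ord0; rewrite mxE unlift_none.
  by move=> i; have := h (lift ord0 i); rewrite mxE liftK.
move=> i; rewrite mxE; case: unliftP => [j|] ->; last exact: h.1.
exact: h.2.
Qed.

End product_lebesgue.

Section lebesgue_cV.
Context {R : realType} (d : nat).

(* Elements are the vectors of R^d, measurable sets the Lebesgue measurable
   ones: the Caratheodory sigma-algebra of the outer measure induced by
   borel_lebesgue is its completion. *)
Definition lebesgueType := caratheodory_type ((@borel_lebesgue R d)^*)%mu.

Definition lebesgue_cV : set lebesgueType -> \bar R :=
  @completed_measure_extension _ _ _ (@borel_lebesgue R d).

HB.instance Definition _ := Measure.on lebesgue_cV.

Let lebesgue_cV_sigma_finite : sigma_finite [set: lebesgueType] lebesgue_cV.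
Proof. exact/completed_measure_extension_sigma_finite/sigma_finiteT. Qed.

HB.instance Definition _ :=
  @Measure_isSigmaFinite.Build _ _ _ lebesgue_cV lebesgue_cV_sigma_finite.

End lebesgue_cV.
Arguments lebesgueType R d : clear implicits.

Section complex_valued.
Context {R : realType} {d : nat}.
Implicit Types f g : 'cV[R]_d -> R[i].
Local Notation mu := (@lebesgue_cV R d).
Local Notation normc := (@Normc.normc R).

Definition cmeasurable f :=
  measurable_fun [set: lebesgueType R d]
    (fun x => complex.Re (f x) : measurableTypeR R) /\
  measurable_fun [set: lebesgueType R d]
    (fun x => complex.Im (f x) : measurableTypeR R).

Definition cintegral f : R[i] :=
  (Complex (\int[mu]_x complex.Re (f x)) (\int[mu]_x complex.Im (f x)))%R.

Definition L2normsq f : \bar R := (\int[mu]_x (normc (f x) ^+ 2)%:E)%E.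

(* Functions rather than classes modulo null sets; the notions below do not
   distinguish functions that are equal almost everywhere. *)
Definition L2 f := cmeasurable f /\ (L2normsq f < +oo)%E.

Definition L2inner f g : R[i] := cintegral (fun x => f x * conjc (g x)).

Section bessel.
Context {G : choiceType}.
Implicit Types psi : G -> 'cV[R]_d -> R[i].

Definition bessel_bound psi (B : R) := 0 <= B /\ forall f, L2 f ->
  (\esum_(k in [set: G]) (normc (L2inner f (psi k)) ^+ 2)%:E
     <= B%:E * L2normsq f)%E.

Definition bessel psi :=
  (forall k, L2 (psi k)) /\ exists B, bessel_bound psi B.

Definition optimal_bound psi : R := inf [set B | bessel_bound psi B].

Lemma optimal_boundP psi :
  bessel psi -> bessel_bound psi (optimal_bound psi).
Proof.
move=> [_ [B0 B0psi]]; have hinf : has_inf [set B | bessel_bound psi B].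
  by split; [exists B0|exists 0 => B []].
split; first by apply: lb_le_inf; [exists B0|move=> B []].
move=> f Lf; have f0 : (0 <= L2normsq f)%E.
  by apply: integral_ge0 => x _; rewrite lee_fin sqr_ge0.
have h B : bessel_bound psi B -> _ := fun hB => hB.2 f Lf.
have ffin : L2normsq f \is a fin_num by rewrite ge0_fin_numE//; exact: Lf.2.
rewrite -(fineK ffin) in f0 h *; set r := fine _ in f0 h *.
have sfin : (\esum_(k in [set: G]) (normc (L2inner f (psi k)) ^+ 2)%:E)%E
    \is a fin_num.
  rewrite ge0_fin_numE; last by apply: esum_ge0 => k _; rewrite lee_fin sqr_ge0.
  by rewrite (le_lt_trans (h _ B0psi))// -EFinM ltry.
rewrite -(fineK sfin) in h *; set t := fine _ in h *.
rewrite lee_fin in f0; rewrite -EFinM lee_fin.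
have [r0|r0] := eqVneq r 0.
  by have := h _ B0psi; rewrite r0 mule0 mulr0 lee_fin.
have {f0 r0} r0 : 0 < r by rewrite lt_def r0.
rewrite -ler_pdivrMr//; apply: lb_le_inf; first by exists B0.
by move=> B /h; rewrite -EFinM lee_fin ler_pdivrMr.
Qed.

(* Meaningful for Bessel families only: inf set0 = 0, so a bound on the norm
   has to be accompanied by bessel psi. *)
Definition AO_norm psi : R := Num.sqrt (optimal_bound psi).

End bessel.

(* At most 1 entails bounded variation: the value +oo is allowed here. *)
Definition total_variation_line (h : R -> R[i]) : \bar R :=
  ereal_sup [set (\sum_(k < (size s).-1)
                    normc (h (s`_k.+1) - h (s`_k)))%:E |
             s in [set s : seq R | sorted <%R s]].

Definition SNBV f := cmeasurable f /\
  forall v y : 'cV[R]_d,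
    (total_variation_line (fun t => f (y + t *: v)%R) <= 1)%E.

End complex_valued.

Section cubes.
Context {R : realType} {d : nat}.

(* Q = (a, l) stands for the product of the intervals [a_i, a_i + l). *)
Definition cube := {Q : 'cV[R]_d * R | 0 < Q.2}.
Implicit Type Q : cube.

Definition corner Q : 'cV[R]_d := (val Q).1.
Definition side Q : R := (val Q).2.
Definition cube_center Q : 'cV[R]_d := corner Q + const_mx (side Q / 2).

Definition cube_set Q : set 'cV[R]_d :=
  [set x | forall i, corner Q i 0 <= x i 0 < corner Q i 0 + side Q].

Definition volume Q : R := fine (lebesgue_cV (cube_set Q)).

Lemma volumeE Q : volume Q = side Q ^+ d.
Proof.
have s0 : 0 < side Q by exact: (valP Q).
pose I i : set (measurableTypeR R) :=
  `[corner Q i 0, corner Q i 0 + side Q[%classic.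
have mI i : measurable (I i) by exact: measurable_itv.
have -> : volume Q = fine (\prod_(i < d) lebesgue_measure (I i))%E.
  rewrite -borel_lebesgue_box// /volume; congr fine.
  rewrite /lebesgue_cV /completed_measure_extension.
  rewrite (_ : cube_set Q = [set x : 'cV[R]_d | forall i, I i (x i 0)]).
    by rewrite measurable_mu_extE//; exact: measurable_box.
  by apply/seteqP; split => x /= h i; have := h i; rewrite /I/= in_itv.
rewrite (eq_bigr (fun=> (side Q)%:E)) => [|i _]; last first.
  rewrite lebesgue_measure_itv/= lte_fin ltrDl s0 -EFinD.
  by rewrite addrAC subrr add0r.
suff -> m : (\prod_(i < m) (side Q)%:E)%E = (side Q ^+ m)%:E by [].
elim: m => [|m IHm]; first by rewrite big_ord0.
by rewrite big_ord_recl IHm exprS EFinM.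
Qed.

Definition dyadic_interval (a b : R) :=
  exists j n : int, a = j%:~R * 2 ^ n /\ b = (j + 1)%:~R * 2 ^ n.

Definition dyadic_cubes : set cube :=
  [set Q | forall i, dyadic_interval (corner Q i 0) (corner Q i 0 + side Q)].

Definition SNBV_cube Q (f : 'cV[R]_d -> R[i]) :=
  SNBV f /\ [set x | f x != 0] `<=` cube_set Q.

Definition SNBV0 Q (f : 'cV[R]_d -> R[i]) :=
  SNBV_cube Q f /\ cintegral f = 0.

Definition perturb Q (A : 'M[R]_d) (y : 'cV[R]_d) (f : 'cV[R]_d -> R[i])
    (x : 'cV[R]_d) : R[i] :=
  f (cube_center Q + A *m (side Q *: y + x - cube_center Q)).

End cubes.
Arguments cube R d : clear implicits.
Arguments dyadic_cubes R d : clear implicits.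

(* The library norm on matrices is the largest absolute value of an entry; it
   is the right norm for vectors only. *)
Definition mx_norm_inf {R : realType} {d l : nat} (B : 'M[R]_(d, l)) : R :=
  \big[Num.max/0]_(i < d) \sum_(j < l) `|B i j|.

(* Main.v *)
Require Import Defs.
From HB Require Import structures.
From mathcomp Require Import all_boot all_order all_algebra.
From mathcomp Require Import all_classical all_reals all_analysis.
From mathcomp Require Import complex.
From mathcomp Require Import measurable_realfun.
From mathcomp Require Import ring lra.

(* Write f o T - f as a telescoping sum over 2d maps that change one coordinate:
   the linear part is factored by Gaussian elimination near the identity, the
   translation coordinate by coordinate. Pre-composition with such maps preserves
   the bound on the variation along lines, the mean value zero and, up to
   enlarging the cube, the support. It remains to treat
   D_Q = F_Q - F_Q o E_Q for real F_Q and E_Q moving coordinate i by at most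
   3 e l(Q).

   On a line, |F (t) - F (t + s)| <= U (t - delta) - U (t + delta) for |s| <= delta,
   where U is the variation to the right of a point, and the integral of the right
   side is at most 2 delta times the total variation. By Fubini this bounds
   sum_P int_P |Phi o E_P - Phi| over cubes P of side s with bounded overlap by
   C e s l^(d-1) if Phi lives on a cube of side l.

   For l(P) <= l(Q), the substitution x -> E_P x in int D_Q F_P gives
     int D_Q D_P = a int (D_Q o E_P - D_Q) F'_P + (a - 1) int D_Q F'_P,
   with F'_P = F_P o E_P, a the Jacobian and |a - 1| <= e. The first term is
   controlled as above, the second by a Poincare inequality since F'_P has mean
   value zero. Hence sum_P |int D_Q D_P| <= C e 2^-k |Q| over the cubes P of side
   2^-k l(Q), and Schur's test with weights (2/3)^(log_2 l(Q)) concludes. *)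
Set Implicit Arguments.
Unset Strict Implicit.
Unset Printing Implicit Defensive.
Import Order.TTheory GRing.Theory Num.Theory.
Import numFieldNormedType.Exports.
Local Open Scope classical_set_scope.
Local Open Scope ring_scope.
Local Open Scope complex_scope.

(** * Completion of a measure *)

(** Only one factor [e] is extracted from a product of two increments. The Gram row sums, hence the
    squared norm, are therefore linear in [eta], and the norm is of order eta^(1/2).

    The variation is bounded on every line, but the functions are only Lebesgue measurable, while
    Tonelli on products concerns Borel functions. Each function is therefore traded for a Borel one
    off a Borel null set, and maps may be composed with only if null sets have null preimages. Maps
    moving one coordinate suit this: the change of variables is one-dimensional, and the Jacobian of
    the affine ones is a constant.

    The Schur test cannot do without weights. Against smaller cubes the entries gain the ratio of
    the sides. Against larger ones there is no gain: at each scale boundedly many cubes meet P, each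
    with an entry of order e |P|, and infinitely many scales occur. Weights that decrease with the
    side spend part of the first gain to make the second sum converge.

    The threshold on [eta] keeps supports comparable to the cubes: each of the 2d maps widens the
    support by a fixed multiple of eta l(Q), and the total must not exceed l(Q) / 2. *)

Section completion.
Context {d : measure_display} {T : measurableType d} {R : realType}.
Variable mu : {sigma_finite_measure set T -> \bar R}.
Local Notation cT := (caratheodory_type (mu^*)%mu).
Local Notation cmu := (@completed_measure_extension d T R mu).
Local Open Scope ereal_scope.

Lemma measurable_caratheodory (A : set T) : measurable A ->
  measurable (A : set cT).
Proof. exact: caratheodory_measurable_mu_ext. Qed.

Lemma measurable_fun_caratheodory d' (U : measurableType d') (f : T -> U) :
  measurable_fun [set: T] f -> measurable_fun [set: cT] (f : cT -> U).
Proof.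
move=> mf _ Y mY; have := mf measurableT Y mY.
by rewrite !setTI; exact: measurable_caratheodory.
Qed.

(** A measurable hull: the outer measure is an infimum over countable covers, and intersecting
    covers that are optimal up to [k.+1%:R^-1] attains it. *)
Lemma mu_ext_cover (E : set T) : exists2 F, measurable F /\ E `<=` F &
  mu F = (mu^*)%mu E.
Proof.
have [Eoo|] := eqVneq ((mu^*)%mu E) +oo.
  exists setT => //; rewrite Eoo; apply/eqP; rewrite -leye_eq -Eoo.
  by rewrite -(measurable_mu_extE mu measurableT) le_mu_ext.
rewrite -ltey => Efin.
have fE : (mu^*)%mu E \is a fin_num by rewrite ge0_fin_numE// mu_ext_ge0.
have cov (k : nat) : exists F, [/\ measurable F, E `<=` F &
    mu F <= (mu^*)%mu E + (k.+1%:R^-1)%:E].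
  have k0 : (0 < k.+1%:R^-1 :> R)%R by rewrite invr_gt0.
  have [_ /= [A [mA EA] <-] Al] := lb_ereal_inf_adherent k0 fE.
  exists (\bigcup_m A m); split => //; first exact: bigcupT_measurable.
  apply: le_trans (ltW Al); apply: measure_sigma_subadditive => //.
  exact: bigcupT_measurable.
pose F k := projT1 (cid (cov k)).
have mF k : measurable (F k) by rewrite /F; case: cid => ? [].
have EF k : E `<=` F k by rewrite /F; case: cid => ? [].
have muF k : mu (F k) <= (mu^*)%mu E + (k.+1%:R^-1)%:E.
  by rewrite /F; case: cid => ? [].
have mI : measurable (\bigcap_k F k) by exact: bigcapT_measurable.
have EI : E `<=` \bigcap_k F k by exact: sub_bigcap.
exists (\bigcap_k F k) => //.
apply/eqP; rewrite eq_le; apply/andP; split; last first.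
  by rewrite -(measurable_mu_extE mu mI) le_mu_ext.
apply/lee_addgt0Pr => /= _/posnumP[e]; near \oo => n.
apply: (@le_trans _ _ (mu (F n))).
  by rewrite le_measure ?inE//; exact: bigcap_inf.
rewrite (le_trans (muF n))// leeD// lee_fin ltW//.
by near: n; apply: near_infty_natSinv_lt.
Unshelve. all: by end_near. Qed.

(** On a piece of finite measure take a hull of the set, then a hull [N] of the difference.
    Finiteness makes [N] null, and off [N] the set coincides with its hull. Sigma-finiteness glues
    the pieces. *)
Lemma caratheodory_null_diff (E : set cT) : measurable E ->
  exists N : set T, [/\ measurable N, mu N = 0 & measurable (E `\` N : set T)].
Proof.
move=> mE.
have [F UF mF] := sigma_finiteT mu.
have step k : exists N : set T,
    [/\ measurable N, mu N = 0 & measurable ((E `&` F k) `\` N : set T)].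
  have mEF : measurable (E `&` F k : set cT).
    by apply: measurableI => //; exact: measurable_caratheodory (mF k).1.
  have [G [mG EG] GE] := mu_ext_cover (E `&` F k).
  have mGc : measurable (G : set cT) by exact: measurable_caratheodory.
  have Efin : cmu (E `&` F k) < +oo.
    apply: le_lt_trans (mF k).2.
    rewrite -[leRHS](measurable_mu_extE mu (mF k).1).
    exact: le_mu_ext.
  have [N [mN GN] NE] := mu_ext_cover (G `\` (E `&` F k)).
  have cG : cmu G = mu G by rewrite -(measurable_mu_extE mu mG).
  exists N; split => //.
    rewrite NE; set A := E `&` F k in EG GE mEF Efin *.
    have -> : (mu^*)%mu (G `\` A) = cmu G - cmu (G `&` A).
      by rewrite -measureD//= cG GE.
    rewrite setIidr// cG GE -[cmu A]/((mu^*)%mu A) subee//.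
    by rewrite ge0_fin_numE//; exact: mu_ext_ge0.
  suff -> : (E `&` F k) `\` N = G `\` N by exact: measurableD.
  apply/seteqP; split => [x [/EG ? ?]//|x [Gx Nx]]; split => //.
  by apply: contrapT => nx; apply/Nx/GN.
pose N k := projT1 (cid (step k)).
have mN k : measurable (N k) by rewrite /N; case: cid => ? [].
have N0 k : mu (N k) = 0 by rewrite /N; case: cid => ? [].
have EN k : measurable ((E `&` F k) `\` N k : set T).
  by rewrite /N; case: cid => ? [].
exists (\bigcup_k N k); split.
- exact: bigcupT_measurable.
- apply/eqP; rewrite -measure_le0; apply: (@le_trans _ _ (\sum_(k <oo) mu (N k))).
    by apply: measure_sigma_subadditive => //; exact: bigcupT_measurable.
  by rewrite eseries0.
- rewrite (_ : _ `\` _ =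
    (\bigcup_k ((E `&` F k) `\` N k)) `\` \bigcup_k N k).
    by apply: measurableD; apply: bigcupT_measurable.
  apply/seteqP; split => x [].
    move=> Ex nx; split => //; have : setT x by []. 
    by rewrite UF => -[k _ Fx]; exists k => //; split => // Nx; apply: nx; exists k.
  by move=> [k _ [[? _]]].
Qed.

(** Only the superlevel sets at rational thresholds have to be corrected, so one null set suffices.
    Multiplying by the indicator keeps the representative defined everywhere and, for nonnegative
    [f], below [f]. *)
Lemma caratheodory_borel_rep (f : T -> R) : measurable_fun [set: cT] (f : cT -> R) ->
  exists N : set T, [/\ measurable N, mu N = 0 &
    measurable_fun [set: T] (fun x => f x * \1_(~` N) x)%R].
Proof.
move=> mf.
have step (q : rat) : exists N : set T,
    [/\ measurable N, mu N = 0 & measurable ((f @^-1` `]ratr q, +oo[) `\` N)].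
  apply: caratheodory_null_diff; rewrite -[X in measurable X]setTI; apply: mf => //.
pose N q := projT1 (cid (step q)).
have mN q : measurable (N q) by rewrite /N; case: cid => ? [].
have N0 q : mu (N q) = 0 by rewrite /N; case: cid => ? [].
have fN q : measurable ((f @^-1` `]ratr q, +oo[) `\` N q).
  by rewrite /N; case: cid => ? [].
have mUN : measurable (\bigcup_q N q) by exact: bigcupT_measurable_rat.
exists (\bigcup_q N q); split => //.
  apply/negligibleP => //; rewrite (_ : \bigcup_q N q =
      \bigcup_k if unpickle k is Some q then N q else set0).
    apply: negligible_bigcup => k; case: unpickle => [q|]; last exact: negligible_set0.
    by exists (N q); split => //; exact: N0.
  apply/seteqP; split => x [k _ kx].
    by exists (pickle k); [exact: I|rewrite pickleK].
  by move: kx; case: unpickle => [q qx|//]; exists q.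
apply: (measurability _ (RGenOInfty.measurableE R)) => // _ [_ [r ->] <-].
(* The product vanishes on the null set, which therefore belongs to the superlevel set exactly when
   [r < 0]. *)
rewrite setTI (_ : _ @^-1` _ =
    ((\bigcup_(q in [set q | (r < ratr q)%R]) ((f @^-1` `]ratr q, +oo[) `\` N q))
      `\` \bigcup_q N q) `|` (if (r < 0)%R then \bigcup_q N q else set0)).
  apply: measurableU; last by case: ifP.
  apply: measurableD => //.
  rewrite bigcup_mkcond; apply: bigcupT_measurable_rat => q.
  by case: ifP.
apply/seteqP; split => x /=; rewrite in_itv/= andbT indicE.
  have [xN|xN] := pselect ((\bigcup_q N q) x).
    by rewrite memNset//= mulr0 => ->; right.
  rewrite mem_set//= mulr1 => /rat_in_itvoo[q]; rewrite in_itv/= => /andP[rq qf].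
  left; split => //; exists q => //=; split; first by rewrite /= in_itv/= andbT.
  by move=> Nq; apply: xN; exists q.
case=> [[[q /= rq [+ nq]] xN]|].
  rewrite in_itv/= andbT => /(lt_trans rq); by rewrite mem_set//= mulr1.
by case: ifPn => // r0 xN; rewrite memNset//= ?mulr0//; apply.
Qed.

Lemma ae_caratheodory_null (N : set T) (P : T -> Prop) :
  measurable N -> mu N = 0 -> (forall x, ~ N x -> P x) -> {ae cmu, forall x, P x}.
Proof.
move=> mN N0 NP; exists N; split.
- exact: measurable_caratheodory.
- exact: etrans (measurable_mu_extE mu mN) N0.
- by move=> x /= nP; apply: contrapT => /NP.
Qed.

Lemma caratheodory_null_measurable_fun (f g : T -> R) (N : set T) :
  measurable N -> mu N = 0 -> measurable_fun [set: T] g ->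
  (forall x, ~ N x -> f x = g x) -> measurable_fun [set: cT] (f : cT -> R).
Proof.
move=> mN N0 mg fg; apply/measurable_EFinP.
apply: (@ae_measurable_fun _ _ _ cmu _ setT (EFin \o (g : cT -> R))).
- exact: measure_is_complete_caratheodory.
- apply: (@ae_caratheodory_null N) => // x /fg fgx _.
  by rewrite /= fgx.
- by apply/measurable_EFinP; exact: measurable_fun_caratheodory.
Qed.

(** Pushed forward by the identity to the original sigma-algebra, the completed measure is [mu]
    again. *)
Lemma integral_caratheodory (g : T -> \bar R) : measurable_fun [set: T] g ->
  (forall x, 0 <= g x) -> \int[cmu]_x g x = \int[mu]_x g x.
Proof.
move=> mg g0.
have mid : measurable_fun [set: cT] (id : cT -> T).
  by apply: measurable_fun_caratheodory; exact: measurable_id.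
transitivity (\int[pushforward cmu (id : cT -> T)]_x g x).
  by rewrite ge0_integral_pushforward.
apply: eq_measure_integral => A mA _; exact: (measurable_mu_extE mu mA).
Qed.

Lemma integral_caratheodory_rep (f : T -> R) (N : set T) :
  measurable_fun [set: cT] (f : cT -> R) -> (forall x, 0 <= f x)%R ->
  measurable N -> mu N = 0 ->
  measurable_fun [set: T] (fun x => f x * \1_(~` N) x)%R ->
  \int[cmu]_x (f x)%:E = \int[mu]_x (f x * \1_(~` N) x)%:E.
Proof.
move=> mf f0 mN N0 mfN.
have fN0 x : 0 <= (f x * \1_(~` N) x)%:E by rewrite lee_fin mulr_ge0.
rewrite -(@integral_caratheodory (fun x => (f x * \1_(~` N) x)%:E))//; last first.
  exact/measurable_EFinP.
apply: ge0_ae_eq_integral.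
- exact: measurableT.
- exact/measurable_EFinP.
- apply: measurable_fun_caratheodory; exact/measurable_EFinP.
- by move=> x _; rewrite lee_fin.
- by move=> x _; exact: fN0.
- apply: (@ae_caratheodory_null N) => // x Nx _.
  by rewrite indicE mem_set// mulr1.
Qed.

End completion.

(** * Variation on a line *)

Section line.
Context {R : realType}.
Local Notation mR := (measurableTypeR R).
Local Notation leb := (@lebesgue_measure R).

Lemma lebesgue_measure_affine (a c : R) (B : set mR) : 0 < a -> measurable B ->
  leb ((fun t => a * t + c) @^-1` B) = ((a^-1)%:E * leb B)%E.
Proof.
move=> a0 mB.
have mphi : measurable_fun [set: mR] (fun t : mR => a * t + c : mR).
  by apply: measurable_funD => //; exact: measurable_funM.
pose phi (t : mR) : mR := a * t + c.
have a0' : 0 <= a by exact: ltW.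
(* Read as an identity of measures, the claim reduces by uniqueness to half-open intervals. *)
suff /(_ mphi B mB) -> : forall A, measurable A ->
    leb A = mscale (NngNum a0') (pushforward leb phi) A.
  by rewrite /mscale/= /pushforward muleA -EFinM mulVf ?gt_eqF// mul1e.
move=> {}mphi; apply: lebesgue_measure_unique => _ [[x y] _ <-].
rewrite -[RHS]/(a%:E * leb (phi @^-1` `]x, y]))%E.
have -> : phi @^-1` `]x, y] = `](x - c) / a, (y - c) / a]%classic.
  apply/seteqP; split => t /=; rewrite !in_itv/= ltr_pdivrMr// ler_pdivlMr//;
  by rewrite ltrBlDr lerBrDr /phi mulrC.
rewrite !lebesgue_measure_itv/= !lte_fin ltr_pM2r ?invr_gt0// ltrD2r.
case: ifPn => _; last by rewrite mule0.
rewrite -!EFinB -EFinM; congr EFin; field; exact: lt0r_neq0.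
Qed.

Lemma integral_affine (a c : R) (g : mR -> \bar R) : 0 < a ->
  measurable_fun [set: mR] g -> (forall t, (0 <= g t)%E) ->
  (\int[leb]_t g (a * t + c)%R = (a^-1)%:E * \int[leb]_t g t)%E.
Proof.
move=> a0 mg g0.
have mphi : measurable_fun [set: mR] (fun t : mR => a * t + c : mR).
  by apply: measurable_funD => //; exact: measurable_funM.
pose phi (t : mR) : mR := a * t + c.
have a0' : 0 <= a^-1 by rewrite invr_ge0 ltW.
transitivity (\int[pushforward leb phi]_t g t)%E.
  by rewrite ge0_integral_pushforward.
transitivity (\int[mscale (NngNum a0') leb]_t g t)%E.
  by apply: eq_measure_integral => A mA _; exact: lebesgue_measure_affine.
by rewrite ge0_integral_mscale.
Qed.

Definition variation_le (h : R -> R) (V : R) := forall s : seq R,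
  sorted <%R s -> \sum_(k < (size s).-1) `|h s`_k.+1 - h s`_k| <= V.

Section variation.
Variables (h : R -> R) (V : R).
Hypothesis hV : variation_le h V.

Let tails (t : R) : set R :=
  [set \sum_(k < size s) `|h (t :: s)`_k.+1 - h (t :: s)`_k| |
    s in [set s | path <%R t s]].

Let U (t : R) : R := sup (tails t).

Let U_ub t : ubound (tails t) V.
Proof. by move=> _ [s /= ps <-]; exact: (@hV (t :: s)). Qed.

Let U_sup t : has_sup (tails t).
Proof.
split; last by exists V; exact: U_ub.
by exists 0; exists [::]; rewrite //= big_ord0.
Qed.

Let U_ge0 t : 0 <= U t.
Proof.
apply: sup_upper_bound; first exact: U_sup.
by exists [::]; rewrite //= big_ord0.
Qed.

Let U_le t : U t <= V.
Proof. by apply: ge_sup; [exact: (U_sup t).1|exact: U_ub]. Qed.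

Let U_step t t' : t < t' -> `|h t - h t'| + U t' <= U t.
Proof.
move=> tt'; rewrite addrC -lerBrDr; apply: ge_sup; first exact: (U_sup t').1.
move=> _ [s /= ps <-]; rewrite lerBrDr; apply: sup_upper_bound => //.
exists (t' :: s); first by rewrite /= tt'.
by rewrite /= big_ord_recl /= addrC distrC.
Qed.

Let U_anti t t' : t <= t' -> U t' <= U t.
Proof.
rewrite le_eqVlt => /predU1P[->//|/U_step]; apply: le_trans.
by rewrite lerDr.
Qed.

(* [U t] is the variation of [h] to the right of [t]; the dominating function
   is [U (t - delta) - U (t + delta)], and the two integrals almost cancel. *)
Lemma variation_oscillation (delta a b : R) : 0 <= delta -> a <= b ->
  exists H : mR -> R, [/\ measurable_fun [set: mR] H, forall t, 0 <= H t,
    forall t t', a <= t <= b -> `|t' - t| <= delta -> `|h t' - h t| <= H t &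
    (\int[leb]_t (H t)%:E <= (2 * delta * V)%:E)%E].
Proof.
move=> d0 ab.
(* Measurability comes from monotonicity: [h] enters the dominating function only through [U]. *)
have mU : measurable_fun [set: mR] (U : mR -> R).
  apply: nonincreasing_measurable => // x y _ _; exact: U_anti.
(* The cutoff to [[a, b]] keeps both integrals finite, so that they can be cancelled. *)
pose W := `[a, b]%classic : set mR.
have mW : measurable W by exact: measurable_itv.
have m1 c : measurable_fun [set: mR] (fun t : mR => U (1 * t + c)).
  apply: (measurableT_comp mU).
  by apply: measurable_funD => //; exact: measurable_funM.
pose H t := (U (1 * t - delta) - U (1 * t + delta)) * \1_W t.
have UU t : 0 <= U (1 * t - delta) - U (1 * t + delta).
  by rewrite subr_ge0 U_anti// lerD2l ge0_cp.
have mind (B : set mR) : measurable B -> measurable_fun [set: mR] (\1_B : mR -> R).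
  by move=> ?; exact: measurable_indic.
exists H; split.
- by apply: measurable_funM; [exact: measurable_funB|exact: mind].
- by move=> t; rewrite mulr_ge0.
- move=> t t' tab; rewrite ler_distl => /andP[t1 t2].
  rewrite /H indicE mem_set ?mulr1; last by rewrite /W/= in_itv.
  have le1 : `|h t' - h t| <= U (Num.min t t') - U (Num.max t t').
    case: (ltgtP t t') => [tt'|tt'|->].
    + by rewrite lerBrDr distrC U_step.
    + by rewrite lerBrDr U_step.
    + by rewrite !subrr normr0.
  apply: (le_trans le1); rewrite mul1r lerB// U_anti//.
    by rewrite le_min t1 andbT gerBl.
  by rewrite ge_max t2 andbT lerDl.
- pose I c := (\int[leb]_t (U (1 * t + c) * \1_W t)%:E)%E.
  have mI c : measurable_fun [set: mR] (fun t : mR => (U (1 * t + c) * \1_W t)%:E).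
    by apply/measurable_EFinP; apply: measurable_funM; [exact: m1|exact: mind].
  have mH : measurable_fun [set: mR] (EFin \o H).
    by apply/measurable_EFinP; apply: measurable_funM; [exact: measurable_funB|exact: mind].
  have HI : (\int[leb]_t (H t)%:E + I delta = I (- delta)%R)%E.
    rewrite /I -ge0_integralD//.
    + by apply: eq_integral => t _; rewrite -EFinD -mulrDl subrK.
    + by move=> t _; rewrite lee_fin mulr_ge0.
    + by move=> t _; rewrite lee_fin mulr_ge0.
  have shiftI c : I c = (\int[leb]_t (U t * \1_W (t - c))%:E)%E.
    pose g (u : mR) := (U u * \1_W (u - c))%:E.
    rewrite -[RHS]mul1e -[1%E]/(1%:E) -[in RHS]invr1.
    rewrite -(@integral_affine 1 c g) //.
    + by apply: eq_integral => t _ /=; rewrite /g mul1r addrK.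
    + apply/measurable_EFinP; apply: measurable_funM => //.
      by apply: (measurableT_comp (mind _ mW)); exact: measurable_funB.
    + by move=> t; rewrite lee_fin mulr_ge0.
  have Ifin : I delta \is a fin_num.
    rewrite ge0_fin_numE; last by apply: integral_ge0 => t _; rewrite lee_fin mulr_ge0.
    apply: (@le_lt_trans _ _ (\int[leb]_t (V%:E * (\1_W t)%:E))%E).
      apply: ge0_le_integral => //.
      + by move=> t _; rewrite lee_fin mulr_ge0.
      + by apply/measurable_EFinP; apply: measurable_funM => //; exact: mind.
      + by move=> t _; rewrite -EFinM lee_fin ler_wpM2r.
    rewrite ge0_integralZl//; last 2 first.
    - by apply/measurable_EFinP; exact: mind.
    - by rewrite lee_fin (le_trans (U_ge0 0)).
    rewrite integral_indic// setIT [X in (_ * X < _)%E]lebesgue_measure_itv; case: ifP => _.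
      by rewrite -EFinB -EFinM ltry.
    by rewrite mule0 ltry.
  have main : (I (- delta)%R <= (2 * delta * V)%:E + I delta)%E.
    have V0 : 0 <= V by rewrite (le_trans (U_ge0 0)).
    (* After the substitution [shiftI] the windows are [[a - delta, b - delta]] and
       [[a + delta, b + delta]]; the first is covered by the second and [J], and [U <= V]. *)
    pose J := `[a - delta, a + delta]%classic : set mR.
    have mJ : measurable J by exact: measurable_itv.
    have -> : (2 * delta * V)%:E = (\int[leb]_t (V%:E * (\1_J t)%:E))%E.
      rewrite ge0_integralZl//; last first.
        by apply/measurable_EFinP; exact: mind.
      rewrite integral_indic// setIT.
      rewrite [X in (_ = _ * X)%E]lebesgue_measure_itv/= lte_fin -subr_gt0.
      have -> : a + delta - (a - delta) = 2 * delta by ring.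
      case: ifPn => [_|]; first by rewrite -EFinB -EFinM; congr EFin; ring.
      rewrite -leNgt pmulr_rle0// => dle0.
      by rewrite (_ : delta = 0) ?mulr0 ?mul0r ?mule0//; apply/eqP; rewrite eq_le dle0.
    rewrite !shiftI -ge0_integralD//; first last.
    + apply/measurable_EFinP; apply: measurable_funM => //.
      by apply: (measurableT_comp (mind _ mW)); exact: measurable_funB.
    + by move=> t _; rewrite lee_fin mulr_ge0.
    + by apply/measurable_EFinP; apply: measurable_funM => //; exact: mind.
    + by move=> t _; rewrite -EFinM lee_fin mulr_ge0.
    apply: ge0_le_integral => //.
    + by move=> t _; rewrite lee_fin mulr_ge0.
    + apply/measurable_EFinP; apply: measurable_funM => //.
      by apply: (measurableT_comp (mind _ mW)); exact: measurable_funB.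
    + apply: emeasurable_funD; last first.
        apply/measurable_EFinP; apply: measurable_funM => //.
        by apply: (measurableT_comp (mind _ mW)); exact: measurable_funB.
      apply/measurable_EFinP; apply: measurable_funM; first exact: measurable_cst.
      exact: mind.
    move=> t _; rewrite -EFinM -EFinD lee_fin.
    have [tW|tW] := boolP (t - - delta \in W); last first.
      by rewrite [\1_W _]indicE (negbTE tW) mulr0 addr_ge0// mulr_ge0.
    rewrite [\1_W _]indicE tW mulr1.
    have := tW; rewrite inE /W/= in_itv/= opprK => /andP[t1 t2].
    have [tJ|tJ] := leP t (a + delta).
      rewrite [\1_J _]indicE mem_set ?mulr1; last by rewrite /J/= in_itv/= tJ andbT lerBlDr.
      by rewrite (le_trans (U_le t))// lerDl mulr_ge0.
    rewrite [\1_W _]indicE mem_set ?mulr1; last first.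
      rewrite /W/= in_itv/= lerBrDr (ltW tJ)/= lerBlDr (le_trans _ (le_trans t2 _))//.
        by rewrite lerDl.
      by rewrite lerDl.
    by rewrite lerDr mulr_ge0.
  by rewrite -HI leeD2rE in main.
Qed.

End variation.
End line.

(** * Lebesgue measure and maps moving one coordinate *)

Section coordinates.
Context {R : realType}.
Local Notation mR := (measurableTypeR R).
Local Notation leb := (@lebesgue_measure R).
Local Notation bleb := (@borel_lebesgue R).

Definition ins n (i : 'I_n.+1) (t : R) (z : 'cV[R]_n) : 'cV[R]_n.+1 :=
  \col_k oapp (fun j => z j 0) t (unlift i k).

Definition del n (i : 'I_n.+1) (x : 'cV[R]_n.+1) : 'cV[R]_n :=
  \col_j x (lift i j) 0.

Lemma ins_same n (i : 'I_n.+1) t z : ins i t z i 0 = t.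
Proof. by rewrite mxE unlift_none. Qed.

Lemma ins_lift n (i : 'I_n.+1) t z j : ins i t z (lift i j) 0 = z j 0.
Proof. by rewrite mxE liftK. Qed.

Lemma del_ins n (i : 'I_n.+1) t z : del i (ins i t z) = z.
Proof. by apply/colP => j; rewrite mxE ins_lift. Qed.

Lemma measurable_ins n (i : 'I_n.+1) :
  measurable_fun [set: mR * 'cV[R]_n] (fun p => ins i p.1 p.2).
Proof.
apply: measurable_fun_cV => k; case: (unliftP i k) => [j|] ->.
  rewrite (_ : (fun _ => _) = (fun v : 'cV[R]_n => v j 0 : mR) \o snd).
    exact: measurableT_comp (measurable_coord j) measurable_snd.
  by apply/funext => p /=; rewrite ins_lift.
rewrite (_ : (fun _ => _) = fst) ?measurable_fst//.
by apply/funext => p /=; rewrite ins_same.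
Qed.

Lemma measurable_del n (i : 'I_n.+1) : measurable_fun [set: 'cV[R]_n.+1] (@del n i).
Proof.
apply: measurable_fun_cV => j.
rewrite (_ : (fun _ => _) = (fun x : 'cV[R]_n.+1 => x (lift i j) 0 : mR)).
  exact: measurable_coord.
by apply/funext => x; rewrite mxE.
Qed.

Definition boxes n : set (set 'cV[R]_n) :=
  [set B | exists2 A : 'I_n -> set mR, (forall i, measurable (A i)) &
     B = [set x : 'cV[R]_n | forall i, A i (x i 0)]].

Lemma boxes_measurable n : @measurable _ 'cV[R]_n = <<s @boxes n >>.
Proof.
apply/seteqP; split; last first.
  apply: smallest_sub; first exact: sigma_algebra_measurable.
  by move=> _ [A mA ->]; exact: measurable_box.
apply: smallest_sub; first exact: smallest_sigma_algebra.
rewrite -bigcup_seq/=; apply: bigcup_sub => i _ _ [B mB <-].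
apply: sub_sigma_algebra; exists (fun k => if k == i then B else setT).
  by move=> k; case: ifP.
apply/seteqP; split => x /=.
  by move=> [_ Bx] k; case: eqP => [->|].
by move=> /(_ i); rewrite eqxx.
Qed.

(** The definition of [borel_lebesgue] splits off coordinate 0; this allows any other. The two
    measures agree on boxes, which generate, are stable under intersection and exhaust the space
    with finite measure. *)
Lemma borel_lebesgue_ins n (i : 'I_n.+1) (B : set 'cV[R]_n.+1) : measurable B ->
  bleb n.+1 B = (leb \x bleb n)%E ((fun p => ins i p.1 p.2) @^-1` B).
Proof.
move=> mB.
pose phi (p : mR * 'cV[R]_n) := ins i p.1 p.2.
pose g (k : nat) : set 'cV[R]_n.+1 :=
  [set x | forall j, (`[- k%:R, k%:R]%classic : set mR) (x j 0)].
have := @measure_unique _ R 'cV[R]_n.+1 (@boxes n.+1) g (@boxes_measurable n.+1)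
  _ _ _ (bleb n.+1) (pushforward (leb \x bleb n)%E phi).
move=> /(_ _ _ _ (measurable_ins i)); apply; [| | | | |exact: mB].
- move=> _ _ [A mA ->] [A' mA' ->]; exists (fun j => A j `&` A' j).
    by move=> j; exact: measurableI.
  by apply/seteqP; split => x /= => [[h1 h2] j|h]; [|split => j; case: (h j)].
- by move=> k; exists (fun=> `[- k%:R, k%:R]%classic).
- apply/seteqP; split => // x _.
  have [k kx] : exists k : nat, \sum_j `|x j 0| <= k%:R.
    exists (Num.truncn (\sum_j `|x j 0|)).+1; apply/ltW/truncnS_gt.
  exists k => // j /=; rewrite in_itv/= -ler_norml (le_trans _ kx)//.
  by rewrite (bigD1 j)//= lerDl sumr_ge0.
- move=> _ [A mA ->]; rewrite [LHS](borel_lebesgue_box mA).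
  have E : phi @^-1` [set x : 'cV[R]_n.+1 | forall j, A j (x j 0)] =
      A i `*` [set x : 'cV[R]_n | forall j, A (lift i j) (x j 0)].
    apply/seteqP; split => -[t z] /= h.
      split; first by have := h i; rewrite /phi ins_same.
      by move=> j; have := h (lift i j); rewrite ins_lift.
    move=> k; case: (unliftP i k) => [j|] ->; last by rewrite ins_same; exact: h.1.
    by rewrite ins_lift; exact: h.2.
  rewrite -[RHS]/((leb \x bleb n)%E (phi @^-1` [set x | forall j, A j (x j 0)])) E.
  have mA' : forall j, measurable (A (lift i j)) by [].
  rewrite [RHS]product_measure1E//; last exact: (measurable_box mA').
  by rewrite [X in (_ = _ * X)%E](borel_lebesgue_box mA') (bigD1_ord i).
- move=> k; rewrite [ltLHS](@borel_lebesgue_box _ _ (fun=> `[- k%:R, k%:R]%classic))//.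
  suff /andP[] : (0 <= \prod_(j < n.+1)
      lebesgue_measure (`[(- k%:R)%R, k%:R%R]%classic : set mR) < +oo)%E by [].
  elim/big_ind : _ => [|x y /andP[x0 xoo] /andP[y0 yoo]|j _].
  - by rewrite lee01 ltry.
  - by rewrite mule_ge0//= lte_mul_pinfty// ge0_fin_numE.
  - rewrite measure_ge0/= lebesgue_measure_itv/=; case: ifP => _ //.
    by rewrite -EFinB ltry.
Qed.

Lemma integral_ins n (i : 'I_n.+1) (g : 'cV[R]_n.+1 -> \bar R) :
  measurable_fun [set: 'cV[R]_n.+1] g -> (forall x, (0 <= g x)%E) ->
  (\int[bleb n.+1]_x g x = \int[bleb n]_z \int[leb]_t g (ins i t z))%E.
Proof.
move=> mg g0.
have mphi := measurable_ins i.
have mgphi : measurable_fun [set: mR * 'cV[R]_n] (fun p => g (ins i p.1 p.2)).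
  exact: measurableT_comp.
transitivity (\int[pushforward (leb \x bleb n)%E (fun p => ins i p.1 p.2)]_x g x)%E.
  by apply: eq_measure_integral => A mA _; exact: borel_lebesgue_ins.
rewrite ge0_integral_pushforward// preimage_setT.
pose h (p : mR * 'cV[R]_n) := g (ins i p.1 p.2).
transitivity (\int[(leb \x bleb n)%E]_p h p)%E; first by [].
rewrite fubini_tonelli1; [|exact: mgphi|by move=> p; exact: g0].
exact: (@fubini_tonelli _ _ _ _ _ leb (bleb n) h mgphi (fun p => g0 _)).
Qed.

End coordinates.

(** * Shears: change of variables and Tonelli along one coordinate *)

Section shear.
Context {R : realType} {n : nat}.
Local Notation mR := (measurableTypeR R).
Local Notation leb := (@lebesgue_measure R).
Local Notation bleb := (@borel_lebesgue R).
Local Notation V := 'cV[R]_n.+1.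
Local Notation LT := (lebesgueType R n.+1).
Local Notation mu := (@lebesgue_cV R n.+1).
Implicit Types (i : 'I_n.+1) (a : R) (phi : 'cV[R]_n -> R) (F G : V -> R).

(** Common form of the axis translations ([a = 1], [phi] constant) and of the maps [emap] below
    ([phi] affine). *)
Definition shear i a phi (x : V) : V := ins i (a * x i 0 + phi (del i x)) (del i x).

Definition lmeasurable F := measurable_fun [set: LT] (F : LT -> mR).

Lemma measurable_shear i a phi : measurable_fun [set: 'cV[R]_n] (phi : _ -> mR) ->
  measurable_fun [set: V] (shear i a phi).
Proof.
move=> mphi.
apply: (measurableT_comp (measurable_ins i)
  (_ : measurable_fun setT (fun x : V => (a * x i 0 + phi (del i x) : mR, del i x)))).
apply/measurable_fun_pairP; split => /=; last exact: measurable_del.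
apply: measurable_funD; first by apply: measurable_funM => //; exact: measurable_coord.
by apply: measurableT_comp => //; exact: measurable_del.
Qed.

Lemma integral_shear_borel i a phi (g : V -> \bar R) : 0 < a ->
  measurable_fun [set: 'cV[R]_n] (phi : _ -> mR) ->
  measurable_fun [set: V] g -> (forall x, (0 <= g x)%E) ->
  (\int[bleb n.+1]_x g (shear i a phi x) = (a^-1)%:E * \int[bleb n.+1]_x g x)%E.
Proof.
move=> a0 mphi mg g0.
have mgi : measurable_fun [set: mR * 'cV[R]_n] (fun p => g (ins i p.1 p.2)).
  by apply: measurableT_comp => //; exact: measurable_ins.
rewrite (@integral_ins _ _ i (fun x => g (shear i a phi x)))//; last first.
  by apply: measurableT_comp => //; exact: measurable_shear.
rewrite (integral_ins i)// -ge0_integralZl//; first last.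
- by rewrite lee_fin invr_ge0 ltW.
- by move=> z _; apply: integral_ge0.
- exact: (@measurable_fun_fubini_tonelli_G _ _ _ _ _ leb _ mgi (fun p => g0 _)).
apply: eq_integral => z _.
rewrite -(@integral_affine _ a (phi z) (fun t => g (ins i t z)))//.
  by apply: eq_integral => t _; rewrite /shear del_ins ins_same.
exact: (measurableT_comp mgi (pair2_measurable z)).
Qed.

(** Precomposition with a Borel map need not preserve Lebesgue measurability; it does once Borel
    null sets have null preimages, which the change of variables for indicators provides. *)
Lemma null_shear i a phi (N : set V) : 0 < a ->
  measurable_fun [set: 'cV[R]_n] (phi : _ -> mR) ->
  measurable N -> bleb n.+1 N = 0%E ->
  measurable (shear i a phi @^-1` N) /\ bleb n.+1 (shear i a phi @^-1` N) = 0%E.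
Proof.
move=> a0 mphi mN N0.
have mS : measurable (shear i a phi @^-1` N).
  by rewrite -[X in measurable X]setTI; exact: measurable_shear.
split => //; have := @integral_shear_borel i a phi (fun x => (\1_N x)%:E) a0 mphi.
have -> : (\int[bleb n.+1]_x (\1_N x)%:E = 0)%E by rewrite integral_indic// setIT.
rewrite mule0 (eq_integral (fun x => (\1_(shear i a phi @^-1` N) x)%:E))//.
rewrite integral_indic// setIT; apply => //.
exact/measurable_EFinP/measurable_indic.
Qed.

Lemma lmeasurable_shear i a phi F : 0 < a ->
  measurable_fun [set: 'cV[R]_n] (phi : _ -> mR) ->
  lmeasurable F -> lmeasurable (F \o shear i a phi).
Proof.
move=> a0 mphi mF.
have [N [mN N0 mFN]] := caratheodory_borel_rep mF.
have [mS S0] := null_shear i a0 mphi mN N0.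
apply: (caratheodory_null_measurable_fun (mu := bleb n.+1) mS S0
  (measurableT_comp mFN (measurable_shear i a mphi))) => x Nx.
by rewrite /= indicE mem_set ?mulr1.
Qed.

Lemma integral_shear i a phi F : 0 < a ->
  measurable_fun [set: 'cV[R]_n] (phi : _ -> mR) ->
  lmeasurable F -> (forall x, 0 <= F x) ->
  (\int[mu]_x (F (shear i a phi x))%:E = (a^-1)%:E * \int[mu]_x (F x)%:E)%E.
Proof.
move=> a0 mphi mF F0.
have [N [mN N0 mFN]] := caratheodory_borel_rep mF.
have [mS S0] := null_shear i a0 mphi mN N0.
rewrite [X in (_ * X)%E](integral_caratheodory_rep mF F0 mN N0 mFN).
rewrite -(integral_shear_borel i a0 mphi); last 2 first.
- exact/measurable_EFinP.
- by move=> x; rewrite lee_fin mulr_ge0.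
have mFs := lmeasurable_shear i a0 mphi mF.
have mFNs : measurable_fun [set: V]
    (fun x => ((F \o shear i a phi) x * \1_(~` (shear i a phi @^-1` N)) x : mR)).
  exact: (measurableT_comp mFN (measurable_shear i a mphi)).
exact: (integral_caratheodory_rep mFs (fun x => F0 _) mS S0 mFNs).
Qed.

(* The hypotheses concern every line. They therefore apply to the Borel function
   [G * \1_(~` N)] with [N] null, which lies below [G] everywhere. *)
Lemma integral_le_fubini i G (z0 : 'cV[R]_n) (r K : R) : 0 <= r -> 0 <= K ->
  lmeasurable G -> (forall x, 0 <= G x) ->
  (forall z : 'cV[R]_n, (exists j, r < `|z j 0 - z0 j 0|) -> forall t, G (ins i t z) = 0) ->
  (forall z, exists H : mR -> R, [/\ measurable_fun [set: mR] H,
     forall t, G (ins i t z) <= H t & (\int[leb]_t (H t)%:E <= K%:E)%E]) ->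
  (\int[mu]_x (G x)%:E <= (K * (2 * r) ^+ n)%:E)%E.
Proof.
move=> r0 K0 mG G0 Gout GH.
have [N [mN N0 mGN]] := caratheodory_borel_rep mG.
rewrite (integral_caratheodory_rep mG G0 mN N0 mGN).
rewrite (integral_ins i); first last.
- by move=> x; rewrite lee_fin mulr_ge0.
- exact/measurable_EFinP.
pose I j := `[z0 j 0 - r, z0 j 0 + r]%classic : set mR.
pose B := [set z : 'cV[R]_n | forall j, I j (z j 0)].
have mB : measurable B by apply: measurable_box => j; exact: measurable_itv.
have BE : bleb n B = ((2 * r) ^+ n)%:E.
  rewrite borel_lebesgue_box; last by move=> j; exact: measurable_itv.
  rewrite (eq_bigr (fun=> (2 * r)%:E)) => [|j _].
    by rewrite prodEFin; congr EFin; rewrite prodr_const card_ord.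
  rewrite lebesgue_measure_itv/= lte_fin.
  have -> : (z0 j 0 - r < z0 j 0 + r) = (0 < 2 * r) by apply/idP/idP; lra.
  case: ifPn => [_|]; first by rewrite -EFinB; congr EFin; ring.
  by rewrite -leNgt => r1; congr EFin; apply/eqP; rewrite eq_le r1 mulr_ge0.
apply: (@le_trans _ _ (\int[bleb n]_z (K%:E * (\1_B z)%:E))%E); last first.
  rewrite ge0_integralZl//; last exact/measurable_EFinP/measurable_indic.
  by rewrite integral_indic// setIT EFinM [X in (_ * X <= _)%E]BE.
have mGi : measurable_fun [set: mR * 'cV[R]_n]
    (fun p => (G (ins i p.1 p.2) * \1_(~` N) (ins i p.1 p.2))%:E).
  apply/measurable_EFinP; apply: (measurableT_comp mGN); exact: measurable_ins.
apply: ge0_le_integral => //.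
- by move=> z _; apply: integral_ge0 => t _; rewrite lee_fin mulr_ge0.
- apply: (@measurable_fun_fubini_tonelli_G _ _ _ _ _ leb _ mGi _) => p.
  by rewrite lee_fin mulr_ge0.
- apply: emeasurable_funM => //; exact/measurable_EFinP/measurable_indic.
move=> z _; have [zB|zB] := pselect (B z); last first.
  rewrite indicE memNset// mule0.
  rewrite integral0_eq// => t _.
  rewrite Gout ?mul0r//.
  move/existsNP : zB => [j zj]; exists j; rewrite ltNge; apply/negP => zj'; apply: zj.
  by rewrite /I/= in_itv/= -ler_distl.
rewrite indicE mem_set// mule1.
have [H [mH GHt HK]] := GH z; apply: le_trans HK.
apply: ge0_le_integral => //.
- by move=> t _; rewrite lee_fin mulr_ge0.
- exact: (measurableT_comp mGi (pair2_measurable z)).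
- exact/measurable_EFinP.
- move=> t _; rewrite lee_fin (le_trans _ (GHt t))//.
  by rewrite ler_piMr// indicE; case: (_ \in _).
Qed.

End shear.

(** * Bounded measurable functions supported in a box *)

Section test_functions.
Context {R : realType} {n : nat}.
Local Notation mR := (measurableTypeR R).
Local Notation leb := (@lebesgue_measure R).
Local Notation bleb := (@borel_lebesgue R).
Local Notation V := 'cV[R]_n.+1.
Local Notation LT := (lebesgueType R n.+1).
Local Notation mu := (@lebesgue_cV R n.+1).
Implicit Types (i : 'I_n.+1) (F G : V -> R) (c x : V).

Definition inbox c (r : R) x : bool := [forall j, `|x j 0 - c j 0| <= r].

Lemma inboxP c r x : reflect (forall j, `|x j 0 - c j 0| <= r) (inbox c r x).
Proof. exact: forallP. Qed.

Definition supp c r F := forall x, F x != 0 -> inbox c r x.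

Lemma supp0 c r F x : supp c r F -> ~~ inbox c r x -> F x = 0.
Proof. by move=> sF; apply: contraNeq => /sF. Qed.

Lemma lmeasurableD F G : lmeasurable F -> lmeasurable G ->
  lmeasurable (fun x => F x + G x).
Proof. exact: measurable_funD. Qed.

Lemma lmeasurableB F G : lmeasurable F -> lmeasurable G ->
  lmeasurable (fun x => F x - G x).
Proof. exact: measurable_funB. Qed.

Lemma lmeasurableM F G : lmeasurable F -> lmeasurable G ->
  lmeasurable (fun x => F x * G x).
Proof. exact: measurable_funM. Qed.

Lemma lmeasurable_cst (k : R) : lmeasurable (fun _ : V => k).
Proof. exact: measurable_cst. Qed.

Lemma lmeasurable_norm F : lmeasurable F -> lmeasurable (fun x => `|F x|).
Proof. by move=> mF; exact: measurableT_comp. Qed.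

Lemma lmeasurable_sum T (J : seq T) (F : T -> V -> R) :
  (forall p, lmeasurable (F p)) -> lmeasurable (fun x => \sum_(p <- J) F p x).
Proof. by move=> mF; apply: measurable_sum. Qed.

Lemma measurable_inbox c r : measurable [set x : V | inbox c r x].
Proof.
rewrite (_ : [set _ | _] =
  [set x : V | forall j, (`[c j 0 - r, c j 0 + r]%classic : set mR) (x j 0)]).
  apply: (@measurable_box _ _ (fun j => `[c j 0 - r, c j 0 + r]%classic : set mR)).
  by move=> j; exact: measurable_itv.
apply/seteqP; split => x /= => [/forallP h j|h].
  by rewrite in_itv/= -ler_distl.
by apply/forallP => j; have := h j; rewrite in_itv/= -ler_distl.
Qed.

Lemma measurable_fun_inbox c r :
  measurable_fun [set: V] (fun x => (inbox c r x)%:R : mR).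
Proof.
rewrite (_ : (fun _ => _) = \1_[set x | inbox c r x]).
  by apply: measurable_indic; exact: measurable_inbox.
apply/funext => x; rewrite indicE.
by have [h|/negP h] := boolP (inbox c r x); [rewrite mem_set|rewrite memNset].
Qed.

Lemma lmeasurable_inbox c r : lmeasurable (fun x => (inbox c r x)%:R).
Proof.
exact: (measurable_fun_caratheodory (mu := bleb n.+1) (measurable_fun_inbox c r)).
Qed.

(** Closed under the operations below and contained in L^1 and L^2, so that real-valued integrals
    can be split without separate integrability arguments. *)
Definition test F := [/\ lmeasurable F, exists M, forall x, `|F x| <= M &
  exists c r, supp c r F].

Lemma integral_supp_le c r F (M : R) : lmeasurable F -> (forall x, `|F x| <= M) ->
  0 <= r -> supp c r F -> (\int[mu]_x (`|F x|)%:E <= (M * (2 * r) ^+ n.+1)%:E)%E.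
Proof.
move=> mF FM r0 sF.
have M0 : 0 <= M by rewrite (le_trans _ (FM 0)).
rewrite exprS mulrA; apply: (@integral_le_fubini _ _ ord0 _ (del ord0 c)) => //.
- by rewrite !mulr_ge0.
- exact: lmeasurable_norm.
- move=> z [j zj] t; apply/normr0P; apply/eqP/(supp0 sF).
  apply/negP => /inboxP/(_ (lift ord0 j)); rewrite ins_lift leNgt.
  by move: zj; rewrite mxE => ->.
move=> z.
exists (fun t => M * \1_(`[c ord0 0 - r, c ord0 0 + r]%classic : set mR) t).
split.
- by apply: measurable_funM => //; apply: measurable_indic; exact: measurable_itv.
- move=> t; rewrite indicE; have [tI|tI] := boolP (_ \in _); first by rewrite mulr1.
  rewrite (supp0 sF) ?normr0 ?mulr0//.
  apply: contraNN tI => /inboxP/(_ ord0); rewrite ins_same => tr.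
  by rewrite inE/= in_itv/= -ler_distl.
- under eq_integral do rewrite EFinM.
  rewrite ge0_integralZl//; last first.
    by apply/measurable_EFinP; apply: measurable_indic; exact: measurable_itv.
  rewrite integral_indic// setIT [X in (_ * X <= _)%E]lebesgue_measure_itv/= lte_fin.
  have -> : (c ord0 0 - r < c ord0 0 + r) = (0 < 2 * r) by apply/idP/idP; lra.
  case: ifPn => [_|_]; last by rewrite mule0 lee_fin !mulr_ge0.
  by rewrite -EFinB -EFinM lee_fin le_eqVlt; apply/predU1P; left; ring.
Qed.

Lemma test_integrable F : test F -> mu.-integrable [set: LT] (EFin \o F).
Proof.
case=> mF [M FM] [c [r sF]]; apply/integrableP; split; first exact/measurable_EFinP.
have sF' : supp c `|r| F.
  by move=> x /sF /inboxP h; apply/inboxP => j; rewrite (le_trans (h j))// ler_norm.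
apply: (@le_lt_trans _ _ (M * (2 * `|r|) ^+ n.+1)%:E); last exact: ltry.
exact: (integral_supp_le mF FM (normr_ge0 r) sF').
Qed.

Lemma testM F G : test F -> lmeasurable G -> (exists M, forall x, `|G x| <= M) ->
  test (fun x => F x * G x).
Proof.
case=> mF [M FM] [c [r sF]] mG [M' GM]; split.
- exact: lmeasurableM.
- by exists (M * M') => x; rewrite normrM ler_pM.
- by exists c, r => x; rewrite mulf_eq0 negb_or => /andP[/sF].
Qed.

Lemma testN F : test F -> test (fun x => - F x).
Proof.
case=> mF [M FM] [c [r sF]]; split.
- exact: measurableT_comp.
- by exists M => x; rewrite normrN.
- by exists c, r => x; rewrite oppr_eq0 => /sF.
Qed.

Lemma testD F G : test F -> test G -> test (fun x => F x + G x).
Proof.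
case=> mF [M FM] [c [r sF]] [mG [M' GM] [c' [r' sG]]]; split.
- exact: lmeasurableD.
- by exists (M + M') => x; rewrite (le_trans (ler_normD _ _))// lerD.
- exists 0, (\sum_j (`|c j 0| + `|c' j 0|) + `|r| + `|r'|) => x FGx.
  apply/inboxP => j; rewrite mxE subr0 (bigD1 j)//=.
  have S0 : 0 <= \sum_(i < n.+1 | i != j) (`|c i 0| + `|c' i 0|).
    by rewrite sumr_ge0// => k _; rewrite addr_ge0.
  have := normr_ge0 (c j 0); have := normr_ge0 (c' j 0).
  have := ler_norm r; have := ler_norm r'.
  have := normr_ge0 r; have := normr_ge0 r'.
  have [Fx0|/sF/inboxP/(_ j) Fx] := eqVneq (F x) 0.
    move: FGx; rewrite Fx0 add0r => /sG/inboxP/(_ j).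
    by have := ler_normD (x j 0 - c' j 0) (c' j 0); rewrite subrK; lra.
  by move: Fx; have := ler_normD (x j 0 - c j 0) (c j 0); rewrite subrK; lra.
Qed.

Lemma testB F G : test F -> test G -> test (fun x => F x - G x).
Proof. by move=> tF tG; exact: (testD tF (testN tG)). Qed.

Lemma test_norm F : test F -> test (fun x => `|F x|).
Proof.
case=> mF [M FM] [c [r sF]]; split.
- exact: lmeasurable_norm.
- by exists M => x; rewrite normr_id.
- by exists c, r => x; rewrite normr_eq0 => /sF.
Qed.

Lemma testZ (k : R) F : test F -> test (fun x => k * F x).
Proof.
case=> mF [M FM] [c [r sF]]; split.
- exact: (lmeasurableM (@lmeasurable_cst k)).
- by exists (`|k| * M) => x; rewrite normrM ler_wpM2l.
- by exists c, r => x; rewrite mulf_eq0 negb_or => /andP[_ /sF].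
Qed.

Lemma Rintegral_test_ge0 F (B : R) : test F -> (forall x, 0 <= F x) ->
  (\int[mu]_x (F x)%:E <= B%:E)%E -> \int[mu]_x F x <= B.
Proof.
move=> tF F0 FB; rewrite -lee_fin /Rintegral fineK//.
by apply: integrable_fin_num => //; exact: test_integrable.
Qed.

End test_functions.

(** * Integral estimates for functions of bounded variation along lines *)

Section EFin_integral.
Context {d : measure_display} {T : measurableType d} {R : realType}.
Variable m : {measure set T -> \bar R}.
Implicit Types F G : T -> R.
Local Open Scope ereal_scope.

Lemma integral_EFinD F G : measurable_fun [set: T] F -> measurable_fun [set: T] G ->
  (forall x, 0 <= F x)%R -> (forall x, 0 <= G x)%R ->
  \int[m]_x (F x + G x)%:E = \int[m]_x (F x)%:E + \int[m]_x (G x)%:E.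
Proof.
move=> mF mG F0 G0; under eq_integral do rewrite EFinD.
by rewrite ge0_integralD//; try exact/measurable_EFinP; move=> x _; rewrite lee_fin.
Qed.

Lemma le_integral_EFin F G : measurable_fun [set: T] F -> measurable_fun [set: T] G ->
  (forall x, 0 <= F x <= G x)%R -> \int[m]_x (F x)%:E <= \int[m]_x (G x)%:E.
Proof.
move=> mF mG FG; apply: ge0_le_integral => //; try exact/measurable_EFinP.
- by move=> x _; rewrite lee_fin; case/andP: (FG x).
- by move=> x _; rewrite lee_fin; case/andP: (FG x).
Qed.

Lemma integral_EFinZ (k : R) F : measurable_fun [set: T] F -> (forall x, 0 <= F x)%R ->
  (0 <= k)%R -> \int[m]_x (k * F x)%:E = k%:E * \int[m]_x (F x)%:E.
Proof.
move=> mF F0 k0; under eq_integral do rewrite EFinM.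
rewrite ge0_integralZl//; first exact/measurable_EFinP.
by move=> x _; rewrite lee_fin.
Qed.

Lemma integral_EFin_sum (I : Type) (J : seq I) (F : I -> T -> R) :
  (forall p, measurable_fun [set: T] (F p)) -> (forall p x, 0 <= F p x)%R ->
  \int[m]_x (\sum_(p <- J) F p x)%:E = \sum_(p <- J) \int[m]_x (F p x)%:E.
Proof.
move=> mF F0; under eq_integral do rewrite -sumEFin.
rewrite ge0_integral_sum//; first by move=> p; exact/measurable_EFinP.
by move=> p x _; rewrite lee_fin.
Qed.

End EFin_integral.

(** * Increments under displacements of one coordinate and under translations *)

Section shifts.
Context {R : realType} {n : nat}.
Local Notation mR := (measurableTypeR R).
Local Notation leb := (@lebesgue_measure R).
Local Notation bleb := (@borel_lebesgue R).
Local Notation V := 'cV[R]_n.+1.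
Local Notation LT := (lebesgueType R n.+1).
Local Notation mu := (@lebesgue_cV R n.+1).
Implicit Types (i : 'I_n.+1) (F G Phi : V -> R) (c x : V).

Definition variation_along i F (W : R) :=
  forall z, variation_le (fun t => F (ins i t z)) W.

(** The function that dominates the oscillation on a line serves all displacements of size at most
    [delta] at once. At each point the sum is thus at most [N] times that function, however many
    indices there are. Its integral over the line is bounded, and the other [n] coordinates range
    over a box of side [2 * r]. *)
Lemma integral_shift_sum i Phi c (r W delta : R) (T : eqType) (J : seq T)
    (B : T -> V -> bool) (E : T -> V -> V) (N : nat) :
  0 <= r -> 0 <= W -> 0 <= delta -> supp c r Phi -> variation_along i Phi W ->
  (forall p x, B p x -> exists2 t, E p x = ins i t (del i x) & `|t - x i 0| <= delta) ->
  (forall x, (count (B^~ x) J <= N)%N) ->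
  lmeasurable (fun x => \sum_(p <- J) (B p x)%:R * `|Phi (E p x) - Phi x|) ->
  (\int[mu]_x (\sum_(p <- J) (B p x)%:R * `|Phi (E p x) - Phi x|)%:E <=
    (N%:R * (2 * delta * W) * (2 * r) ^+ n)%:E)%E.
Proof.
move=> r0 W0 d0 sPhi vPhi BE BN mG.
apply: (integral_le_fubini (i := i) (z0 := del i c) r0 _ mG).
- by rewrite !mulr_ge0.
- by move=> x; apply: sumr_ge0 => p _; rewrite mulr_ge0.
- move=> z [j zj] t.
  have out t' : Phi (ins i t' z) = 0.
    apply: (supp0 sPhi); apply/negP => /inboxP/(_ (lift i j)).
    by rewrite ins_lift leNgt; move: zj; rewrite mxE => ->.
  apply: big1 => p _; have [/BE[t' -> _]|] := boolP (B p _); last by rewrite mul0r.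
  by rewrite del_ins !out subrr normr0 mulr0.
move=> z.
(* Off the interval enlarged by [delta], both [Phi x] and [Phi (E p x)] vanish. *)
have [||H [mH H0 Hosc HI]] := @variation_oscillation _ _ _ (vPhi z) delta
  (c i 0 - (r + delta)) (c i 0 + (r + delta)) => //.
  by have : 0 <= r + delta by [rewrite addr_ge0]; lra.
exists (fun t => N%:R * H t); split.
- by apply: measurable_funM.
- move=> t.
  have [tI|tI] := boolP (c i 0 - (r + delta) <= t <= c i 0 + (r + delta)).
    apply: (@le_trans _ _ (\sum_(p <- J) (B p (ins i t z))%:R * H t)).
      apply: ler_sum => p _; have [/BE[t' -> tt']|] := boolP (B p _); last first.
        by rewrite !mul0r.
      by rewrite !mul1r del_ins; apply: Hosc => //; rewrite ins_same in tt'.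
    rewrite -mulr_suml ler_wpM2r//.
    rewrite -natr_sum ler_nat (leq_trans _ (BN (ins i t z)))// -sum1_count [leqRHS]big_mkcond.
    by apply: leq_sum => p _; case: (B p _).
  have out t' : `|t' - t| <= delta -> Phi (ins i t' z) = 0.
    move=> tt'; apply: (supp0 sPhi); apply: contraNN tI => /inboxP/(_ i).
    rewrite ins_same !ler_distl => /andP[t1 t2].
    by move: tt'; rewrite ler_distl => /andP[t3 t4]; apply/andP; lra.
  rewrite big1 ?mulr_ge0// => p _.
  have [/BE[t' -> tt']|] := boolP (B p _); last by rewrite mul0r.
  rewrite ins_same in tt'; rewrite del_ins (out _ tt') out ?subrr ?normr0 ?mulr0//.
- under eq_integral do rewrite EFinM.
  rewrite ge0_integralZl//; last 2 first.
  + exact/measurable_EFinP.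
  + by move=> t _; rewrite lee_fin.
  by rewrite EFinM lee_wpmul2l.
Qed.

Lemma ins_add_delta i (h : R) x :
  x + h *: delta_mx i 0 = ins i (x i 0 + h) (del i x).
Proof.
apply/colP => k; rewrite 3!mxE eqxx andbT.
case: (unliftP i k) => [j|] ->; last by rewrite ins_same eqxx mulr1.
by rewrite ins_lift mxE eq_sym (negbTE (neq_lift _ _)) mulr0 addr0.
Qed.

Lemma ins_shear_delta i (h : R) x :
  x + h *: delta_mx i 0 = shear i 1 (fun=> h) x.
Proof. by rewrite ins_add_delta /shear mul1r. Qed.

Lemma col_sum_delta (h : V) : h = \sum_(j <- enum 'I_n.+1) h j 0 *: delta_mx j 0.
Proof.
rewrite big_enum/= {1}[h]matrix_sum_delta; apply: eq_bigr => j _.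
by rewrite big_ord1.
Qed.

Lemma lmeasurable_translate F (h : V) : lmeasurable F ->
  lmeasurable (fun x => F (x + h)).
Proof.
rewrite (col_sum_delta h); elim: (enum _) => [|j l IH] mF.
  by under eq_fun do rewrite big_nil addr0.
under eq_fun do rewrite big_cons addrA ins_shear_delta.
have mk : measurable_fun [set: 'cV[R]_n] (fun _ => h j 0 : mR) by [].
exact: (lmeasurable_shear j ltr01 mk (IH mF)).
Qed.

Lemma integral_translate F (h : V) : lmeasurable F -> (forall x, 0 <= F x) ->
  (\int[mu]_x (F (x + h))%:E = \int[mu]_x (F x)%:E)%E.
Proof.
rewrite (col_sum_delta h); elim: (enum _) => [|j l IH] mF F0.
  by under eq_integral do rewrite big_nil addr0.
under eq_integral do rewrite big_cons addrA ins_shear_delta.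
pose h' := \sum_(k <- l) h k 0 *: delta_mx k 0 : V.
rewrite (@integral_shear _ _ _ _ _ (fun x => F (x + h'))) ?invr1 ?mul1e ?IH//.
exact: lmeasurable_translate.
Qed.

(** The translation is made one coordinate at a time. By translation invariance the shift by the
    remaining coordinates does not affect the integral of a single-coordinate difference, so each
    coordinate costs one use of [integral_shift_sum]. *)
Lemma integral_translation_diff Phi c (r W delta : R) (h : V) :
  0 <= r -> 0 <= W -> 0 <= delta ->
  lmeasurable Phi -> supp c r Phi -> (forall i, variation_along i Phi W) ->
  (forall j, `|h j 0| <= delta) ->
  (\int[mu]_x (`|Phi (x + h) - Phi x|)%:E <=
    (n.+1%:R * (2 * delta * W) * (2 * r) ^+ n)%:E)%E.
Proof.
move=> r0 W0 d0 mPhi sPhi vPhi hd; rewrite (col_sum_delta h).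
rewrite -[in leRHS](size_enum_ord n.+1).
elim: (enum _) => [|j l IH].
  rewrite (eq_integral (fun=> 0%E)) => [|x _]; last by rewrite big_nil addr0 subrr normr0.
  by rewrite integral0 lee_fin !mul0r.
pose h' := \sum_(k <- l) h k 0 *: delta_mx k 0 : V.
rewrite big_cons -/h'.
pose D x := `|Phi (x + h j 0 *: delta_mx j 0) - Phi x|.
have mD : lmeasurable D.
  by apply: lmeasurable_norm; apply: lmeasurableB => //; exact: lmeasurable_translate.
have mD' : lmeasurable (fun x => `|Phi (x + h') - Phi x|).
  by apply: lmeasurable_norm; apply: lmeasurableB => //; exact: lmeasurable_translate.
have mDh := lmeasurable_translate h' mD.
have mDD : lmeasurable (fun x => D (x + h') + `|Phi (x + h') - Phi x|).
  exact: lmeasurableD.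
have mL : lmeasurable (fun x => `|Phi (x + (h j 0 *: delta_mx j 0 + h')) - Phi x|).
  by apply: lmeasurable_norm; apply: lmeasurableB => //; exact: lmeasurable_translate.
apply: (le_trans (le_integral_EFin mu mL mDD _)).
  move=> x; rewrite normr_ge0/= /D addrA (addrAC x).
  by rewrite (le_trans _ (ler_normD _ _))// addrA subrK.
rewrite (integral_EFinD mu mDh mD' (fun x => normr_ge0 _) (fun x => normr_ge0 _)).
rewrite (integral_translate _ mD (fun x => normr_ge0 _)) [size _]/=.
rewrite -[(size l).+1]add1n natrD.
move: IH; set K := 2 * delta * W; set P := (2 * r) ^+ n => IH.
rewrite !mulrDl EFinD /K /P {K P} in IH *.
apply: leeD; last exact: IH.
(* A family with a single index, hence overlap 1. *)
have := @integral_shift_sum j Phi c r W delta unit [:: tt] (fun _ _ => true)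
  (fun _ x => x + h j 0 *: delta_mx j 0) 1.
have E x : \sum_(p <- [:: tt]) true%:R * `|Phi (x + h j 0 *: delta_mx j 0) - Phi x| = D x.
  by rewrite big_seq1 mul1r.
under eq_integral do rewrite E.
apply => //.
- move=> _ x _; exists (x j 0 + h j 0); first exact: ins_add_delta.
  by rewrite addrAC subrr add0r.
- by under eq_fun do rewrite E.
Qed.

End shifts.

(** * Pairing with functions of mean value zero: a Poincare inequality *)

Section mean_zero.
Context {R : realType} {n : nat}.
Local Notation mR := (measurableTypeR R).
Local Notation bleb := (@borel_lebesgue R n.+1).
Local Notation V := 'cV[R]_n.+1.
Local Notation mu := (@lebesgue_cV R n.+1).
Implicit Types (i : 'I_n.+1) (F G Phi : V -> R) (c x : V).

Lemma integral_translate_borel (g : V -> \bar R) (h : V) :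
  measurable_fun [set: V] g -> (forall x, (0 <= g x)%E) ->
  (\int[bleb]_x g (x + h)%R = \int[bleb]_x g x)%E.
Proof.
move=> mg g0; rewrite (col_sum_delta h).
suff: measurable_fun [set: V] (fun x => g (x + \sum_(j <- enum 'I_n.+1) h j 0 *: delta_mx j 0)) /\
  (\int[bleb]_x g (x + \sum_(j <- enum 'I_n.+1) h j 0 *: delta_mx j 0)%R = \int[bleb]_x g x)%E.
  by case.
elim: (enum _) => [|j l [IHm IH]].
  by split; [under eq_fun do rewrite big_nil addr0|under eq_integral do rewrite big_nil addr0].
have mk : measurable_fun [set: 'cV[R]_n] (fun _ => h j 0 : mR) by [].
split.
  under eq_fun do rewrite big_cons addrA ins_shear_delta.
  exact: (measurableT_comp IHm (measurable_shear j 1 mk)).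
under eq_integral do rewrite big_cons addrA ins_shear_delta.
have := @integral_shear_borel _ _ j 1 (fun=> h j 0)
  (fun x => g (x + \sum_(k <- l) h k 0 *: delta_mx k 0)) ltr01 mk IHm (fun _ => g0 _).
by rewrite invr1 mul1e IH.
Qed.

Lemma measurable_addV : measurable_fun [set: V * V] (fun p => p.1 + p.2).
Proof.
apply: measurable_fun_cV => j.
rewrite (_ : (fun _ => _) = (fun p : V * V => (p.1 j 0 : mR) + (p.2 j 0 : mR))); last first.
  by apply/funext => p; rewrite mxE.
apply: measurable_funD.
- exact: (measurableT_comp (measurable_coord j) measurable_fst).
- exact: (measurableT_comp (measurable_coord j) measurable_snd).
Qed.

Lemma measurable_subV : measurable_fun [set: V * V] (fun p => p.2 - p.1).
Proof.
apply: measurable_fun_cV => j.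
rewrite (_ : (fun _ => _) = (fun p : V * V => (p.2 j 0 : mR) - (p.1 j 0 : mR))); last first.
  by apply/funext => p; rewrite !mxE.
apply: measurable_funB.
- exact: (measurableT_comp (measurable_coord j) measurable_snd).
- exact: (measurableT_comp (measurable_coord j) measurable_fst).
Qed.

Lemma integral_inbox c (r : R) : 0 <= r ->
  (\int[bleb]_x ((inbox c r x)%:R)%:E = ((2 * r) ^+ n.+1)%:E)%E.
Proof.
move=> r0.
pose I j := `[c j 0 - r, c j 0 + r]%classic : set mR.
rewrite (eq_integral (fun x => (\1_[set x : V | forall j, I j (x j 0)] x)%:E)); last first.
  move=> x _; rewrite indicE; congr (_%:R)%:E; congr nat_of_bool; apply/idP/idP.
    by move=> /inboxP xc; rewrite inE => j; rewrite /I/= in_itv/= -ler_distl.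
  by rewrite inE => h; apply/inboxP => j; have := h j; rewrite /I/= in_itv/= -ler_distl.
have mI j : measurable (I j) by exact: measurable_itv.
rewrite integral_indic//; last exact: measurable_box.
rewrite setIT [LHS](borel_lebesgue_box mI).
rewrite (eq_bigr (fun=> (2 * r)%:E)) => [|j _].
  by rewrite prodEFin; congr EFin; rewrite prodr_const card_ord.
rewrite lebesgue_measure_itv/= lte_fin.
have -> : (c j 0 - r < c j 0 + r) = (0 < 2 * r) by apply/idP/idP; lra.
case: ifPn => [_|]; first by rewrite -EFinB; congr EFin; ring.
by rewrite -leNgt => r1; congr EFin; apply/eqP; rewrite eq_le r1 mulr_ge0.
Qed.

(** Mean value zero allows any constant [k] to be subtracted from [Phi]. The bound is in terms of a
    Borel version [PhiN] because [k] will be a value [PhiN y], integrated over [y] by Tonelli on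
    [V * V]. *)
Lemma Rintegral_mean_zero_le Phi (PhiN : V -> R) (N : set V) F c rho (k : R) :
  test Phi -> measurable N -> bleb N = 0%E ->
  measurable_fun [set: V] (PhiN : V -> mR) ->
  (forall x, ~ N x -> PhiN x = Phi x) ->
  lmeasurable F -> (forall x, `|F x| <= 1) -> supp c rho F -> \int[mu]_x F x = 0 ->
  ((`|\int[mu]_x (Phi x * F x)|)%:E <=
    \int[bleb]_x ((inbox c rho x)%:R * `|PhiN x - k|)%:E)%E.
Proof.
move=> tPhi mN N0 mPhiN PhiE mF F1 sF IF.
have tF : test F by split => //; [exists 1|exists c, rho].
have bF : exists M, forall x, `|F x| <= M by exists 1.
have [mPhi [M PhiM] _] := tPhi.
have tPF : test (fun x => Phi x * F x) by exact: testM.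
have tkF : test (fun x => k * F x) by exact: testZ.
have -> : \int[mu]_x (Phi x * F x) = \int[mu]_x (Phi x * F x - k * F x).
  rewrite (RintegralB measurableT (test_integrable tPF) (test_integrable tkF)).
  by rewrite (RintegralZl _ measurableT (test_integrable tF)) IF mulr0 subr0.
have tD : test (fun x => Phi x * F x - k * F x) by exact: testB.
have iD := test_integrable tD.
rewrite (EFin_normr_Rintegral measurableT iD).
have [mD _ _] := tD.
apply: (le_trans (le_abse_integral _ measurableT _)); first exact/measurable_EFinP.
pose f x := (inbox c rho x)%:R * `|Phi x - k|.
have mf : lmeasurable f.
  apply: lmeasurableM; first exact: lmeasurable_inbox.
  by apply: lmeasurable_norm; apply: lmeasurableB => //; exact: lmeasurable_cst.
have f0 x : 0 <= f x by rewrite mulr_ge0.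
apply: (@le_trans _ _ (\int[mu]_x (f x)%:E)%E).
  apply: (le_integral_EFin mu (lmeasurable_norm mD) mf) => x.
  rewrite normr_ge0/= -mulrBl normrM /f.
  have [xc|xc] := boolP (inbox c rho x); first by rewrite mul1r ler_piMr.
  by rewrite (supp0 sF xc) normr0 mulr0 mul0r.
pose fN x := (inbox c rho x)%:R * `|PhiN x - k|.
have mfN : measurable_fun [set: V] (fN : V -> mR).
  apply: measurable_funM; first exact: measurable_fun_inbox.
  by apply: measurableT_comp => //; exact: measurable_funB.
have mfN' : measurable_fun [set: V] (fun x => f x * \1_(~` N) x : mR).
  rewrite (_ : (fun _ => _) = (fun x => fN x * \1_(~` N) x)).
    by apply: measurable_funM => //; apply: measurable_indic; exact: measurableC.
  apply/funext => x; rewrite indicE; have [Nx|Nx] := pselect (N x).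
    by rewrite memNset ?mulr0//=; apply.
  by rewrite /f /fN PhiE.
rewrite (integral_caratheodory_rep mf f0 mN N0 mfN').
apply: (le_integral_EFin bleb mfN' mfN) => x.
rewrite mulr_ge0//= indicE; have [Nx|Nx] := pselect (N x).
  by rewrite memNset ?mulr0 ?mulr_ge0//=; apply.
by rewrite mem_set// mulr1 /f /fN PhiE.
Qed.

(* [int Phi F_p = int (Phi - Phi y) F_p] for each [y]; average over [y] in the box
   and substitute [x = y + h]. *)
Lemma mean_zero_sum Phi c (r W : R) (T : eqType) (J : seq T) (F : T -> V -> R)
    (cc : T -> V) (rho : R) (N : nat) :
  0 <= r -> 0 <= W -> 0 < rho -> test Phi -> supp c r Phi ->
  (forall i, variation_along i Phi W) ->
  (forall p, p \in J -> [/\ lmeasurable (F p), forall x, `|F p x| <= 1,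
     supp (cc p) rho (F p) & \int[mu]_x F p x = 0]) ->
  (forall x, (count (fun p => inbox (cc p) rho x) J <= N)%N) ->
  \sum_(p <- J) `|\int[mu]_x (Phi x * F p x)| <=
    N%:R * (n.+1%:R * (2 * (2 * rho) * W) * (2 * r) ^+ n) * 2 ^+ n.+1.
Proof.
move=> r0 W0 rho0 tPhi sPhi vPhi hF BN.
have [mPhi _ _] := tPhi.
have [M [mM M0 mPM]] := caratheodory_borel_rep mPhi.
pose PM x := Phi x * \1_(~` M) x.
have PME x : ~ M x -> PM x = Phi x.
  by move=> Mx; rewrite /PM indicE mem_set// mulr1.
pose a p := `|\int[mu]_x (Phi x * F p x)|.
pose b p x : R := (inbox (cc p) rho x)%:R.
pose dP (q : V * V) := `|PM q.2 - PM q.1|.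
have mdP : measurable_fun [set: V * V] (dP : V * V -> mR).
  apply: measurableT_comp => //; apply: measurable_funB.
  - exact: (measurableT_comp mPM measurable_snd).
  - exact: (measurableT_comp mPM measurable_fst).
pose Q := (bleb \x bleb)%E.
pose g p (q : V * V) := b p q.1 * b p q.2 * dP q.
have mb p : measurable_fun [set: V] (b p : V -> mR) by exact: measurable_fun_inbox.
have mg p : measurable_fun [set: V * V] (g p : V * V -> mR).
  apply: measurable_funM => //; apply: measurable_funM.
  - exact: (measurableT_comp (mb p) measurable_fst).
  - exact: (measurableT_comp (mb p) measurable_snd).
have b0 p x : 0 <= b p x by exact: ler0n.
have dP0 q : 0 <= dP q by exact: normr_ge0.
have g0 p q : 0 <= g p q by rewrite /g !mulr_ge0.
have mgE p : measurable_fun [set: V * V] (fun q => (g p q)%:E).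
  by apply/measurable_EFinP; exact: mg.
(* Take [k = PM y] and integrate over [y] in the box of [p]; its volume appears on the left. *)
have step1 p : p \in J -> (((2 * rho) ^+ n.+1 * a p)%:E <= \int[Q]_q (g p q)%:E)%E.
  move=> pJ; have [mF F1 sF IF] := hF p pJ.
  rewrite (fubini_tonelli1 _ (mgE p)); last by move=> q; rewrite lee_fin.
  rewrite EFinM -(integral_inbox (cc p) (ltW rho0)) muleC.
  rewrite -(integral_EFinZ _ (mb p) (b0 p) (normr_ge0 _)).
  apply: ge0_le_integral => //.
  - by move=> y _; rewrite lee_fin mulr_ge0// normr_ge0.
  - by apply/measurable_EFinP; apply: measurable_funM => //; exact: mb.
  - apply: (@measurable_fun_fubini_tonelli_F _ _ _ _ _ bleb _ (mgE p)) => q.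
    by rewrite lee_fin.
  move=> y _; rewrite -/(b p y) /fubini_F.
  rewrite (eq_integral (fun x => (b p y * (b p x * `|PM x - PM y|))%:E)); last first.
    by move=> x _; rewrite /g/= mulrA.
  have mbP : measurable_fun [set: V] (fun x => b p x * `|PM x - PM y| : mR).
    apply: measurable_funM; first exact: mb.
    apply: measurableT_comp; first by [].
    by apply: measurable_funB; [exact: mPM|exact: measurable_cst].
  rewrite (integral_EFinZ _ mbP); last 2 first.
  - by move=> x; rewrite mulr_ge0.
  - exact: b0.
  rewrite mulrC EFinM lee_wpmul2l ?lee_fin//.
  exact: (Rintegral_mean_zero_le (PM y) tPhi mM M0 mPM PME mF F1 sF IF).
pose K := n.+1%:R * (2 * (2 * rho) * W) * (2 * r) ^+ n.
have K0 : 0 <= K.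
  have rho0' := ltW rho0.
  by rewrite /K mulr_ge0 ?exprn_ge0 ?mulr_ge0.
have step2 : (\int[Q]_q (\sum_(p <- J) g p q)%:E <= (N%:R * K * (2 * (2 * rho)) ^+ n.+1)%:E)%E.
  (* Two points of a box of radius [rho] differ by at most [s] in each coordinate, and at most [N]
     boxes contain a given point: hence the majorant [e]. *)
  pose s := 2 * rho.
  have s0 : 0 <= s by rewrite mulr_ge0// ltW.
  pose e (q : V * V) := N%:R * ((inbox 0 s (q.2 - q.1))%:R * dP q).
  have me : measurable_fun [set: V * V] (e : V * V -> mR).
    apply: measurable_funM => //; apply: measurable_funM => //.
    exact: (measurableT_comp (measurable_fun_inbox 0 s) measurable_subV).
  have e0 q : 0 <= e q by rewrite !mulr_ge0.
  have msum : measurable_fun [set: V * V] (fun q => \sum_(p <- J) g p q : mR).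
    by apply: measurable_sum.
  apply: (@le_trans _ _ (\int[Q]_q (e q)%:E)%E).
    apply: (le_integral_EFin Q msum me) => q; apply/andP; split; first exact: sumr_ge0.
    rewrite /e mulrA; under eq_bigr do rewrite /g.
    rewrite -mulr_suml ler_wpM2r//.
    have [sq|sq] := boolP (inbox 0 s (q.2 - q.1)); last first.
      rewrite mulr0 big1// => p _; rewrite /b.
      case: (boolP (inbox (cc p) rho q.1)) => [/inboxP h1|_]; last by rewrite mul0r.
      case: (boolP (inbox (cc p) rho q.2)) => [/inboxP h2|_]; last by rewrite mulr0.
      case/negP: sq; apply/inboxP => j.
      move: (h1 j) (h2 j); rewrite !mxE subr0 !ler_distl /s => /andP[? ?] /andP[? ?].
      by apply/andP; split; lra.
    rewrite mulr1 (@le_trans _ _ (\sum_(p <- J) b p q.1))//.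
      by apply: ler_sum => p _; rewrite ler_piMr// /b; case: inbox.
    rewrite /b -natr_sum ler_nat (leq_trans _ (BN q.1))// -sum1_count [leqRHS]big_mkcond.
    by apply: leq_sum => p _; case: inbox.
  have meE : measurable_fun [set: V * V] (fun q => (e q)%:E) by exact/measurable_EFinP.
  rewrite (fubini_tonelli1 _ meE); last by move=> q; rewrite lee_fin.
  (* The same integrand after [x = y + h]. With [h] outermost, the inner integral is a translation
     difference. *)
  pose e' (q : V * V) := N%:R * ((inbox 0 s q.2)%:R * `|PM (q.1 + q.2) - PM q.1|).
  have me' : measurable_fun [set: V * V] (e' : V * V -> mR).
    apply: measurable_funM => //; apply: measurable_funM => //.
      exact: (measurableT_comp (measurable_fun_inbox 0 s) measurable_snd).
    apply: measurableT_comp => //; apply: measurable_funB.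
    - exact: (measurableT_comp mPM measurable_addV).
    - exact: (measurableT_comp mPM measurable_fst).
  have e'0 q : 0 <= e' q by rewrite !mulr_ge0.
  have me'E : measurable_fun [set: V * V] (fun q => (e' q)%:E) by exact/measurable_EFinP.
  have eE y : (\int[bleb]_x (e (y, x))%:E = \int[bleb]_h (e' (y, h))%:E)%E.
    have mey : measurable_fun [set: V] (fun x => (e (y, x))%:E).
      exact: (measurableT_comp meE (pair1_measurable y)).
    rewrite -(integral_translate_borel y mey); last by move=> x; rewrite lee_fin.
    by apply: eq_integral => h _; rewrite /e /e' /dP/= addrK (addrC h).
  under eq_integral do rewrite /fubini_F eE.
  rewrite (fubini_tonelli _ me'E); last by move=> q; rewrite lee_fin.
  have NK0 : 0 <= N%:R * K by rewrite mulr_ge0.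
  rewrite EFinM -(integral_inbox 0 s0) -(integral_EFinZ _ (measurable_fun_inbox 0 s) _ NK0)//.
  apply: ge0_le_integral => //.
  - by move=> h _; apply: integral_ge0 => y _; rewrite lee_fin.
  - apply: (@measurable_fun_fubini_tonelli_G _ _ _ _ _ bleb _ me'E) => q.
    by rewrite lee_fin.
  - apply/measurable_EFinP; apply: measurable_funM => //; exact: measurable_fun_inbox.
  move=> h _; have [hs|hs] := boolP (inbox 0 s h); last first.
    rewrite mulr0 integral0_eq// => y _.
    by rewrite /e' /= (negbTE hs) mul0r mulr0.
  rewrite mulr1.
  have mPh : measurable_fun [set: V] (fun y => PM (y + h) : mR).
    exact: (measurableT_comp mPM (measurableT_comp measurable_addV (pair2_measurable h))).
  have mPd : measurable_fun [set: V] (fun y => `|PM (y + h) - PM y| : mR).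
    apply: measurableT_comp; first by [].
    by apply: measurable_funB; [exact: mPh|exact: mPM].
  rewrite (eq_integral (fun y : V => (N%:R * `|PM (y + h) - PM y|)%:E)); last first.
    by move=> y _; rewrite /e' /= hs mul1r.
  rewrite (integral_EFinZ _ mPd)// EFinM lee_wpmul2l ?lee_fin//.
  have mPdE : measurable_fun [set: V] (fun y : V => (`|PM (y + h) - PM y|)%:E).
    exact/measurable_EFinP.
  rewrite -(integral_caratheodory bleb mPdE); last by move=> y; rewrite lee_fin.
  have hs' j : `|h j 0| <= s by have := inboxP _ _ _ hs j; rewrite mxE subr0.
  apply: le_trans (integral_translation_diff r0 W0 s0 mPhi sPhi vPhi hs').
  (* [Phi] and [PM] agree off [M], their translates by [h] off [M'], which is null by translation
     invariance. *)
  pose M' := (fun y : V => y + h) @^-1` M.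
  have mh : measurable_fun [set: V] (fun y => y + h).
    exact: (measurableT_comp measurable_addV (pair2_measurable h)).
  have mM' : measurable M' by rewrite -[X in measurable X]setTI; exact: mh.
  have M'0 : bleb M' = 0%E.
    have m1 : measurable_fun [set: V] (fun x => (\1_M x)%:E : \bar R).
      exact/measurable_EFinP/measurable_indic.
    have := integral_translate_borel h m1 (fun x => _ : (0 <= (\1_M x)%:E)%E).
    have -> : (\int[bleb]_x (\1_M x)%:E = 0)%E by rewrite integral_indic// setIT.
    rewrite (eq_integral (fun x => (\1_M' x)%:E))//.
    rewrite integral_indic// setIT; apply => x; by rewrite lee_fin.
  have mU : measurable (M `|` M') by exact: measurableU.
  have U0 : bleb (M `|` M') = 0%E.
    apply/eqP; rewrite -measure_le0 (le_trans (measureU2 _ _ _))//.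
    by rewrite [X in (X + _ <= _)%E]M0 [X in (_ + X <= _)%E]M'0 adde0.
  have mLd : lmeasurable (fun y : V => `|Phi (y + h) - Phi y|).
    by apply: lmeasurable_norm; apply: lmeasurableB => //; exact: lmeasurable_translate.
  have mLdE : measurable_fun [set: lebesgueType R n.+1] (fun y : V => (`|Phi (y + h) - Phi y|)%:E).
    exact/measurable_EFinP.
  rewrite le_eqVlt; apply/predU1P; left.
  apply: (@ge0_ae_eq_integral _ _ _ mu _ _ _ measurableT _ mLdE).
  - exact: (measurable_fun_caratheodory (mu := bleb) mPdE).
  - by move=> y _; rewrite lee_fin.
  - by move=> y _; rewrite lee_fin.
  - apply: (ae_caratheodory_null mU U0) => y My _; congr EFin; congr (`|_ - _|).
      by rewrite PME// => My'; apply: My; right.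
    by rewrite PME// => My'; apply: My; left.
(* The factor [2 ^+ n.+1] is the volume of the box for [h], of radius [2 * rho], divided by that of
   the averaging box, of radius [rho]. *)
rewrite -(@ler_pM2l _ ((2 * rho) ^+ n.+1)); last by rewrite exprn_gt0// mulr_gt0.
rewrite mulr_sumr -lee_fin.
have -> : (2 * rho) ^+ n.+1 *
    (N%:R * (n.+1%:R * (2 * (2 * rho) * W) * (2 * r) ^+ n) * 2 ^+ n.+1) =
    N%:R * K * (2 * (2 * rho)) ^+ n.+1.
  by rewrite -/K [in RHS]exprMn; ring.
apply: le_trans step2.
rewrite -sumEFin (eq_integral (fun q => \sum_(p <- J) (g p q)%:E)%E); last first.
  by move=> q _; rewrite sumEFin.
rewrite ge0_integral_sum//; last by move=> p q _; rewrite lee_fin.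
rewrite big_seq [leRHS]big_seq; exact: lee_sum.
Qed.

End mean_zero.

(** * Increments along elementary affine maps *)

Section elementary.
Context {R : realType} {n : nat}.
Local Notation mR := (measurableTypeR R).
Local Notation V := 'cV[R]_n.+1.
Local Notation mu := (@lebesgue_cV R n.+1).
Implicit Types (i : 'I_n.+1) (F G : V -> R) (c x m : V) (l b rho e : R).

Definition line_variation F (W : R) :=
  forall v y, variation_le (fun t => F (y + t *: v)) W.

Lemma line_variation_along F W i : line_variation F W -> variation_along i F W.
Proof.
move=> vF z; have := vF (delta_mx i 0) (ins i 0 z).
rewrite (_ : (fun t => F (_ + _)) = (fun t => F (ins i t z)))//.
by apply/funext => t; rewrite ins_add_delta ins_same add0r del_ins.
Qed.

Lemma line_variationB F G W W' : line_variation F W -> line_variation G W' ->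
  line_variation (fun x => F x - G x) (W + W').
Proof.
move=> vF vG v y s ss.
apply: (le_trans _ (lerD (vF v y s ss) (vG v y s ss))).
rewrite -big_split/=; apply: ler_sum => k _.
by rewrite (le_trans _ (ler_normB _ _))// le_eqVlt; apply/predU1P; left; congr `|_|; ring.
Qed.

(** The offset is measured in units of [l] and the linear form from [c], so that [b] and [m] carry
    no scale and one smallness condition serves cubes of all sizes. *)
Definition emap i c l b m x : V :=
  x + (l * b + \sum_j m j 0 * (x j 0 - c j 0)) *: delta_mx i 0.

Lemma emap_ins i c l b m x : emap i c l b m x =
  ins i (x i 0 + (l * b + \sum_j m j 0 * (x j 0 - c j 0))) (del i x).
Proof. by rewrite /emap ins_add_delta. Qed.

Definition ephi i c l b m (z : 'cV[R]_n) : R :=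
  l * b - m i 0 * c i 0 + \sum_j m (lift i j) 0 * (z j 0 - c (lift i j) 0).

Lemma measurable_ephi i c l b m :
  measurable_fun [set: 'cV[R]_n] (ephi i c l b m : _ -> mR).
Proof.
apply: measurable_funD => //; apply: measurable_sum => j.
by apply: measurable_funM => //; apply: measurable_funB => //; exact: measurable_coord.
Qed.

(** Isolates the dependence on coordinate [i]: the Jacobian is the constant [1 + m i 0]. *)
Lemma emap_shear i c l b m : emap i c l b m = shear i (1 + m i 0) (ephi i c l b m).
Proof.
apply/funext => x; rewrite emap_ins /shear; congr ins.
rewrite /ephi (bigD1_ord i)//=; under [in RHS]eq_bigr do rewrite mxE.
ring.
Qed.

Definition small e b m := `|b| + \sum_j `|m j 0| <= e.

Lemma small_coord e b m i : small e b m -> `|m i 0| <= e.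
Proof.
move=> sm; apply: le_trans sm; rewrite (bigD1 i)//= addrCA lerDl addr_ge0//.
exact: sumr_ge0.
Qed.

Lemma small_ge0 e b m : small e b m -> 0 <= e.
Proof. by apply: le_trans; rewrite addr_ge0// sumr_ge0. Qed.

Lemma emap_displacement i c l b m e rho x : small e b m -> 0 <= l -> 0 <= rho ->
  inbox c (rho * l) x ->
  `|l * b + \sum_j m j 0 * (x j 0 - c j 0)| <= e * (1 + rho) * l.
Proof.
move=> sm l0 rho0 /inboxP xc.
have S1 : `|\sum_j m j 0 * (x j 0 - c j 0)| <= (\sum_j `|m j 0|) * (rho * l).
  rewrite (le_trans (ler_norm_sum _ _ _))// mulr_suml; apply: ler_sum => j _.
  by rewrite normrM ler_wpM2l.
rewrite (le_trans (ler_normD _ _))// normrM (ger0_norm l0).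
have B0 := normr_ge0 b.
have S0 : 0 <= \sum_j `|m j 0| by rewrite sumr_ge0.
apply: (@le_trans _ _ ((`|b| + \sum_j `|m j 0|) * (1 + rho) * l)); last first.
  by rewrite ler_wpM2r// ler_wpM2r ?addr_ge0.
have : 0 <= `|b| * rho * l by rewrite !mulr_ge0.
have : 0 <= (\sum_j `|m j 0|) * l by rewrite !mulr_ge0.
move: S1; set S := \sum_j `|m j 0|; lra.
Qed.

(** Only coordinate [i] is in doubt. If t = |x_i - c_i| exceeds [rho * l], then
    [t <= rho * l + e * (l + t)]. The width [3 * e] absorbs the term in t, since [(1 - e) * (rho + 3
    * e) - (rho + e) = e * (2 - rho - 3 * e)] is nonnegative. *)
Lemma emap_inbox i c l b m e rho x : small e b m -> e <= 3^-1 -> 0 <= l ->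
  0 <= rho <= 1 -> inbox c (rho * l) (emap i c l b m x) ->
  inbox c ((rho + 3 * e) * l) x.
Proof.
move=> sm e3 l0 /andP[rho0 rho1] /inboxP Ex.
have e0 := small_ge0 sm.
have other j : j != i -> `|x j 0 - c j 0| <= rho * l.
  have := Ex j; rewrite !mxE => + ji; by rewrite (negbTE ji)/= mulr0 addr0.
have xi : `|x i 0 - c i 0| <= (rho + 3 * e) * l.
  rewrite leNgt; apply/negP => xi.
  have xi' : rho * l <= `|x i 0 - c i 0|.
    by rewrite ltW// (le_lt_trans _ xi)// ler_wpM2r// lerDl mulr_ge0.
  have S1 : `|\sum_j m j 0 * (x j 0 - c j 0)| <= (\sum_j `|m j 0|) * `|x i 0 - c i 0|.
    rewrite (le_trans (ler_norm_sum _ _ _))// mulr_suml; apply: ler_sum => j _.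
    rewrite normrM ler_wpM2l//; have [->//|/other h] := eqVneq j i.
    exact: le_trans xi'.
  have := Ex i; rewrite emap_ins ins_same.
  set d := l * b + _ => h.
  have d1 : `|d| <= e * l + e * `|x i 0 - c i 0|.
    rewrite (le_trans (ler_normD _ _))// normrM (ger0_norm l0).
    have b0 := normr_ge0 b.
    have S0 : 0 <= \sum_j `|m j 0| by rewrite sumr_ge0.
    have be : `|b| <= e by rewrite (le_trans _ sm)// lerDl.
    have Se : \sum_j `|m j 0| <= e by rewrite (le_trans _ sm)// lerDr.
    rewrite lerD//; first by rewrite mulrC ler_wpM2r.
    by rewrite (le_trans S1)// ler_wpM2r.
  have h2 : `|x i 0 - c i 0| <= rho * l + `|d|.
    rewrite -[x i 0 - c i 0](addrK d) (le_trans (ler_normB _ _))// lerD2r.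
    by rewrite addrAC.
  have : 0 <= e * (2 - rho - 3 * e) by rewrite mulr_ge0//; lra.
  have e1 : 0 < 1 - e by lra.
  have : (1 - e) * ((rho + 3 * e) * l) < (1 - e) * `|x i 0 - c i 0| by rewrite ltr_pM2l.
  move=> h3 h4; have : 0 <= e * (2 - rho - 3 * e) * l by rewrite mulr_ge0.
  move: h2 d1 h3; lra.
apply/inboxP => j; have [->//|/other h] := eqVneq j i.
by rewrite (le_trans h)// ler_wpM2r// lerDl mulr_ge0.
Qed.

(** [integral_shear] concerns nonnegative functions, so F is written as (F + |F|) - |F|. *)
Lemma test_Rintegral_emap i c l b m e F : small e b m -> e <= 3^-1 ->
  test F -> test (F \o emap i c l b m) ->
  (1 + m i 0) * \int[mu]_x F (emap i c l b m x) = \int[mu]_x F x.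
Proof.
move=> sm e3 tF tFE; rewrite emap_shear in tFE *.
set s := shear _ _ _ in tFE *.
have a0 : 0 < 1 + m i 0 by have := small_coord i sm; rewrite ler_norml; lra.
have pos G : test G -> test (G \o s) -> (forall x, 0 <= G x) ->
    (1 + m i 0) * \int[mu]_x (G \o s) x = \int[mu]_x G x.
  move=> tG tGs G0; have [mG _ _] := tG.
  have := integral_shear i a0 (measurable_ephi i c l b m) mG G0.
  rewrite /Rintegral => ->; rewrite fineM//; last first.
    by apply: integrable_fin_num => //; exact: test_integrable.
  by rewrite mulrA mulfV ?gt_eqF// mul1r.
pose P x := F x + `|F x|.
have tP : test P by apply: testD => //; exact: test_norm.
have tA : test (fun x => `|F x|) by exact: test_norm.
have tAs : test ((fun x => `|F x|) \o s) by exact: (test_norm tFE).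
have tPs : test (P \o s) by exact: (testD tFE tAs).
have FE x : F x = P x - `|F x| by rewrite /P addrK.
under eq_Rintegral do rewrite FE.
under [RHS]eq_Rintegral do rewrite FE.
rewrite (RintegralB measurableT (test_integrable tP) (test_integrable tA)).
rewrite (RintegralB measurableT (test_integrable tPs) (test_integrable tAs)).
rewrite mulrBr pos// ?pos// => x.
by have := ler_norm (- F x); rewrite normrN /P; lra.
Qed.

(** The invariant of successive compositions. [rho] is the radius of the support in units of [l],
    the only quantity that deteriorates, by [3 * e] per map. *)
Definition adm c l rho F := [/\ lmeasurable F, forall x, `|F x| <= 1,
  supp c (rho * l) F, line_variation F 1 & \int[mu]_x F x = 0].

Lemma adm_test c l rho F : adm c l rho F -> test F.
Proof. by case=> mF F1 sF _ _; split => //; [exists 1|exists c, (rho * l)]. Qed.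

(** An affine map sends lines to lines, affinely in the parameter. It tilts them, which is why all
    directions are kept and not only the axes. *)
Lemma line_variation_emap i c l b m F W : line_variation F W ->
  line_variation (F \o emap i c l b m) W.
Proof.
move=> vF v y; have := vF (v + (\sum_j m j 0 * v j 0) *: delta_mx i 0) (emap i c l b m y).
rewrite (_ : (fun t => F (_ + _)) = (fun t => (F \o emap i c l b m) (y + t *: v)))//.
apply/funext => t /=; congr F; rewrite /emap.
rewrite scalerDr scalerA addrACA -!addrA; congr (_ + (_ + _)).
rewrite -scalerDl; congr (_ *: _); rewrite -addrA; congr (_ + _).
rewrite mulr_sumr -big_split/=; apply: eq_bigr => j _; rewrite !mxE; ring.
Qed.

Lemma adm_emap i c l b m e rho F : small e b m -> e <= 3^-1 -> 0 <= l ->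
  0 <= rho <= 1 -> adm c l rho F -> adm c l (rho + 3 * e) (F \o emap i c l b m).
Proof.
move=> sm e3 l0 rho01 aF; have [mF F1 sF vF IF] := aF.
have a0 : 0 < 1 + m i 0 by have := small_coord i sm; rewrite ler_norml; lra.
have mFE : lmeasurable (F \o emap i c l b m).
  by rewrite emap_shear; exact: (lmeasurable_shear i a0 (measurable_ephi i c l b m) mF).
have sFE : supp c ((rho + 3 * e) * l) (F \o emap i c l b m).
  by move=> x /sF; exact: emap_inbox.
have tFE : test (F \o emap i c l b m).
  by split => //; [exists 1 => x; exact: F1|exists c, ((rho + 3 * e) * l)].
split => //; first by move=> x; exact: F1.
  exact: line_variation_emap.
have := test_Rintegral_emap sm e3 (adm_test aF) tFE.
by rewrite IF => /eqP; rewrite mulf_eq0 gt_eqF//= => /eqP.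
Qed.


End elementary.

(** * Gram entries of the increments *)

Section gram.
Context {R : realType} {n : nat}.
Local Notation mR := (measurableTypeR R).
Local Notation V := 'cV[R]_n.+1.
Local Notation mu := (@lebesgue_cV R n.+1).
Implicit Types (i : 'I_n.+1) (F G Phi : V -> R) (c x m : V) (l b rho e : R).

Lemma Rintegral_EFin_test F : test F -> (\int[mu]_x F x)%:E = (\int[mu]_x (F x)%:E)%E.
Proof.
move=> tF; rewrite /Rintegral fineK//; apply: integrable_fin_num => //.
exact: test_integrable.
Qed.

Lemma le_Rintegral_test F G : test F -> test G -> (forall x, F x <= G x) ->
  \int[mu]_x F x <= \int[mu]_x G x.
Proof.
move=> tF tG FG.
by apply: (le_Rintegral measurableT (test_integrable tF) (test_integrable tG)).
Qed.

Lemma le_normr_test F : test F -> `|\int[mu]_x F x| <= \int[mu]_x `|F x|.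
Proof. by move=> tF; exact: (le_normr_Rintegral measurableT (test_integrable tF)). Qed.

Lemma lmeasurable_emap i c l b m e F : small e b m -> e <= 3^-1 ->
  lmeasurable F -> lmeasurable (F \o emap i c l b m).
Proof.
move=> sm e3 mF; have a0 : 0 < 1 + m i 0.
  by have := small_coord i sm; rewrite ler_norml; lra.
by rewrite emap_shear; exact: (lmeasurable_shear i a0 (measurable_ephi i c l b m) mF).
Qed.

Lemma suppW c r r' F : r <= r' -> supp c r F -> supp c r' F.
Proof.
move=> rr' sF x /sF /inboxP h; apply/inboxP => j; exact: le_trans rr'.
Qed.

Lemma adm_emap2 i c l b m e F : small e b m -> e <= 3^-1 -> 0 <= l ->
  adm c l 1 F -> adm c l 2 (F \o emap i c l b m).
Proof.
move=> sm e3 l0 aF.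
have r01 : 0 <= (1 : R) <= 1 by rewrite ler01 lexx.
have [mF F1 sF vF IF] := adm_emap i sm e3 l0 r01 aF.
split => //; apply: suppW sF; rewrite ler_wpM2r//; lra.
Qed.

(* The substitution [x -> emap x] in [int Phi F] moves the increment from [F] to
   [Phi], which in [gram_row] lives on a larger scale. *)
Lemma emap_gram_le i c l b m e Phi F : small e b m -> e <= 3^-1 -> 0 <= l ->
  adm c l 1 F -> test Phi ->
  `|\int[mu]_x (Phi x * (F x - F (emap i c l b m x)))| <=
    2 * \int[mu]_x ((inbox c (2 * l) x)%:R * `|Phi (emap i c l b m x) - Phi x|) +
    e * `|\int[mu]_x (Phi x * F (emap i c l b m x))|.
Proof.
move=> sm e3 l0 aF tPhi; set E := emap i c l b m.
have [mF F1 _ _ _] := aF.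
have aFE : adm c l 2 (F \o E) := adm_emap2 i sm e3 l0 aF.
have [mFE FE1 sFE _ _] := aFE.
have tF := adm_test aF; have tFE := adm_test aFE.
have [mPhi [M PhiM] _] := tPhi.
have mPE : lmeasurable (Phi \o E) := lmeasurable_emap i c l sm e3 mPhi.
have tPF : test (fun x => Phi x * F x) by apply: testM => //; exists 1.
have tPFE' : test (fun x => Phi x * F (E x)) by apply: testM => //; exists 1 => x; exact: FE1.
have tPEFE : test (fun x => Phi (E x) * F (E x)).
  rewrite (_ : (fun x => _) = (fun x => (F \o E) x * (Phi \o E) x)).
    by apply: testM => //; exists M => x; exact: PhiM.
  by apply/funext => x; rewrite mulrC.
have tdiff : test (fun x => Phi (E x) * F (E x) - Phi x * F (E x)) by exact: testB.
have a1 := small_coord i sm.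
have -> : \int[mu]_x (Phi x * (F x - F (E x))) =
    (1 + m i 0) * \int[mu]_x (Phi (E x) * F (E x) - Phi x * F (E x)) +
    m i 0 * \int[mu]_x (Phi x * F (E x)).
  under eq_Rintegral do rewrite mulrBr.
  rewrite (RintegralB measurableT (test_integrable tPF) (test_integrable tPFE')).
  rewrite (RintegralB measurableT (test_integrable tPEFE) (test_integrable tPFE')).
  have := test_Rintegral_emap (i := i) (c := c) (l := l) sm e3 tPF tPEFE.
  by move=> <-; ring.
rewrite (le_trans (ler_normD _ _))// !normrM lerD//; last by rewrite ler_wpM2r.
have tI : test (fun x => (inbox c (2 * l) x)%:R * `|Phi (E x) - Phi x|).
  split.
  - apply: lmeasurableM; first exact: lmeasurable_inbox.
    by apply: lmeasurable_norm; exact: lmeasurableB.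
  - exists (2 * M) => x; rewrite normrM normr_id normr_nat.
    apply: (@le_trans _ _ `|Phi (E x) - Phi x|).
      by rewrite ler_piMl// lern1; case: inbox.
    by rewrite (le_trans (ler_normB _ _))// mulr_natl mulr2n lerD.
  - exists c, (2 * l) => x; case: inbox => //; by rewrite mul0r eqxx.
apply: ler_pM => //.
- by have := small_ge0 sm; move: a1; rewrite !ler_norml; lra.
- apply: (le_trans (le_normr_test tdiff)); apply: le_Rintegral_test => //.
    exact: test_norm.
  move=> x; rewrite -mulrBl normrM.
  have [xc|xc] := boolP (inbox c (2 * l) x); first by rewrite mul1r ler_piMr.
  have -> : F (E x) = 0 := supp0 sFE xc.
  by rewrite normr0 mulr0 mul0r.
Qed.

Section family.
Variables (T : eqType) (i : 'I_n.+1) (e : R).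
Variables (c m : T -> V) (l b : T -> R) (F : T -> V -> R).
Hypotheses (e0 : 0 <= e) (e3 : e <= 3^-1) (l_gt0 : forall p, 0 < l p).
Hypothesis sm : forall p, small e (b p) (m p).
Hypothesis aF : forall p, adm (c p) (l p) 1 (F p).
Let E p := emap i (c p) (l p) (b p) (m p).
Let D p x := F p x - F p (E p x).

Let disp p x : inbox (c p) (2 * l p) x ->
  exists2 t, E p x = ins i t (del i x) & `|t - x i 0| <= 3 * e * l p.
Proof.
move=> xc; eexists; first exact: emap_ins.
rewrite addrAC subrr add0r (mulrC 3) (_ : 3 = 1 + 2 :> R); last by ring.
by apply: emap_displacement => //; exact: ltW.
Qed.

(** Sums both terms of [emap_gram_le] over cubes of one side [s]. For [r] comparable to the side of
    the cube Q carrying [Phi], the factor [s * (2 * r) ^+ n] is comparable to |Q| times the ratio of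
    the sides: this is the gain from the scales. *)
Lemma gram_row Phi cQ r (N : nat) (J : seq T) (s : R) :
  0 <= r -> 0 < s -> test Phi -> supp cQ r Phi -> line_variation Phi 2 ->
  (forall p, p \in J -> l p = s) ->
  (forall x, (count (fun p => inbox (c p) (2 * s) x) J <= N)%N) ->
  \sum_(p <- J) `|\int[mu]_x (Phi x * D p x)| <=
    e * s * (2 * r) ^+ n * N%:R * (24 + n.+1%:R * 16 * 2 ^+ n.+1).
Proof.
move=> r0 s0 tPhi sPhi vPhi ls BN.
have [mPhi _ _] := tPhi.
have vP j : variation_along j Phi 2 by exact: line_variation_along.
(* [integral_shift_sum] asks for the displacement bound at every index, not only in [J]; the test
   [l p == s] enforces it. *)
pose B p x := (l p == s) && inbox (c p) (2 * s) x.
pose u p x := (B p x)%:R * `|Phi (E p x) - Phi x|.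
have mu_ p : lmeasurable (u p).
  apply: lmeasurableM.
    rewrite /B; case: (l p == s); last exact: lmeasurable_cst.
    exact: lmeasurable_inbox.
  apply: lmeasurable_norm; apply: lmeasurableB => //.
  exact: (lmeasurable_emap i _ _ (sm p) e3 mPhi).
have u0 p x : 0 <= u p x by rewrite mulr_ge0.
have key : (\int[mu]_x (\sum_(p <- J) u p x)%:E <=
    (N%:R * (2 * (3 * e * s) * 2) * (2 * r) ^+ n)%:E)%E.
  apply: (integral_shift_sum (i := i) (c := cQ)) => //.
  - by rewrite !mulr_ge0// ltW.
  - by move=> p x /andP[/eqP <-]; exact: disp.
  - move=> x; apply: leq_trans (BN x); apply: sub_count => p /andP[] //.
  - exact: lmeasurable_sum.
have tu p : p \in J -> test (u p).
  move=> pJ; split => //.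
    have [_ [M PhiM] _] := tPhi; exists (2 * M) => x; rewrite normrM normr_id normr_nat.
    apply: (@le_trans _ _ `|Phi (E p x) - Phi x|).
      by rewrite ler_piMl// lern1; case: (B p x).
    by rewrite (le_trans (ler_normB _ _))// mulr_natl mulr2n lerD.
  exists (c p), (2 * s) => x; rewrite /u /B; case: inbox => //.
  by rewrite andbF mul0r eqxx.
have key' : \sum_(p <- J) \int[mu]_x u p x <= N%:R * (2 * (3 * e * s) * 2) * (2 * r) ^+ n.
  rewrite -lee_fin -sumEFin; apply: le_trans key.
  rewrite (integral_EFin_sum mu J mu_ u0) big_seq [leRHS]big_seq.
  by apply: lee_sum => p pJ; rewrite (Rintegral_EFin_test (tu p pJ)).
have mz : \sum_(p <- J) `|\int[mu]_x (Phi x * F p (E p x))| <=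
    N%:R * (n.+1%:R * (2 * (2 * (2 * s)) * 2) * (2 * r) ^+ n) * 2 ^+ n.+1.
  apply: (mean_zero_sum (F := fun p => F p \o E p) (cc := c) r0 _ _ tPhi sPhi vP _ BN) => //.
    by rewrite mulr_gt0.
  move=> p pJ.
  have [h1 h2 h3 _ h5] := adm_emap2 i (sm p) e3 (ltW (l_gt0 p)) (aF p).
  by split=> //; rewrite -(ls p pJ).
have : \sum_(p <- J) `|\int[mu]_x (Phi x * D p x)| <=
    2 * (\sum_(p <- J) \int[mu]_x u p x) +
    e * (\sum_(p <- J) `|\int[mu]_x (Phi x * F p (E p x))|).
  rewrite !mulr_sumr -big_split/= big_seq [leRHS]big_seq; apply: ler_sum => p pJ.
  have H := emap_gram_le i (sm p) e3 (ltW (l_gt0 p)) (aF p) tPhi.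
  by rewrite /u /B -(ls p pJ) eqxx.
move=> h; apply: (le_trans h).
set r' := (2 * r) ^+ n; set t := 2 ^+ n.+1 in key' mz *.
have -> : e * s * r' * N%:R * (24 + n.+1%:R * 16 * t) =
  2 * (N%:R * (2 * (3 * e * s) * 2) * r') +
  e * (N%:R * (n.+1%:R * (2 * (2 * (2 * s)) * 2) * r') * t) by ring.
by rewrite lerD// ler_wpM2l.
Qed.

(** For pairs whose other cube is at least as large: nothing is gained from the ratio of the sides,
    and the one-dimensional estimate applied to [F p] itself gives [e] times the volume. *)
Lemma gram_small Phi p : lmeasurable Phi -> (forall x, `|Phi x| <= 2) ->
  `|\int[mu]_x (Phi x * D p x)| <= 12 * e * l p * (2 * l p) ^+ n.
Proof.
move=> mPhi Phi2; have lp := l_gt0 p; have lp0 := ltW lp.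
have [mF F1 sF vF _] := aF p.
have [mFE FE1 sFE _ _] := adm_emap2 i (sm p) e3 lp0 (aF p).
have tF := adm_test (aF p); have tFE := adm_test (adm_emap2 i (sm p) e3 lp0 (aF p)).
have tD : test (D p) by exact: testB.
have tPD : test (fun x => Phi x * D p x).
  rewrite (_ : (fun x => _) = (fun x => D p x * Phi x)).
    by apply: testM => //; exists 2.
  by apply/funext => x; rewrite mulrC.
apply: (le_trans (le_normr_test tPD)).
have tAD : test (fun x => `|D p x|) by exact: test_norm.
apply: (@le_trans _ _ (\int[mu]_x (2 * `|D p x|))).
  apply: le_Rintegral_test; [exact: test_norm|exact: testZ|move=> x].
  by rewrite normrM ler_wpM2r.
rewrite (RintegralZl _ measurableT (test_integrable tAD)).
have -> : 12 * e * l p * (2 * l p) ^+ n =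
    2 * (1%:R * (2 * (3 * e * l p) * 1) * (2 * (1 * l p)) ^+ n).
  by rewrite (mul1r (l p)); ring.
rewrite ler_wpM2l//; apply: Rintegral_test_ge0 => //.
(* The increment vanishes off the box of radius [2 * l p], so the cutoff required by
   [integral_shift_sum] is free. *)
have DE x : \sum_(q <- [:: tt]) (inbox (c p) (2 * l p) x)%:R * `|F p (E p x) - F p x| = `|D p x|.
  rewrite big_seq1 distrC; have [xc|xc] := boolP (inbox (c p) (2 * l p) x).
    by rewrite mul1r.
  have FE0 : F p (E p x) = 0 := supp0 sFE xc.
  rewrite mul0r /D FE0 (supp0 sF) ?subrr ?normr0//.
  apply: contraNN xc => /inboxP h; apply/inboxP => j.
  by rewrite (le_trans (h j))// ler_wpM2r//; lra.
under eq_integral do rewrite -DE.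
apply: (integral_shift_sum (i := i) (c := c p) (B := fun _ => inbox (c p) (2 * l p))
  (E := fun _ => E p)) => //.
- by rewrite mul1r.
- by rewrite !mulr_ge0.
- exact: line_variation_along.
- by move=> _ x; exact: disp.
- by move=> x /=; case: inbox.
- by under eq_fun do rewrite DE; case: tAD.
Qed.

End family.
End gram.

(** * Schur row sums over all scales *)

Lemma sum_group (R : realFieldType) (T : Type) (J : seq T) (a : T -> R)
    (f : T -> nat) (beta r : R) :
  (forall p, 0 <= a p) -> 0 <= beta -> 0 <= r < 1 ->
  (forall k, \sum_(p <- J | f p == k) a p <= beta * r ^+ k) ->
  \sum_(p <- J) a p <= beta / (1 - r).
Proof.
move=> a0 beta0 /andP[r0 r1] H.
have r1' : 0 < 1 - r by lra.
(* The exact partial geometric sum makes the induction close. *)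
have step M : \sum_(p <- J | (f p < M)%N) a p <= beta * (1 - r ^+ M) / (1 - r).
  elim: M => [|M IH]; first by rewrite big_pred0// expr0 subrr mulr0 mul0r.
  apply: (@le_trans _ _ (\sum_(p <- J | (f p < M)%N) a p + \sum_(p <- J | f p == M) a p)).
    rewrite [leLHS]big_mkcond [X in _ <= X + _]big_mkcond [X in _ <= _ + X]big_mkcond.
    rewrite -big_split/=; apply: ler_sum => p _.
    by rewrite ltnS; case: (ltngtP (f p) M) => _; rewrite ?addr0 ?add0r.
  apply: (le_trans (lerD IH (H M))); rewrite le_eqVlt; apply/predU1P; left.
  by rewrite exprS; field; rewrite gt_eqF.
have [M fM] : exists M, all (fun p => f p < M)%N J.
  elim: J {H step} => [|p J [M JM]]; first by exists 0.
  exists (maxn M (f p).+1); rewrite /= leq_max ltnSn orbT /=.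
  by apply: sub_all JM => q qM; rewrite leq_max qM.
rewrite -(all_filterP fM) big_filter; apply: (le_trans (step M)).
rewrite ler_pM2r ?invr_gt0// ler_piMr// gerBl exprn_ge0//.
Qed.

Section schur.
Context {R : realType} {n : nat}.
Local Notation V := 'cV[R]_n.+1.
Local Notation mu := (@lebesgue_cV R n.+1).
Variables (T : eqType) (i : 'I_n.+1) (e : R) (N : nat).
Variables (k : T -> int) (c m : T -> V) (b : T -> R) (F : T -> V -> R).
Let l p : R := 2 ^ k p.
Hypotheses (e0 : 0 <= e) (e3 : e <= 3^-1).
Hypothesis sm : forall p, small e (b p) (m p).
Hypothesis aF : forall p, adm (c p) (l p) 1 (F p).
Hypothesis overlap : forall (J : seq T) (q : int) (x : V), uniq J ->
  (count (fun p => (k p == q) && inbox (c p) (4 * 2 ^ q) x) J <= N)%N.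
Let D p x := F p x - F p (emap i (c p) (l p) (b p) (m p) x).

Let l_gt0 p : 0 < l p. Proof. exact: exprz_gt0. Qed.

Lemma supp_increment p : supp (c p) (2 * l p) (D p).
Proof.
have [_ _ sF _ _] := aF p.
have [_ _ sFE _ _] := adm_emap2 i (sm p) e3 (ltW (l_gt0 p)) (aF p).
move=> x; apply: contraNT => xc.
have FE0 : F p (emap i (c p) (l p) (b p) (m p) x) = 0 := supp0 sFE xc.
rewrite /D FE0 (supp0 sF) ?subrr//.
apply: contraNN xc => /inboxP h; apply/inboxP => j.
by rewrite (le_trans (h j))// ler_wpM2r ?ltW//; lra.
Qed.

Lemma test_increment p : test (D p).
Proof.
have aE := adm_emap2 i (sm p) e3 (ltW (l_gt0 p)) (aF p).
exact: (testB (adm_test (aF p)) (adm_test aE)).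
Qed.

Lemma increment_le2 p x : `|D p x| <= 2.
Proof.
have [_ F1 _ _ _] := aF p.
by rewrite (le_trans (ler_normB _ _))// (_ : 2 = 1 + 1 :> R)// lerD.
Qed.

Lemma line_variation_increment p : line_variation (D p) 2.
Proof.
have [_ _ _ vF _] := aF p.
rewrite (_ : 2 = 1 + 1 :> R)//; apply: line_variationB => //.
exact: line_variation_emap.
Qed.

(** The leading [4] is [1 / (1 - 3 / 4)], from summing over scales. Inside, the first summand comes
    from [gram_row] with [r = 2 * l p], the second from [gram_small]. *)
Definition schur_const : R :=
  4 * N%:R * (4 ^+ n * (24 + n.+1%:R * 16 * 2 ^+ n.+1) + 12 * 2 ^+ n).

Let omega p : R := (2 / 3) ^ k p.
Let G p q := `|\int[mu]_x (D p x * D q x)|.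

(* Any ratio strictly between 1/2 and 1 would do in place of 2/3: the cubes at
   scale [k p - j] contribute [(3 / 4) ^+ j], those at scale [k p + j]
   contribute [(2 / 3) ^+ j]. *)
Lemma schur_row (p : T) (J : seq T) : uniq J ->
  \sum_(q <- J) G p q * omega q <= schur_const * e * (l p ^+ n.+1 * omega p).
Proof.
move=> uJ.
have om0 q : 0 < omega q by rewrite exprz_gt0// divr_gt0.
pose C0 : R := 24 + n.+1%:R * 16 * 2 ^+ n.+1.
have C00 : 0 <= C0 by rewrite addr_ge0// !mulr_ge0// exprn_ge0.
pose w := l p ^+ n.+1 * omega p.
have nz2 : (2 : R) != 0 by rewrite pnatr_eq0.
have nz23 : (2 / 3 : R) != 0 by rewrite gt_eqF// divr_gt0.
have w0 : 0 <= w by rewrite mulr_ge0 ?exprn_ge0 ?ltW.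
(* [gram_row] gains [2 ^- j], the weight costs [(3 / 2) ^+ j]. *)
have lo j : \sum_(q <- J | k q == k p - j%:Z) G p q * omega q <=
    e * N%:R * (4 ^+ n * C0) * w * (3 / 4) ^+ j.
  set k' := k p - j%:Z.
  pose J' := [seq q <- J | k q == k'].
  have kJ' q : q \in J' -> k q = k' by rewrite mem_filter => /andP[/eqP].
  rewrite -big_filter -/J'.
  rewrite (eq_big_seq (fun q => G p q * (2 / 3) ^ k')); last first.
    by move=> q /kJ' qk; rewrite /omega qk.
  rewrite -mulr_suml.
  have s0 : 0 < (2 : R) ^ k' by exact: exprz_gt0.
  have := @gram_row _ _ T i e c m l b F e0 e3 l_gt0 sm aF (D p) (c p) (2 * l p) N J' (2 ^ k')
    (mulr_ge0 (ler0n R 2) (ltW (l_gt0 p))) s0 (test_increment p) (@supp_increment p)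
    (line_variation_increment p).
  rewrite -/C0 => H.
  have {}H : \sum_(q <- J') G p q <= e * 2 ^ k' * (2 * (2 * l p)) ^+ n * N%:R * C0.
    apply: H => [q /kJ' qk|x]; first by rewrite /l qk.
    apply: leq_trans (overlap k' x uJ); rewrite count_filter; apply: sub_count => q /=.
    move=> /andP[/inboxP h ->]/=; apply/inboxP => j'; rewrite (le_trans (h j'))//.
    by rewrite ler_wpM2r ?ltW//; lra.
  have o0 : 0 <= (2 / 3 : R) ^ k' by rewrite ltW// exprz_gt0// divr_gt0.
  apply: (le_trans (ler_wpM2r o0 H)); rewrite le_eqVlt; apply/predU1P; left.
  have -> : (3 / 4 : R) ^+ j = 2 ^- j * (2 / 3) ^- j.
    by rewrite -!exprVn -exprMn; congr (_ ^+ _); field.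
  rewrite /w /omega /k' (expfzDr _ _ nz2) (expfzDr _ _ nz23).
  rewrite -!exprnN.
  have -> : 2 * (2 * l p) = 4 * l p by ring.
  rewrite exprMn exprS /l; ring.
(* The entries bring no decay in [j]: at most [N] of them are nonzero at each scale, and the weight
   does the rest. *)
have hi j : \sum_(q <- J | k q == k p + j%:Z) G p q * omega q <=
    e * N%:R * (12 * 2 ^+ n) * w * (2 / 3) ^+ j.
  set k' := k p + j%:Z.
  pose J' := [seq q <- J | (k q == k') && inbox (c q) (4 * 2 ^ k') (c p)].
  have G0 q : 0 <= G p q by exact: normr_ge0.
  apply: (@le_trans _ _ (\sum_(q <- J') (12 * e * l p * (2 * l p) ^+ n) * (2 / 3) ^ k')).
    rewrite big_filter big_mkcond [leRHS]big_mkcond; apply: ler_sum => q _.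
    have [/eqP qk|_] := ifPn; last by [].
    have [qp|qp] /= := boolP (inbox _ _ _).
      rewrite /omega qk ler_wpM2r//; first by rewrite ltW// exprz_gt0// divr_gt0.
      rewrite /G; have -> : \int[mu]_x (D p x * D q x) = \int[mu]_x (D q x * D p x).
        by apply: eq_Rintegral => x _; rewrite mulrC.
      have [mDq _ _] := test_increment q.
      exact: (@gram_small _ _ T i e c m l b F e0 e3 l_gt0 sm aF (D q) p mDq
        (@increment_le2 q)).
    suff D0 x : D p x * D q x = 0.
      rewrite /G (_ : \int[mu]_x (D p x * D q x) = 0) ?normr0 ?mul0r//.
      by rewrite /Rintegral integral0_eq// => x _; rewrite D0.
    (* Where the supports meet, the centers are within [2 * l p + 2 * l q <= 4 * l q]: the origin of
       the 4 in [overlap]. *)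
    apply/eqP; rewrite mulf_eq0; apply: contraNT qp.
    rewrite negb_or => /andP[/supp_increment/inboxP hp /supp_increment/inboxP hq].
    apply/inboxP => j'; have := hp j'; have := hq j'.
    have lpq : l p <= l q.
      by rewrite /l qk ler_weXz2l ?lerDl// ler1n.
    move: lpq; rewrite -qk -/(l q) !ler_distl => ? /andP[? ?] /andP[? ?].
    by apply/andP; split; lra.
  rewrite big_const_seq count_predT iter_addr_0.
  rewrite -[leLHS]mulr_natl.
  apply: (@le_trans _ _ (N%:R * (12 * e * l p * (2 * l p) ^+ n * (2 / 3) ^ k'))).
    rewrite ler_wpM2r//; last by rewrite ler_nat /J' size_filter; exact: overlap.
    have ? := ltW (l_gt0 p).
    rewrite !mulr_ge0// ?exprn_ge0 ?mulr_ge0//.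
    by rewrite ltW// exprz_gt0// divr_gt0.
  rewrite le_eqVlt; apply/predU1P; left.
  rewrite /w /omega /k' (expfzDr _ _ nz23) -exprnP.
  rewrite exprMn exprS; ring.
have -> : schur_const * e * (l p ^+ n.+1 * omega p) =
    (e * N%:R * (4 ^+ n * C0 + 12 * 2 ^+ n) * w) / (1 - 3 / 4).
  by rewrite /schur_const -/w -/C0; field.
apply: (@sum_group _ _ _ _ (fun q => absz (k q - k p))).
- by move=> q; rewrite mulr_ge0 ?normr_ge0// ltW.
- apply: mulr_ge0 => //; apply: mulr_ge0; first by rewrite mulr_ge0.
  by rewrite addr_ge0// mulr_ge0// exprn_ge0.
- by apply/andP; split; lra.
move=> j.
(* For [j = 0] the two sums coincide; counting the terms twice is harmless. *)
apply: (@le_trans _ _ (\sum_(q <- J | k q == k p - j%:Z) G p q * omega q +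
   \sum_(q <- J | k q == k p + j%:Z) G p q * omega q)).
  rewrite [leLHS]big_mkcond [X in _ <= X + _]big_mkcond [X in _ <= _ + X]big_mkcond.
  rewrite -big_split/=; apply: ler_sum => q _.
  have t0 : 0 <= G p q * omega q by rewrite mulr_ge0 ?normr_ge0// ltW.
  case: ifPn => [/eqP qj|_]; last by rewrite addr_ge0//; case: ifP.
  have [->|->] : k q = k p - j%:Z \/ k q = k p + j%:Z.
    have [h|h] := leP 0 (k q - k p).
      by right; rewrite -qj (gez0_abs h) addrC subrK.
    by left; rewrite -qj (ltz0_abs h) opprK addrC subrK.
    by rewrite eqxx lerDl; case: ifP.
  by rewrite eqxx lerDr; case: ifP.
apply: (le_trans (lerD (lo j) (hi j))).
set X := 4 ^+ n * C0; set Y := 12 * 2 ^+ n.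
have -> : e * N%:R * (X + Y) * w * (3 / 4) ^+ j =
  e * N%:R * X * w * (3 / 4) ^+ j + e * N%:R * Y * w * (3 / 4) ^+ j by ring.
rewrite lerD2l ler_wpM2l//.
  by apply: mulr_ge0 => //; apply: mulr_ge0; rewrite mulr_ge0// exprn_ge0.
by rewrite lerXn2r ?nnegrE//; lra.
Qed.

End schur.

(** * Bessel bounds *)

Section bessel_gram.
Context {d : measure_display} {T : measurableType d} {R : realType}.
Variable mu : {measure set T -> \bar R}.
Implicit Types f g h : T -> R.

Definition sqintegrable f := measurable_fun [set: T] f /\
  mu.-integrable [set: T] (fun x => (f x ^+ 2)%:E).

Local Notation "<< f , g >>" := (\int[mu]_x (f x * g x)) (at level 0).

Lemma sqintegrableM f g : sqintegrable f -> sqintegrable g ->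
  mu.-integrable [set: T] (EFin \o (fun x => f x * g x)).
Proof.
move=> [mf f2] [mg g2].
apply: (le_integrable _ _ _ (integrableD measurableT f2 g2)) => //.
  by apply/measurable_EFinP; exact: measurable_funM.
move=> x _.
rewrite -[leRHS]/(`|(f x ^+ 2 + g x ^+ 2)%:E|%E) -[leLHS]/(`|(f x * g x)%:E|%E).
rewrite !abse_EFin lee_fin [leRHS]ger0_norm ?addr_ge0 ?sqr_ge0//.
rewrite ler_norml; have := sqr_ge0 (f x + g x); have := sqr_ge0 (f x - g x).
have := sqr_ge0 (f x); have := sqr_ge0 (g x); lra.
Qed.

Lemma sqintegrable0 : sqintegrable (fun=> 0).
Proof.
split; first exact: measurable_cst.
by rewrite expr0n/=; exact: integrable0.
Qed.

Lemma sqintegrableD f g (a : R) : sqintegrable f -> sqintegrable g ->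
  sqintegrable (fun x => a * f x + g x).
Proof.
move=> sf sg; have [mf f2] := sf; have [mg g2] := sg.
split; first by apply: measurable_funD => //; exact: measurable_funM.
have fg := sqintegrableM sf sg.
rewrite (_ : (fun x => _) = (fun x => ((a ^+ 2)%:E * (f x ^+ 2)%:E +
    ((2 * a)%:E * (f x * g x)%:E + (g x ^+ 2)%:E))%E)); last first.
  by apply/funext => x; rewrite -!EFinM -!EFinD; congr EFin; ring.
apply: integrableD => //; first exact: integrableZl.
by apply: integrableD => //; exact: integrableZl.
Qed.

Lemma inner_linear f g h (a : R) : sqintegrable f -> sqintegrable g -> sqintegrable h ->
  << f , (fun x => a * g x + h x) >> = a * << f , g >> + << f , h >>.
Proof.
move=> sf sg sh; rewrite -RintegralZl//; last exact: sqintegrableM.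
rewrite -RintegralD//; last 2 first.
- have := integrableZl measurableT a (sqintegrableM sf sg).
  by apply: eq_integrable => // x _; rewrite /= -EFinM.
- exact: sqintegrableM.
by apply: eq_Rintegral => x _ /=; ring.
Qed.

Lemma innerC f g : << f , g >> = << g , f >>.
Proof. by apply: eq_Rintegral => x _; rewrite mulrC. Qed.

Section sums.
Variables (I : eqType) (g : I -> T -> R).
Hypothesis sg : forall p, sqintegrable (g p).

Lemma sqintegrable_sum (J : seq I) (a : I -> R) :
  sqintegrable (fun x => \sum_(p <- J) a p * g p x).
Proof.
elim: J => [|p J IH].
  by under eq_fun do rewrite big_nil; exact: sqintegrable0.
by under eq_fun do rewrite big_cons; exact: sqintegrableD.
Qed.

Lemma inner_sum f (J : seq I) (a : I -> R) : sqintegrable f ->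
  << f , (fun x => \sum_(p <- J) a p * g p x) >> = \sum_(p <- J) a p * << f , g p >>.
Proof.
move=> sf; elim: J => [|p J IH].
  rewrite big_nil; under eq_Rintegral do rewrite big_nil mulr0.
  by rewrite /Rintegral integral0.
rewrite big_cons -IH -(inner_linear _ sf (sg p) (sqintegrable_sum J a)).
by apply: eq_Rintegral => x _; rewrite big_cons.
Qed.

(* [0 <= |h - t S|^2] for all [t], where [S = sum_p <h, g_p> g_p] and the Schur test
   gives [|S|^2 <= B sum_p <h, g_p>^2] *)
Lemma bessel_schur h (J : seq I) (w : I -> R) (B : R) :
  sqintegrable h -> 0 <= B -> (forall p, 0 < w p) ->
  (forall p, p \in J -> \sum_(q <- J) `|<< g p , g q >>| * w q <= B * w p) ->
  \sum_(p <- J) << h , g p >> ^+ 2 <= B * << h , h >>.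
Proof.
move=> sh B0 w0 HB.
pose a p := << h , g p >>; pose X := \sum_(p <- J) a p ^+ 2.
pose S x := \sum_(p <- J) a p * g p x.
have sS : sqintegrable S by exact: sqintegrable_sum.
have X0 : 0 <= X by apply: sumr_ge0 => p _; exact: sqr_ge0.
have H0 f : 0 <= << f , f >>.
  by apply: Rintegral_ge0 => x _; rewrite -expr2 sqr_ge0.
have hS : << h , S >> = X.
  by rewrite inner_sum//; apply: eq_bigr => p _; rewrite expr2.
have SS : << S , S >> <= B * X.
  rewrite {2}/S inner_sum//.
  under eq_bigr do rewrite innerC inner_sum// mulr_sumr.
  pose K p q := `|<< g p , g q >>|.
  pose Y := \sum_(p <- J) \sum_(q <- J) a p ^+ 2 / w p * (K p q * w q).
  have YB : Y <= B * X.
    rewrite /Y /X mulr_sumr big_seq [leRHS]big_seq; apply: ler_sum => p pJ.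
    rewrite -mulr_sumr -mulrA; have := HB p pJ; rewrite -/(K _ _) => {}HB.
    rewrite (mulrC B) ler_wpM2l ?sqr_ge0// mulrC ler_pdivrMr//.
  apply: le_trans YB.
  (* With [Y] also in transposed form, the claim follows termwise from 2 |a_p| |a_q| <= a_p^2 w_q /
     w_p + a_q^2 w_p / w_q. *)
  have YE : Y = \sum_(p <- J) \sum_(q <- J) a q ^+ 2 / w q * (K p q * w p).
    rewrite /Y exchange_big/=; apply: eq_bigr => p _; apply: eq_bigr => q _.
    by rewrite /K innerC.
  rewrite -(ler_pM2l (ltr0n R 2)) (_ : 2 * Y = Y + Y); last by ring.
  rewrite {2}YE /Y -big_split/=.
  rewrite mulr_sumr; apply: ler_sum => p _; rewrite -big_split/= mulr_sumr.
  apply: ler_sum => q _.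
  apply: (@le_trans _ _ (2 * (`|a p| * `|a q| * K p q))).
    rewrite ler_wpM2l// (le_trans (ler_norm _))// !normrM mulrA.
    by rewrite /K (innerC (g p)).
  have K0 : 0 <= K p q by exact: normr_ge0.
  rewrite (_ : a p ^+ 2 / w p * (K p q * w q) + a q ^+ 2 / w q * (K p q * w p) =
    (`|a p| ^+ 2 / w p * w q + `|a q| ^+ 2 / w q * w p) * K p q); last first.
    by rewrite !real_normK ?num_real//; ring.
  rewrite mulrA ler_wpM2r//.
  have wp := w0 p; have wq := w0 q.
  have [np nq] : w p != 0 /\ w q != 0 by rewrite !gt_eqF.
  have : 0 <= (`|a p| * w q - `|a q| * w p) ^+ 2 / (w p * w q).
    by rewrite divr_ge0 ?sqr_ge0// mulr_ge0// ltW.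
  have -> : (`|a p| * w q - `|a q| * w p) ^+ 2 / (w p * w q) =
      `|a p| ^+ 2 / w p * w q + `|a q| ^+ 2 / w q * w p - 2 * (`|a p| * `|a q|).
    by field; rewrite np nq.
  by rewrite subr_ge0.
have quad t : 0 <= << h , h >> - 2 * t * X + t ^+ 2 * (B * X).
  pose f x := - t * S x + h x.
  have sf : sqintegrable f by exact: sqintegrableD.
  have -> : << h , h >> - 2 * t * X + t ^+ 2 * (B * X) =
      << f , f >> + t ^+ 2 * (B * X - << S , S >>).
    rewrite (inner_linear (- t) sf sS sh) (innerC f S) (innerC f h).
    rewrite (inner_linear (- t) sS sS sh) (inner_linear (- t) sh sS sh).
    by rewrite (innerC S h) hS; ring.
  by rewrite addr_ge0// mulr_ge0 ?sqr_ge0// subr_ge0.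
rewrite -/X.
(* For [B = 0] the quadratic is affine in [t], and a large [t] excludes [X > 0]. Otherwise
   [t = B^-1] is optimal. *)
have [Bz|Bn] := eqVneq B 0.
  rewrite Bz mul0r leNgt; apply/negP => Xp.
  have := quad ((<< h , h >> + 1) / (2 * X)).
  rewrite Bz mul0r mulr0 addr0.
  have -> : 2 * ((<< h , h >> + 1) / (2 * X)) * X = << h , h >> + 1.
    by field; rewrite gt_eqF.
  by rewrite opprD addrA subrr sub0r oppr_ge0 leNgt ltr01.
have Bp : 0 < B by rewrite lt_def Bn.
have := quad B^-1.
have -> : << h , h >> - 2 * B^-1 * X + B^-1 ^+ 2 * (B * X) = (B * << h , h >> - X) / B.
  by field.
by rewrite pmulr_lge0 ?invr_gt0// subr_ge0.
Qed.

End sums.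
End bessel_gram.

(** * Bessel bounds for compositions of elementary maps *)

Section chain.
Context {R : realType} {n : nat}.
Local Notation V := 'cV[R]_n.+1.
Local Notation mu := (@lebesgue_cV R n.+1).
Local Notation LT := (lebesgueType R n.+1).
Variables (T : eqType) (e : R) (N : nat) (k : T -> int) (c : T -> V).
Let l p : R := 2 ^ k p.
Hypotheses (e0 : 0 <= e) (e3 : e <= 3^-1).
Hypothesis overlap : forall (J : seq T) (q : int) (x : V), uniq J ->
  (count (fun p => (k p == q) && inbox (c p) (4 * 2 ^ q) x) J <= N)%N.

Let v p : R := Num.sqrt (l p ^+ n.+1).

Let l_gt0 p : 0 < l p. Proof. exact: exprz_gt0. Qed.
Let v_gt0 p : 0 < v p. Proof. by rewrite sqrtr_gt0 exprn_gt0. Qed.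
Let v2 p : v p ^+ 2 = l p ^+ n.+1. Proof. by rewrite sqr_sqrtr// exprn_ge0// ltW. Qed.

Lemma test_sqintegrable (F : V -> R) : test F -> sqintegrable mu (F : LT -> R).
Proof.
move=> tF; have [mF FM _] := tF; split => //.
have := test_integrable (testM tF mF FM).
by apply: eq_integrable => // x _; rewrite /= expr2.
Qed.

Lemma schur_const_ge0 : 0 <= @schur_const R n N.
Proof.
by rewrite mulr_ge0 ?mulr_ge0 ?addr_ge0 ?mulr_ge0 ?addr_ge0 ?mulr_ge0 ?exprn_ge0.
Qed.

(** Normalization by [v], the square root of the volume, divides the Gram entries by [v p * v q].
    Multiplying the Schur weights by [v] compensates for it and turns [schur_row] into the
    hypothesis of [bessel_schur]. *)
Lemma elementary_bessel i (m : T -> V) (b : T -> R) (F : T -> V -> R) (h : V -> R)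
    (J : seq T) :
  (forall p, small e (b p) (m p)) -> (forall p, adm (c p) (l p) 1 (F p)) ->
  sqintegrable mu (h : LT -> R) -> uniq J ->
  \sum_(p <- J) (\int[mu]_x (h x *
      ((v p)^-1 * (F p x - F p (emap i (c p) (l p) (b p) (m p) x))))) ^+ 2 <=
    @schur_const R n N * e * \int[mu]_x (h x * h x).
Proof.
move=> sm aF sh uJ.
pose D p x := F p x - F p (emap i (c p) (l p) (b p) (m p) x).
have tD p : test (D p) := test_increment i e3 sm aF p.
pose g p x := (v p)^-1 * D p x.
have tg p : test (g p) by exact: testZ.
pose w p : R := (2 / 3) ^ k p * v p.
have w0 p : 0 < w p by rewrite mulr_gt0// exprz_gt0// divr_gt0.
have CB0 : 0 <= @schur_const R n N * e by rewrite mulr_ge0// schur_const_ge0.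
apply: (bessel_schur (fun p => test_sqintegrable (tg p)) sh CB0 w0).
move=> p pJ.
have H := schur_row i e0 e3 sm aF overlap p uJ.
have -> : @schur_const R n N * e * w p =
    (v p)^-1 * (@schur_const R n N * e * (l p ^+ n.+1 * (2 / 3) ^ k p)).
  by rewrite -v2 /w; field; rewrite gt_eqF.
have vi : 0 <= (v p)^-1 by rewrite invr_ge0 ltW.
apply: le_trans (ler_wpM2l vi H).
rewrite mulr_sumr; apply: ler_sum => q _.
have tDD : test (fun x => D p x * D q x).
  by have [mq Mq _] := tD q; exact: testM.
have -> : \int[mu]_x (g p x * g q x) =
    (v p)^-1 * (v q)^-1 * \int[mu]_x (D p x * D q x).
  rewrite -(RintegralZl _ measurableT (test_integrable tDD)).
  by apply: eq_Rintegral => x _; rewrite /g; ring.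
rewrite normrM (ger0_norm (_ : 0 <= (v p)^-1 * (v q)^-1)); last first.
  by rewrite mulr_ge0// invr_ge0 ltW.
rewrite /w -/(D _ _) le_eqVlt; apply/predU1P; left.
by field; rewrite !gt_eqF.
Qed.

Record step := Step {
  step_dir : 'I_n.+1; step_row : T -> V; step_shift : T -> R }.

Definition step_map (s : step) p :=
  emap (step_dir s) (c p) (l p) (step_shift s p) (step_row s p).

(* The head of the list is the outermost map. *)
Fixpoint run (s : seq step) (F : T -> V -> R) : T -> V -> R :=
  if s is s0 :: s' then run s' (fun p => F p \o step_map s0 p) else F.

Definition small_step (s : step) := forall p, small e (step_shift s p) (step_row s p).

Fixpoint small_steps (ss : seq step) : Prop :=
  if ss is s :: ss' then small_step s /\ small_steps ss' else True.

Lemma small_steps_cat ss ss' : small_steps ss -> small_steps ss' ->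
  small_steps (ss ++ ss').
Proof. by elim: ss => [|s ss IH] //= [ss1 /IH h] /h. Qed.

Lemma run_cat s s' F : run (s ++ s') F = run s' (run s F).
Proof. by elim: s F => [|s0 s IH] F //=. Qed.

Lemma admW c' l' rho rho' (F : V -> R) : 0 <= l' -> rho <= rho' ->
  adm c' l' rho F -> adm c' l' rho' F.
Proof.
move=> l0 rr [? ? sF ? ?]; split => //; apply: suppW sF.
by rewrite ler_wpM2r.
Qed.

(** Each map adds one increment and costs a factor at most 4 through (a + b)^2 <= 2 a^2 + 2 b^2. The
    support radius [rho] grows along the way and must stay at most 1 for [elementary_bessel] to
    apply. *)
Lemma run_bessel (ss : seq step) (F : T -> V -> R) (rho : R) (h : V -> R) (J : seq T) :
  small_steps ss ->
  (forall p, adm (c p) (l p) rho (F p)) -> 0 <= rho -> rho + 3 * e * (size ss)%:R <= 1 ->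
  sqintegrable mu (h : LT -> R) -> uniq J ->
  (forall p, test (run ss F p)) /\
  \sum_(p <- J) (\int[mu]_x (h x * ((v p)^-1 * (F p x - run ss F p x)))) ^+ 2 <=
    4 ^+ size ss * (@schur_const R n N * e * \int[mu]_x (h x * h x)).
Proof.
move=> + + + + sh uJ; elim: ss F rho => [|s ss IH] F rho sm aF rho0 rho1.
  split => [p|]; first exact: (adm_test (aF p)).
  rewrite big1 => [|p _]; last first.
    rewrite /Rintegral integral0_eq ?expr0n// => x _.
    by rewrite /= subrr !mulr0.
  rewrite !mulr_ge0 ?exprn_ge0 ?schur_const_ge0//.
  by apply: Rintegral_ge0 => x _; rewrite -expr2 sqr_ge0.
have [sms smss] := sm.
have e0s : 0 <= 3 * e * (size ss)%:R by rewrite !mulr_ge0.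
have rho1' : rho + 3 * e + 3 * e * (size ss)%:R <= 1.
  by apply: le_trans rho1; rewrite /= -[(size ss).+1]add1n natrD mulrDr mulr1 addrA.
have e03 : 0 <= 3 * e by rewrite mulr_ge0.
have rho2 : rho <= 1.
  by rewrite (le_trans _ rho1')// -addrA lerDl addr_ge0.
pose F' p := F p \o step_map s p.
have aF' p : adm (c p) (l p) (rho + 3 * e) (F' p).
  by apply: adm_emap => //; [exact: ltW|rewrite rho0].
have [|tR HR] := IH F' _ smss aF' _ rho1'.
  by rewrite addr_ge0// mulr_ge0.
split => //.
have aF1 p : adm (c p) (l p) 1 (F p) := admW (ltW (l_gt0 p)) rho2 (aF p).
have HD := elementary_bessel (step_dir s) sms aF1 sh uJ.
pose x1 p := \int[mu]_x (h x * ((v p)^-1 * (F p x - F' p x))).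
pose x2 p := \int[mu]_x (h x * ((v p)^-1 * (F' p x - run ss F' p x))).
have xE p : \int[mu]_x (h x * ((v p)^-1 * (F p x - run (s :: ss) F p x))) = x1 p + x2 p.
  have t1 : test (fun x => (v p)^-1 * (F p x - F' p x)).
    by apply: testZ; apply: testB; [exact: (adm_test (aF p))|exact: (adm_test (aF' p))].
  have t2 : test (fun x => (v p)^-1 * (F' p x - run ss F' p x)).
    by apply: testZ; apply: testB; [exact: (adm_test (aF' p))|exact: tR].
  have := inner_linear 1 sh (test_sqintegrable t1) (test_sqintegrable t2).
  rewrite mul1r -/(x1 p) -/(x2 p) => <-.
  by apply: eq_Rintegral => x _ /=; congr (_ * _); ring.
under eq_bigr do rewrite xE.
apply: (@le_trans _ _ (\sum_(p <- J) (2 * x1 p ^+ 2 + 2 * x2 p ^+ 2))).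
  apply: ler_sum => p _; have := sqr_ge0 (x1 p - x2 p); lra.
rewrite big_split/= -!mulr_sumr.
have K0 : 0 <= @schur_const R n N * e * \int[mu]_x (h x * h x).
  rewrite !mulr_ge0 ?schur_const_ge0//.
  by apply: Rintegral_ge0 => x _; rewrite -expr2 sqr_ge0.
move: HD HR; rewrite -/(x1 _) -/(x2 _); move: K0; set K := _ * \int[mu]_x _ => K0 HD HR.
apply: (@le_trans _ _ (2 * K + 2 * (4 ^+ size ss * K))).
  by rewrite lerD// ler_wpM2l.
have : K <= 4 ^+ size ss * K by rewrite ler_peMl// exprn_ege1// ler1n.
rewrite exprS; lra.
Qed.

End chain.

(** * Factorization of affine maps near the identity *)

Section factorization.
Context {R : realType} {n : nat}.
Local Notation V := 'cV[R]_n.+1.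
Local Notation M := 'M[R]_n.+1.

Lemma mx_norm_inf_row (B : M) (eta : R) i : mx_norm_inf B <= eta ->
  \sum_j `|B i j| <= eta.
Proof. by apply: le_trans; rewrite /mx_norm_inf (le_bigmax _ (fun i => \sum_j `|B i j|)). Qed.

(** The largest row sum of [B] is its operator norm on row vectors with the l^1 norm, which is also
    the norm in which [small] measures [m]. *)
Lemma row_sum_mulmx (B : M) (u : 'rV[R]_n.+1) (eta : R) :
  (forall i, \sum_j `|B i j| <= eta) ->
  \sum_j `|(u *m B) 0 j| <= (\sum_j `|u 0 j|) * eta.
Proof.
move=> Beta; apply: (@le_trans _ _ (\sum_j \sum_i `|u 0 i| * `|B i j|)).
  apply: ler_sum => j _; rewrite mxE (le_trans (ler_norm_sum _ _ _))//.
  by apply: ler_sum => i _; rewrite normrM.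
rewrite exchange_big/= mulr_suml; apply: ler_sum => i _.
by rewrite -mulr_sumr ler_wpM2l.
Qed.

Section near_identity.
Variables (S : M) (eta : R).
Hypotheses (eta1 : eta < 1) (Seta : forall i, \sum_j `|(S - 1%:M) i j| <= eta).

(** This lower bound replaces a Neumann series: it gives both invertibility and the bound on the
    inverse. *)
Lemma near_identity_lower (u : 'rV[R]_n.+1) :
  (1 - eta) * (\sum_j `|u 0 j|) <= \sum_j `|(u *m S) 0 j|.
Proof.
have uS : u = u *m S - u *m (S - 1%:M) by rewrite mulmxBr mulmx1 opprB addrC subrK.
have : \sum_j `|u 0 j| <= \sum_j `|(u *m S) 0 j| + \sum_j `|(u *m (S - 1%:M)) 0 j|.
  rewrite -big_split/=; apply: ler_sum => j _.
  rewrite (_ : u 0 j = (u *m S) 0 j - (u *m (S - 1%:M)) 0 j); last first.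
    by rewrite {1}uS !mxE.
  exact: ler_normB.
have := row_sum_mulmx u Seta; lra.
Qed.

Lemma near_identity_unit : S \in unitmx.
Proof.
rewrite -row_free_unit; apply: inj_row_free => u uS0.
have := near_identity_lower u; rewrite uS0.
rewrite [leRHS]big1 => [|j _]; last by rewrite mxE normr0.
rewrite pmulr_rle0 ?subr_gt0// => u0.
have /eqP : \sum_j `|u 0 j| = 0 by apply/eqP; rewrite eq_le u0 sumr_ge0.
rewrite psumr_eq0// => /allP/= H; apply/rowP => j; rewrite mxE.
by apply/eqP; rewrite -normr_eq0; apply: H; rewrite mem_index_enum.
Qed.

Lemma near_identity_inv (u : 'rV[R]_n.+1) :
  (1 - eta) * (\sum_j `|(u *m invmx S) 0 j|) <= \sum_j `|u 0 j|.
Proof.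
by have := near_identity_lower (u *m invmx S); rewrite mulmxKV// near_identity_unit.
Qed.

End near_identity.

(* Passing from [first_rows A i] to [first_rows A i.+1] is left multiplication by
   [1 + e_i w], where [w] is the transpose of [elim_row A i]: this changes
   coordinate [i] only. *)
Definition first_rows (A : M) (k : nat) : M :=
  \matrix_(i, j) if (i < k)%N then A i j else (i == j)%:R.

Lemma first_rows0 A : first_rows A 0 = 1%:M.
Proof. by apply/matrixP => i j; rewrite !mxE. Qed.

Lemma first_rows_all A : first_rows A n.+1 = A.
Proof. by apply/matrixP => i j; rewrite !mxE ltn_ord. Qed.

Lemma first_rowsS A (i : 'I_n.+1) : first_rows A i.+1 =
  first_rows A i + delta_mx i 0 *m row i (A - 1%:M).
Proof.
apply/matrixP => i' j; rewrite !mxE big_ord1 !mxE eqxx andbT ltnS leq_eqVlt.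
have [->|ii'] := eqVneq i' i.
  by rewrite eqxx ltnn/= mul1r addrC subrK.
by rewrite (negbTE (_ : val i' != val i))//= mul0r addr0.
Qed.

Lemma first_rows_near A k (eta : R) : 0 <= eta ->
  (forall i, \sum_j `|(A - 1%:M) i j| <= eta) ->
  forall i, \sum_j `|(first_rows A k - 1%:M) i j| <= eta.
Proof.
move=> eta0 Aeta i; have [ik|ki] := ltnP i k.
  apply: le_trans (Aeta i); rewrite le_eqVlt; apply/predU1P; left.
  by apply: eq_bigr => j _; rewrite !mxE ik.
rewrite big1// => j _; rewrite !mxE ltnNge ki/= subrr normr0//.
Qed.

Definition elim_row (A : M) (i : 'I_n.+1) : V :=
  (row i (A - 1%:M) *m invmx (first_rows A i))^T.

(** Inverting [first_rows A i] costs [(1 - eta)^-1 <= 2]; hence smallness [2 * eta] rather than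
    [eta]. *)
Lemma elim_row_small A i (eta : R) : 0 <= eta <= 2^-1 ->
  (forall i, \sum_j `|(A - 1%:M) i j| <= eta) ->
  small (2 * eta) 0 (elim_row A i).
Proof.
move=> /andP[eta0 eta2] Aeta; rewrite /small normr0 add0r.
have e1 : eta < 1 by lra.
under eq_bigr do rewrite mxE.
have := near_identity_inv e1 (first_rows_near i eta0 Aeta) (row i (A - 1%:M)).
have := Aeta i; rewrite (eq_bigr (fun j => `|row i (A - 1%:M) 0 j|)); last first.
  by move=> j _; rewrite [in RHS]mxE.
set u := \sum_j _; set w := \sum_j _ => u1 u2.
have w0 : 0 <= w by exact: sumr_ge0.
have : 0 <= (2^-1 - eta) * w by rewrite mulr_ge0// subr_ge0.
lra.
Qed.

Lemma emap_elim_row A (i : 'I_n.+1) (c z : V) (l : R) : first_rows A i \in unitmx ->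
  emap i c l 0 (elim_row A i) (c + first_rows A i *m z) = c + first_rows A i.+1 *m z.
Proof.
move=> uA; rewrite /emap mulr0 add0r first_rowsS mulmxDl addrA; congr (_ + _).
set w := row i _.
have -> : \sum_j elim_row A i j 0 * ((c + first_rows A i *m z) j 0 - c j 0) = (w *m z) 0 0.
  rewrite -[in RHS](mulmxKV uA w) -[in RHS](mulmxA (w *m _)) [RHS]mxE; apply: eq_bigr => j _.
  have -> : elim_row A i j 0 = (w *m invmx (first_rows A i)) 0 j by rewrite mxE.
  by congr (_ * _); rewrite [X in X - _ = _]mxE addrAC subrr add0r.
rewrite -mulmxA; apply/colP => k; rewrite !mxE big_ord1 !mxE.
by rewrite mulrC; congr (_ * _); apply: eq_bigr => j _; rewrite !mxE.
Qed.

Section steps.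
Variables (T : eqType) (k : T -> int) (c : T -> V) (A : T -> M) (y : T -> V).
Let l p : R := 2 ^ k p.

(** The last row heads the list and is thus applied last, in keeping with the growth of
    [first_rows]. *)
Fixpoint row_steps (j : nat) : seq (@step R n T) :=
  if j is j'.+1 then
    Step (inord j') (fun p => elim_row (A p) (inord j')) (fun=> 0) :: row_steps j'
  else [::].

Definition shift_steps : seq (@step R n T) :=
  [seq Step j (fun=> 0) (fun p => y p j 0) | j <- enum 'I_n.+1].

Lemma row_stepsS j : row_steps j.+1 =
  Step (inord j) (fun p => elim_row (A p) (inord j)) (fun=> 0) :: row_steps j.
Proof. by []. Qed.

Lemma run_cons s ss (F : T -> V -> R) :
  run k c (s :: ss) F = run k c ss (fun p => F p \o step_map k c s p).
Proof. by []. Qed.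

Lemma run_row_steps j (F : T -> V -> R) p x (eta : R) : (j <= n.+1)%N ->
  0 <= eta < 1 -> (forall i, \sum_j `|(A p - 1%:M) i j| <= eta) ->
  run k c (row_steps j) F p x = F p (c p + first_rows (A p) j *m (x - c p)).
Proof.
move=> + /andP[eta0 eta1] Aeta; elim: j F => [|j IH] F jn.
  by rewrite [LHS]/= first_rows0 mul1mx addrC subrK.
rewrite row_stepsS run_cons (IH _ (ltnW jn)) {IH}.
have := @emap_elim_row (A p) (inord j) (c p) (x - c p) (2 ^ k p).
rewrite (inordK jn) => <-; first by [].
exact: (near_identity_unit eta1 (first_rows_near j eta0 Aeta)).
Qed.

Lemma run_shift_steps (F : T -> V -> R) p x :
  run k c shift_steps F p x = F p (x + l p *: y p).
Proof.
rewrite (col_sum_delta (l p *: y p)) /shift_steps.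
elim: (enum _) F x => [|j s IH] F x; first by rewrite big_nil addr0.
rewrite /= IH/= /step_map/= big_cons; congr F; rewrite /emap/=.
rewrite [X in (_ + X) *: _]big1 ?addr0 => [|i _]; last by rewrite [X in X * _]mxE mul0r.
by rewrite [in RHS]mxE addrA addrAC.
Qed.

(** The shifts end the list and so act before the linear part, just as [y p] is added before [A p]
    is applied. *)
Lemma run_affine (F : T -> V -> R) p x (eta : R) :
  0 <= eta < 1 -> (forall i, \sum_j `|(A p - 1%:M) i j| <= eta) ->
  run k c (row_steps n.+1 ++ shift_steps) F p x =
    F p (c p + A p *m (l p *: y p + x - c p)).
Proof.
move=> eta01 Aeta; rewrite run_cat run_shift_steps (run_row_steps _ _ _ eta01)//.
by rewrite first_rows_all (addrC x).
Qed.

Lemma size_affine_steps : size (row_steps n.+1 ++ shift_steps) = (2 * n.+1)%N.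
Proof.
rewrite size_cat size_map size_enum_ord mul2n -addnn; congr addn.
by elim: n.+1 => //= j ->.
Qed.

Lemma affine_steps_small (eta : R) : 0 <= eta <= 2^-1 ->
  (forall p i, \sum_j `|(A p - 1%:M) i j| <= eta) ->
  (forall p i, `|y p i 0| <= eta) ->
  small_steps (2 * eta) (row_steps n.+1 ++ shift_steps).
Proof.
move=> eta01 Aeta yeta; apply: small_steps_cat.
  elim: n.+1 => [//|j IH]; rewrite row_stepsS; split => // p.
  exact: elim_row_small.
rewrite /shift_steps; elim: (enum _) => [//|j s IH]; split => // p.
rewrite /small/= big1 => [|i _]; last by rewrite mxE normr0.
by have := yeta p j; case/andP: eta01; lra.
Qed.

End steps.
End factorization.

(** * Dyadic cubes *)

Section dyadic.
Context {R : realType} {n : nat}.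
Local Notation V := 'cV[R]_n.+1.
Local Notation T := (dyadic_cubes R n.+1).

(** The definition gives each axis its own exponent; the common side forces them to agree. Positive
    dimension provides the axis [ord0]. *)
Lemma dyadic_side (Q : T) : exists q : int, side (val Q) = 2 ^ q.
Proof.
have [j [q [h1 h2]]] := set_valP Q ord0; exists q.
by move: h2; rewrite h1 intrD mulrDl mul1r => /addrI.
Qed.

Lemma dyadic_corner (Q : T) i : exists j : int, corner (val Q) i 0 = j%:~R * side (val Q).
Proof.
have [j [q [h1 h2]]] := set_valP Q i; exists j; rewrite {1}h1; congr (_ * _).
by move: h2; rewrite h1 intrD mulrDl mul1r => /addrI.
Qed.

Definition dyadic_scale (Q : T) : int := projT1 (cid (dyadic_side Q)).

Lemma dyadic_scaleE Q : side (val Q) = 2 ^ dyadic_scale Q.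
Proof. by rewrite /dyadic_scale; case: cid. Qed.

Definition dyadic_index (Q : T) i : int := projT1 (cid (dyadic_corner Q i)).

Lemma dyadic_indexE Q i : corner (val Q) i 0 = (dyadic_index Q i)%:~R * side (val Q).
Proof. by rewrite /dyadic_index; case: cid. Qed.

Lemma dyadic_inj (Q Q' : T) : dyadic_scale Q = dyadic_scale Q' -> dyadic_index Q =1 dyadic_index Q' -> Q = Q'.
Proof.
move=> sQ iQ; apply/val_inj/val_inj; rewrite [LHS]surjective_pairing [RHS]surjective_pairing.
have sE : side (val Q) = side (val Q') by rewrite !dyadic_scaleE sQ.
congr pair; last exact: sE.
by apply/colP => i; have := dyadic_indexE Q i; rewrite iQ sE -dyadic_indexE.
Qed.

(** In units of [2 ^ q] the center is the index plus 1/2 on each axis. Within distance 4 of [x] this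
    leaves the 9 indices from [f i - 4] to [f i + 4], and scale and index determine the cube. *)
Lemma dyadic_overlap (J : seq T) (q : int) (x : V) : uniq J ->
  (count (fun Q => (dyadic_scale Q == q) && inbox (cube_center (val Q)) (4 * 2 ^ q) x) J
     <= 9 ^ n.+1)%N.
Proof.
move=> uJ; rewrite -size_filter; set J' := seq.filter _ _.
have s0 : 0 < (2 : R) ^ q by exact: exprz_gt0.
pose f i : int := Num.floor (x i 0 / 2 ^ q).
pose phi (Q : T) : {ffun 'I_n.+1 -> 'I_9} := [ffun i => inord (absz (dyadic_index Q i - f i + 4))].
have bnd Q i : Q \in J' -> 0 <= dyadic_index Q i - f i + 4 < 9.
  rewrite mem_filter/= => /andP[/andP[/eqP Qq /inboxP hQ] _]; have := hQ i.
  rewrite mxE mxE dyadic_indexE dyadic_scaleE Qq => xQ.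
  have fx : (f i)%:~R <= x i 0 / 2 ^ q by exact: floor_le.
  have fx1 : x i 0 / 2 ^ q < (f i + 1)%:~R by exact: floorD1_gt.
  have : `|x i 0 / 2 ^ q - ((dyadic_index Q i)%:~R + 2^-1)| <= 4.
    rewrite -(ler_pM2r s0) -{2}(ger0_norm (ltW s0)) -normrM.
    rewrite mulrBl mulrDl mulfVK ?gt_eqF//.
    by rewrite (mulrC 2^-1).
  rewrite ler_distl => /andP[h1 h2].
  have g1 : (f i - 5)%:~R < (dyadic_index Q i)%:~R :> R by rewrite intrB; lra.
  have g2 : (dyadic_index Q i)%:~R < (f i + 5)%:~R :> R by rewrite intrD; move: fx1; rewrite intrD; lra.
  move: g1 g2; rewrite !ltr_int -lezD1 => g1 g2.
  move: g1 g2; rewrite -subr_ge0 -[_ < f i + 5]subr_gt0 => g1 g2.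
  rewrite -[_ < 9]subr_gt0.
  rewrite (_ : dyadic_index Q i - f i + 4 = dyadic_index Q i - (f i - 5 + 1)); last by ring.
  rewrite g1 (_ : 9 - (dyadic_index Q i - (f i - 5 + 1)) = f i + 5 - dyadic_index Q i)//.
  by ring.
have inj : {in J' &, injective phi}.
  move=> Q Q' QJ Q'J /ffunP phiE; apply: dyadic_inj.
    move: QJ Q'J; rewrite !mem_filter => /andP[/andP[/eqP -> _] _].
    by move=> /andP[/andP[/eqP -> _] _].
  move=> i; have := phiE i; rewrite !ffunE => /(congr1 (@nat_of_ord 9)).
  have /andP[a1 a2] := bnd Q i QJ; have /andP[b1 b2] := bnd Q' i Q'J.
  rewrite !inordK; [|by rewrite -ltz_nat gez0_abs|by rewrite -ltz_nat gez0_abs].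
  move=> /(congr1 Posz); rewrite (gez0_abs a1) (gez0_abs b1) => /addIr/addIr; exact.
rewrite -(size_map phi) -(card_uniqP _); last first.
  by rewrite map_inj_in_uniq// filter_uniq.
by rewrite (leq_trans (max_card _))// card_ffun !card_ord.
Qed.

End dyadic.

(** * Real and imaginary parts of dyadic families *)

Section complex_families.
Context {R : realType} {n : nat}.
Local Notation V := 'cV[R]_n.+1.
Local Notation T := (dyadic_cubes R n.+1).
Local Notation mu := (@lebesgue_cV R n.+1).
Local Notation LT := (lebesgueType R n.+1).
Local Notation normc := (@Normc.normc R).

Lemma normc_sqr (z : R[i]) : normc z ^+ 2 = complex.Re z ^+ 2 + complex.Im z ^+ 2.
Proof. by case: z => a b /=; rewrite sqr_sqrtr// addr_ge0 ?sqr_ge0. Qed.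

Lemma Re_le_normc (z : R[i]) : `|complex.Re z| <= normc z.
Proof.
by case: z => a b /=; rewrite -sqrtr_sqr ler_wsqrtr// lerDl sqr_ge0.
Qed.

Lemma Im_le_normc (z : R[i]) : `|complex.Im z| <= normc z.
Proof.
by case: z => a b /=; rewrite -sqrtr_sqr ler_wsqrtr// lerDr sqr_ge0.
Qed.

(** [g] stands for the real or the imaginary part; [2^-1] is the radius of a cube in units of its
    side. *)
Lemma SNBV0_adm (Q : T) (f : V -> R[i]) (g : {additive R[i] -> R}) :
  (forall z, `|g z| <= normc z) ->
  lmeasurable (g \o f) -> \int[mu]_x g (f x) = 0 ->
  SNBV0 (val Q) f -> adm (cube_center (val Q)) (2 ^ dyadic_scale Q) 2^-1 (g \o f).
Proof.
move=> gz mg Ig [[[mf vf] sf] _].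
have l0 : 0 < side (val Q) by exact: (valP (val Q)).
have vg : line_variation (g \o f) 1.
  move=> v y s ss; rewrite -lee_fin; apply: le_trans (vf v y).
  apply: le_trans (ereal_sup_ubound (_ : [set _ | _ in _] _)); last by exists s.
  by rewrite lee_fin; apply: ler_sum => k _; rewrite /= -raddfB.
have fx0 x : ~ cube_set (val Q) x -> f x = 0.
  by move=> nx; apply/eqP; apply: contra_notT nx => /sf.
split => //.
- move=> x; have [xQ|/fx0] := pselect (cube_set (val Q) x); last first.
    by move=> /= ->; rewrite raddf0 normr0.
  (* One side further along an axis the point has left the half-open cube, so the value at [x] is a
     single jump, bounded by the variation. *)
  have xQ' : f (x + side (val Q) *: delta_mx ord0 0) = 0.
    apply: fx0 => /(_ ord0); have /andP[x1 _] := xQ ord0.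
    by rewrite !mxE eqxx mulr1 ltrD2r ltNge x1 andbF.
  have := vg (delta_mx ord0 0) x [:: 0; side (val Q)].
  rewrite /= l0 => /(_ isT).
  by rewrite big_ord1/= scale0r addr0 xQ' raddf0 sub0r normrN.
- move=> x gx; apply/inboxP => j.
  have /sf/(_ j) : f x != 0 by apply: contraNneq gx => /= ->; rewrite raddf0.
  rewrite -dyadic_scaleE !mxE => /andP[x1 x2].
  by rewrite ler_norml; apply/andP; split; lra.
Qed.

(** [2 * n.+1] elementary maps, each of smallness [2 * eta]: hence the exponent and the last
    factor. *)
Definition bessel_const : R := 4 ^+ (2 * n.+1) * (@schur_const R n (9 ^ n.+1) * 2).

Section real_family.
Variables (eta : R) (f : T -> V -> R[i]) (A : T -> 'M[R]_n.+1) (y : T -> V).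
Hypothesis eta01 : 0 <= eta <= (24 * n.+1%:R)^-1.
Hypothesis fS : forall Q, SNBV0 (val Q) (f Q).
Hypothesis Ay : forall Q, mx_norm_inf (A Q - 1%:M) + `|y Q| <= eta.

Lemma coord_le_norm (z : V) j : `|z j 0| <= `|z|.
Proof.
rewrite -[leRHS]/(mx_norm z) mx_normrE.
exact: (le_bigmax _ (fun i : 'I_n.+1 * 'I_1 => `|z i.1 i.2|) (j, 0)).
Qed.

Lemma real_family_bessel (g : {additive R[i] -> R}) (h : V -> R) (J : seq T) :
  (forall z, `|g z| <= normc z) -> (forall Q, lmeasurable (g \o f Q)) ->
  (forall Q, \int[mu]_x g (f Q x) = 0) -> sqintegrable mu (h : LT -> R) -> uniq J ->
  let F Q x := g (f Q x - perturb (val Q) (A Q) (y Q) (f Q) x) in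
  let psi Q x := (Num.sqrt (volume (val Q)))^-1 * F Q x in
  (forall Q, test (psi Q)) /\
  \sum_(Q <- J) (\int[mu]_x (h x * psi Q x)) ^+ 2 <=
    bessel_const * eta * \int[mu]_x (h x * h x).
Proof.
move=> gz mg Ig sh uJ F psi.
have /andP[eta0 eta1] := eta01.
have n1 : (1 : R) <= n.+1%:R by rewrite ler1n.
have etan : 24 * n.+1%:R * eta <= 1.
  by rewrite mulrC -ler_pdivlMr ?mul1r// mulr_gt0.
have eta24 : 24 * eta <= 1.
  by apply: le_trans etan; rewrite ler_wpM2r// ler_peMr.
have Anorm Q i : \sum_j `|(A Q - 1%:M) i j| <= eta.
  apply: mx_norm_inf_row; apply: le_trans (Ay Q); by rewrite lerDl.
have ynorm Q i : `|y Q i 0| <= eta.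
  apply: le_trans (Ay Q); rewrite (le_trans (coord_le_norm _ _))// lerDr.
  by apply: bigmax_ge_id.
have eta2 : 0 <= eta <= 2^-1 by apply/andP; split; lra.
have eta3 : 0 <= eta < 1 by apply/andP; split; lra.
have e0 : 0 <= 2 * eta by rewrite mulr_ge0.
have e3 : 2 * eta <= 3^-1 by lra.
pose c (Q : T) := cube_center (val Q).
pose ss := row_steps A n.+1 ++ shift_steps y.
have sss : small_steps (2 * eta) ss by exact: affine_steps_small.
have adm0 Q : adm (c Q) (2 ^ dyadic_scale Q) 2^-1 (g \o f Q) := SNBV0_adm gz (mg Q) (Ig Q) (fS Q).
(* Radius [2^-1] at the start and [2 * n.+1] widenings by [3 * (2 * eta)]: the origin of
   [(24 * n.+1%:R)^-1]. *)
have ss1 : 2^-1 + 3 * (2 * eta) * (size ss)%:R <= 1.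
  by rewrite size_affine_steps natrM; lra.
have half0 : 0 <= (2^-1 : R) by rewrite invr_ge0.
have [tR HR] := run_bessel e0 e3 (@dyadic_overlap R n) sss adm0 half0 ss1 sh uJ.
have runE Q x : run dyadic_scale c ss (fun Q => g \o f Q) Q x =
    g (perturb (val Q) (A Q) (y Q) (f Q) x).
  by rewrite (run_affine dyadic_scale c y _ _ eta3 (Anorm Q)) /perturb -dyadic_scaleE.
have psiE Q x : psi Q x = (Num.sqrt ((2 ^ dyadic_scale Q) ^+ n.+1))^-1 *
    ((g \o f Q) x - run dyadic_scale c ss (fun Q => g \o f Q) Q x).
  by rewrite /psi /F volumeE runE dyadic_scaleE raddfB.
split => [Q|].
  rewrite (_ : psi Q = fun x => (Num.sqrt ((2 ^ dyadic_scale Q) ^+ n.+1))^-1 *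
    ((g \o f Q) x - run dyadic_scale c ss (fun Q => g \o f Q) Q x)); last exact/funext/psiE.
  by apply: testZ; apply: testB; [exact: (adm_test (adm0 Q))|exact: tR].
rewrite (eq_bigr (fun Q => (\int[mu]_x (h x * ((Num.sqrt ((2 ^ dyadic_scale Q) ^+ n.+1))^-1 *
    ((g \o f Q) x - run dyadic_scale c ss (fun Q => g \o f Q) Q x)))) ^+ 2)); last first.
  by move=> Q _; congr (_ ^+ 2); apply: eq_Rintegral => x _; rewrite psiE.
apply: (le_trans HR); rewrite size_affine_steps /bessel_const.
by rewrite le_eqVlt; apply/predU1P; left; ring.
Qed.

End real_family.
End complex_families.

(** * From real to complex Bessel bounds *)

Section complex_bessel.
Context {R : realType} {n : nat}.
Local Notation V := 'cV[R]_n.+1.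
Local Notation T := (dyadic_cubes R n.+1).
Local Notation mu := (@lebesgue_cV R n.+1).
Local Notation LT := (lebesgueType R n.+1).
Local Notation normc := (@Normc.normc R).
Local Notation Re := (@complex.Re R).
Local Notation Im := (@complex.Im R).

Lemma Re_div_real (z : R[i]) (r : R) : Re (z / r%:C) = r^-1 * Re z.
Proof. by rewrite -fmorphV/=; case: z => a b /=; rewrite mulr0 subr0 mulrC. Qed.

Lemma Im_div_real (z : R[i]) (r : R) : Im (z / r%:C) = r^-1 * Im z.
Proof. by rewrite -fmorphV/=; case: z => a b /=; rewrite mulr0 add0r mulrC. Qed.

Lemma L2_of_tests (f : V -> R[i]) :
  test (fun x => Re (f x)) -> test (fun x => Im (f x)) -> L2 f.
Proof.
move=> tr ti; have [mr _ _] := tr; have [mi _ _] := ti; split; first by split.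
have [mr2 fr2] := test_sqintegrable tr; have [mi2 fi2] := test_sqintegrable ti.
rewrite /L2normsq; under eq_integral do rewrite normc_sqr.
have mR2 : lmeasurable (fun x => Re (f x) ^+ 2) by exact: measurable_funX.
have mI2 : lmeasurable (fun x => Im (f x) ^+ 2) by exact: measurable_funX.
rewrite (integral_EFinD mu mR2 mI2); last 2 first.
- by move=> x; rewrite sqr_ge0.
- by move=> x; rewrite sqr_ge0.
have fin (u : V -> R) : mu.-integrable [set: LT] (fun x => (u x ^+ 2)%:E) ->
    (\int[mu]_x (u x ^+ 2)%:E < +oo)%E.
  move=> /integrableP[_]; under eq_integral do rewrite abse_EFin ger0_norm ?sqr_ge0//.
  by [].
by rewrite lte_add_pinfty// fin.
Qed.

Lemma L2_parts (f : V -> R[i]) : L2 f ->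
  [/\ sqintegrable mu (fun x => Re (f x)), sqintegrable mu (fun x => Im (f x)) &
   L2normsq f = (\int[mu]_x (Re (f x) * Re (f x)) + \int[mu]_x (Im (f x) * Im (f x)))%:E].
Proof.
move=> [[mr mi] f2].
have mR2 : lmeasurable (fun x => Re (f x) ^+ 2) by exact: measurable_funX.
have mI2 : lmeasurable (fun x => Im (f x) ^+ 2) by exact: measurable_funX.
have sR x : 0 <= Re (f x) ^+ 2 by exact: sqr_ge0.
have sI x : 0 <= Im (f x) ^+ 2 by exact: sqr_ge0.
have NE : L2normsq f = (\int[mu]_x (Re (f x) ^+ 2)%:E + \int[mu]_x (Im (f x) ^+ 2)%:E)%E.
  by rewrite /L2normsq; under eq_integral do rewrite normc_sqr; exact: integral_EFinD.
have fR : (\int[mu]_x (Re (f x) ^+ 2)%:E < +oo)%E.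
  apply: le_lt_trans f2; rewrite NE leeDl//.
  by apply: integral_ge0 => x _; rewrite lee_fin.
have fI : (\int[mu]_x (Im (f x) ^+ 2)%:E < +oo)%E.
  apply: le_lt_trans f2; rewrite NE leeDr//.
  by apply: integral_ge0 => x _; rewrite lee_fin.
have int (u : V -> R) : lmeasurable (fun x => u x ^+ 2) ->
    (\int[mu]_x (u x ^+ 2)%:E < +oo)%E -> mu.-integrable [set: LT] (fun x => (u x ^+ 2)%:E).
  move=> mu2 fu; apply/integrableP; split; first exact/measurable_EFinP.
  by under eq_integral do rewrite abse_EFin ger0_norm ?sqr_ge0//.
split; [by split => //; exact: int|by split => //; exact: int|].
rewrite NE EFinD; congr (_ + _)%E.
  rewrite /Rintegral fineK; first by apply: eq_integral => x _; rewrite expr2.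
  under eq_integral do rewrite -expr2.
  by rewrite ge0_fin_numE//; apply: integral_ge0 => x _; rewrite lee_fin.
rewrite /Rintegral fineK; first by apply: eq_integral => x _; rewrite expr2.
under eq_integral do rewrite -expr2.
by rewrite ge0_fin_numE//; apply: integral_ge0 => x _; rewrite lee_fin.
Qed.

(** The complex inner product consists of four real ones, and (p + q)^2 + (r - s)^2 <= 2 (p^2 + q^2
    + r^2 + s^2). *)
Lemma inner_sqr_le (h f : V -> R[i]) : L2 h ->
  test (fun x => Re (f x)) -> test (fun x => Im (f x)) ->
  normc (L2inner h f) ^+ 2 <=
    2 * ((\int[mu]_x (Re (h x) * Re (f x))) ^+ 2 + (\int[mu]_x (Im (h x) * Im (f x))) ^+ 2 +
         (\int[mu]_x (Im (h x) * Re (f x))) ^+ 2 + (\int[mu]_x (Re (h x) * Im (f x))) ^+ 2).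
Proof.
move=> /L2_parts[hr hi _] tr ti.
have fr := test_sqintegrable tr; have fi := test_sqintegrable ti.
rewrite normc_sqr /L2inner /cintegral [complex.Re _]/= [complex.Im _]/=.
rewrite (_ : \int[mu]_x Re (h x * conjc (f x)) =
    \int[mu]_x (Re (h x) * Re (f x)) + \int[mu]_x (Im (h x) * Im (f x))); last first.
  rewrite -(RintegralD measurableT (sqintegrableM hr fr) (sqintegrableM hi fi)).
  by apply: eq_Rintegral => x _; case: (h x) (f x) => a b [a' b'] /=; rewrite mulrN opprK.
rewrite (_ : \int[mu]_x Im (h x * conjc (f x)) =
    \int[mu]_x (Im (h x) * Re (f x)) - \int[mu]_x (Re (h x) * Im (f x))); last first.
  rewrite -(RintegralB measurableT (sqintegrableM hi fr) (sqintegrableM hr fi)).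
  by apply: eq_Rintegral => x _; case: (h x) (f x) => a b [a' b'] /=; ring.
set p := \int[mu]_x _; set q := \int[mu]_x _; set r := \int[mu]_x _; set s := \int[mu]_x _.
have := sqr_ge0 (p - q); have := sqr_ge0 (r + s); lra.
Qed.

Lemma complex_family_bessel (eta : R) (f : T -> V -> R[i]) (A : T -> 'M[R]_n.+1)
    (y : T -> V) :
  0 <= eta <= (24 * n.+1%:R)^-1 -> (forall Q, SNBV0 (val Q) (f Q)) ->
  (forall Q, mx_norm_inf (A Q - 1%:M) + `|y Q| <= eta) ->
  let psi (Q : T) (x : V) : R[i] :=
    (f Q x - perturb (val Q) (A Q) (y Q) (f Q) x) / (Num.sqrt (volume (val Q)))%:C in
  (forall Q, L2 (psi Q)) /\ bessel_bound psi (4 * bessel_const (R := R) (n := n) * eta).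
Proof.
move=> eta01 fS Ay psi.
have real0 (g : {additive R[i] -> R}) := @real_family_bessel R n eta f A y eta01 fS Ay g.
have mRe Q : lmeasurable (Re \o f Q) by have [[[[]]]] := fS Q.
have mIm Q : lmeasurable (Im \o f Q) by have [[[[]]]] := fS Q.
have IRe Q : \int[mu]_x Re (f Q x) = 0 by have [_ []] := fS Q.
have IIm Q : \int[mu]_x Im (f Q x) = 0 by have [_ []] := fS Q.
have HRe h J := real0 (Re : {additive R[i] -> R}) h J (@Re_le_normc R) mRe IRe.
have HIm h J := real0 (Im : {additive R[i] -> R}) h J (@Im_le_normc R) mIm IIm.
(* That the parts of [psi] are test functions comes with the bound of [real_family_bessel]; the zero
   function and the empty list suffice to extract it. *)
have s0 : sqintegrable mu (fun=> 0 : R) by exact: sqintegrable0.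
have psiR Q : (fun x => Re (psi Q x)) = (fun x => (Num.sqrt (volume (val Q)))^-1 *
    Re (f Q x - perturb (val Q) (A Q) (y Q) (f Q) x)).
  by apply/funext => x; rewrite Re_div_real.
have psiI Q : (fun x => Im (psi Q x)) = (fun x => (Num.sqrt (volume (val Q)))^-1 *
    Im (f Q x - perturb (val Q) (A Q) (y Q) (f Q) x)).
  by apply/funext => x; rewrite Im_div_real.
have tR Q : test (fun x => Re (psi Q x)).
  by rewrite psiR; have [+ _] := HRe _ [::] s0 isT; exact.
have tI Q : test (fun x => Im (psi Q x)).
  by rewrite psiI; have [+ _] := HIm _ [::] s0 isT; exact.
have BR h J : sqintegrable mu (h : LT -> R) -> uniq J ->
    \sum_(Q <- J) (\int[mu]_x (h x * Re (psi Q x))) ^+ 2 <=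
      bessel_const (R := R) (n := n) * eta * \int[mu]_x (h x * h x).
  move=> sh uJ; have [_] := HRe _ J sh uJ; apply: le_trans.
  rewrite le_eqVlt; apply/predU1P; left; apply: eq_bigr => Q _; congr (_ ^+ 2).
  by apply: eq_Rintegral => x _; rewrite Re_div_real.
have BI h J : sqintegrable mu (h : LT -> R) -> uniq J ->
    \sum_(Q <- J) (\int[mu]_x (h x * Im (psi Q x))) ^+ 2 <=
      bessel_const (R := R) (n := n) * eta * \int[mu]_x (h x * h x).
  move=> sh uJ; have [_] := HIm _ J sh uJ; apply: le_trans.
  rewrite le_eqVlt; apply/predU1P; left; apply: eq_bigr => Q _; congr (_ ^+ 2).
  by apply: eq_Rintegral => x _; rewrite Im_div_real.
split; first by move=> Q; exact: L2_of_tests.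
have rc0 : 0 <= bessel_const (R := R) (n := n).
  by rewrite mulr_ge0 ?exprn_ge0// mulr_ge0// schur_const_ge0.
have eta0 : 0 <= eta by case/andP: eta01.
split; first by rewrite !mulr_ge0.
move=> h Lh; have [hr hi NE] := L2_parts Lh.
apply: ge_ereal_sup => _ /= [F [finF _] <-].
rewrite NE fsbig_finite//= sumEFin -EFinM lee_fin.
set J := finmap.enum_fset (fset_set F).
have uJ : uniq J by exact: finmap.fset_uniq.
apply: (le_trans (ler_sum _ (fun Q _ => inner_sqr_le Lh (tR Q) (tI Q)))).
rewrite -mulr_sumr !big_split/=.
have h1 := BR _ _ hr uJ; have h2 := BI _ _ hi uJ.
have h3 := BR _ _ hi uJ; have h4 := BI _ _ hr uJ.
set s1 := \sum_(Q <- J) _ in h1 *; set s2 := \sum_(Q <- J) _ in h2 *.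
set s3 := \sum_(Q <- J) _ in h3 *; set s4 := \sum_(Q <- J) _ in h4 *.
move: h1 h2 h3 h4; set K := bessel_const * eta; set a := \int[mu]_x _; set b := \int[mu]_x _.
(* [4 = 2 * 2]: the constant of [inner_sqr_le], and two real families tested on each part of [h]. *)
have -> : 4 * bessel_const (R := R) (n := n) * eta * (a + b) = 4 * (K * a + K * b) by rewrite /K; ring.
lra.
Qed.

End complex_bessel.

Theorem corollary1 (R : realType) (d : nat) (d_gt0 : (0 < d)%N) :
  exists ctilde C : R, [/\ 0 < ctilde, 0 < C &
    forall (eta : R) (f : dyadic_cubes R d -> 'cV[R]_d -> R[i])
           (A : dyadic_cubes R d -> 'M[R]_d) (y : dyadic_cubes R d -> 'cV[R]_d),
      0 <= eta <= ctilde ->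
      (forall Q : dyadic_cubes R d, SNBV0 (val Q) (f Q)) ->
      (forall Q : dyadic_cubes R d,
        mx_norm_inf (A Q - 1%:M) + `|y Q| <= eta) ->
      let psi (Q : dyadic_cubes R d) (x : 'cV[R]_d) : R[i] :=
        (f Q x - perturb (val Q) (A Q) (y Q) (f Q) x)
          / (Num.sqrt (volume (val Q)))%:C in
      bessel psi /\ AO_norm psi <= C * Num.sqrt eta].
Proof.
case: d d_gt0 => [//|n] _.
pose K := 4 * bessel_const (R := R) (n := n).
(* The summand 1 secures positivity without a lower bound on [K]. *)
exists (24 * n.+1%:R)^-1, (Num.sqrt K + 1); split.
- by rewrite invr_gt0 mulr_gt0.
- by rewrite ltr_wpDl ?sqrtr_ge0.
move=> eta f A y eta01 fS Ay psi.
have [L2psi Bpsi] := complex_family_bessel eta01 fS Ay.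
have eta0 : 0 <= eta by case/andP: eta01.
split; first by split => //; exists (K * eta).
apply: (@le_trans _ _ (Num.sqrt (K * eta))).
  rewrite /AO_norm ler_wsqrtr//; apply: ge_inf => //.
  by exists 0 => B [].
have K0 : 0 <= K.
  by rewrite mulr_ge0// mulr_ge0 ?exprn_ge0// mulr_ge0// schur_const_ge0.
by rewrite sqrtrM// ler_wpM2r ?sqrtr_ge0// lerDl.
Qed.
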